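(* Let $\Gamma$ be a free abelian group of finite rank and $\mathfrak{g}=\bigoplus_{\gamma\in\Gamma}\mathfrak{g}_\gamma$ a $\Gamma$-graded Lie algebra over $\mathbf{Q}$. 1) For a fixed quadratic form $Q$ on $\Gamma_{\mathbf{R}}$ there is a natural bijection between the sets $\widehat{\mathrm{Stab}}_Q(\mathfrak{g})$ and $\mathrm{Stab}_Q(\mathfrak{g})$. 2) Any two elements of $\widehat{\mathrm{Stab}}_Q(\mathfrak{g})$ and $\widehat{\mathrm{Stab}}_{Q'}(\mathfrak{g})$ (for quadratic forms $Q,Q'$ on $\Gamma_{\mathbf{R}}$) are equivalent if and only if they define the same element in $\mathrm{Stab}(\mathfrak{g})$.
   Context: $\Gamma_{\mathbf{R}}=\Gamma\otimes\mathbf{R}$; $Z$ also denotes the $\mathbf{R}$-linear extension to $\Gamma_{\mathbf{R}}$ of an additive map $Z:\Gamma\to\mathbf{C}=\mathbf{R}^2$. $Q|_{\mathrm{Ker}\,Z}<0$ means that $Q$ is negative definite on $\mathrm{Ker}(Z:\Gamma_{\mathbf{R}}\to\mathbf{C})$. **Stability data.** $\mathrm{Stab}(\mathfrak{g})$ is the set of pairs $(Z,a)$, where $Z:\Gamma\to\mathbf{C}$ is additive and $a=(a(\gamma))_{\gamma\in\Gamma\setminus\{0\}}$, $a(\gamma)\in\mathfrak{g}_\gamma$, such that for a norm $\|\cdot\|$ on $\Gamma_{\mathbf{R}}$ there is $C>0$ with $\|\gamma\|\le C|Z(\gamma)|$ for all $\gamma\in\mathrm{Supp}\,a=\{\gamma: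 a(\gamma)\ne0\}$. For a quadratic form $Q$ on $\Gamma_{\mathbf{R}}$, $\mathrm{Stab}_Q(\mathfrak{g})\subset\mathrm{Stab}(\mathfrak{g})$ is the subset of those $(Z,a)$ with $Q|_{\mathrm{Ker}\,Z}<0$ and $\mathrm{Supp}\,a\subset\{\gamma\in\Gamma\setminus\{0\}: Q(\gamma)\ge0\}$. One has $\mathrm{Stab}(\mathfrak{g})=\bigcup_Q\mathrm{Stab}_Q(\mathfrak{g})$. **Sectors and groups.** $\mathcal{S}$ is the set of strict sectors in $\mathbf{R}^2$ with vertex at the origin (vertex excluded): sectors of angle less than $180^\circ$, not necessarily open or closed, possibly degenerate (rays). For $V\in\mathcal{S}$ let $C(V,Z,Q)$ be the convex cone generated by $\{x\in\Gamma_{\mathbf{R}}\setminus\{0\}: Z(x)\in V,\ Q(x)\ge0\}$; let $\mathfrak{g}_{V,Z,Q}=\prod_{\gamma\in\Gamma\cap C(V,Z,Q)}\mathfrak{g}_\gamma$, a pro-nilpotent Lie algebra when $Q|_{\mathrm{Ker}\,Z}<0$, and let $G_{V,Z,Q}$ be the corresponding pro-nilpotent group. **The set $\widehat{\mathrm{Stab}}_Q(\mathfrak{g})$** consists of pairs $(Z,A)$, where $Z:\Gamma\to\mathbf{R}^2$ is additive with $Q|_{\mathrm{Ker}\,Z}<0$, and $A=(A_V)_{V\in\mathcal{S}}$ is a collection of elements $A_V\in G_{V,Z,Q}$ satisfying the Factorization Property: whenever a strict sector is decomposed as $V=V_1\sqcup V_2$ into two strict sectors in the clockwise order ($V_1$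 precedes $V_2$), one has $A_V=A_{V_1}A_{V_2}$ in $G_{V,Z,Q}$ (using the natural embeddings $G_{V_i,Z,Q}\to G_{V,Z,Q}$). **Equivalence.** $(Z,A)\in\widehat{\mathrm{Stab}}_Q(\mathfrak{g})$ and $(Z',A')\in\widehat{\mathrm{Stab}}_{Q'}(\mathfrak{g})$ are equivalent if $Z=Z'$ and there is a quadratic form $Q_0$ with $Q\le Q_0$, $Q'\le Q_0$, $Q_0|_{\mathrm{Ker}\,Z}<0$, such that $A_V=A'_V$ as elements of $G_{V,Z,Q_0}$ for all $V\in\mathcal{S}$ (if $Q\le Q_0$ and both forms are negative on $\mathrm{Ker}\,Z$, then $G_{V,Z,Q}\subset G_{V,Z,Q_0}$). **Meaning of ''define''.** A pair $(Z,A)\in\widehat{\mathrm{Stab}}_Q(\mathfrak{g})$ defines the pair $(Z,a)$ with the same $Z$, where $a(\gamma)=0$ if $Z(\gamma)=0$, and otherwise $a(\gamma)$ is the $\mathfrak{g}_\gamma$-component of $\log A_l$ for the ray $l=\mathbf{R}_{>0}Z(\gamma)$. *)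

(* Defs.v *)
From HB Require Import structures.
From mathcomp Require Import all_boot all_order all_algebra.
From mathcomp Require Import all_classical all_reals all_analysis.

Set Implicit Arguments.
Unset Strict Implicit.
Unset Printing Implicit Defensive.

Import Order.TTheory GRing.Theory Num.Theory.

Local Open Scope classical_set_scope.
Local Open Scope ring_scope.

Definition Zbasis (Gam : zmodType) (n : nat) (b : n.-tuple Gam) : Prop :=
  forall x : Gam, exists! c : 'rV[int]_n, x = \sum_(i < n) tnth b i *~ c 0 i.

(** [iota : Gam -> E] exhibits [Gam] as a free abelian group of finite rank
    and [E] as its real span [Gam (x) R], with [iota x = x (x) 1]. *)
Definition real_span (R : realType) (Gam : zmodType) (E : vectType R)
    (iota : {additive Gam -> E}) : Prop :=
  exists (n : nat) (b : n.-tuple Gam),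
    Zbasis b /\ basis_of fullv [seq iota x | x <- b].

Definition is_norm (R : realType) (E : lmodType R) (N : E -> R) : Prop :=
  [/\ forall x, 0 <= N x,
      forall x, N x = 0 -> x = 0,
      forall (t : R) x, N (t *: x) = `|t| * N x &
      forall x y, N (x + y) <= N x + N y].

Definition quadratic_form (R : realType) (E : lmodType R) (Q : E -> R) : Prop :=
  (forall (t : R) x, Q (t *: x) = t ^+ 2 * Q x) /\
  (forall x, scalar (fun y => Q (x + y) - Q x - Q y)).

Definition plane (R : realType) := (R^o * R^o)%type.

Definition modulus (R : realType) (v : plane R) : R :=
  Num.sqrt (v.1 ^+ 2 + v.2 ^+ 2).

(** The sector with polar angles in the nonempty interval of endpoints
    [t1, t2], of length less than [pi]; the booleans [c1, c2] select closed or
    open ends, and the case [t1 = t2] gives the rays. *)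
Definition strict_sector (R : realType) (V : set (plane R)) : Prop :=
  exists (c1 c2 : bool) (t1 t2 : R),
    let I := Interval (BSide c1 t1) (BSide c2 t2) in
    [/\ t2 - t1 < pi, (exists t, t \in I) &
        V = [set v | exists r t : R,
               [/\ 0 < r, t \in I & v = (r * cos t, r * sin t)]]].

Definition sector (R : realType) := {V : set (plane R) | strict_sector V}.

(** Inside a strict sector, [v] is reached from [u] by a clockwise turn iff
    [det (u, v) < 0]. *)
Definition clockwise_split (R : realType) (V V1 V2 : sector R) : Prop :=
  [/\ sval V = sval V1 `|` sval V2,
      sval V1 `&` sval V2 = set0 &
      forall u v : plane R, sval V1 u -> sval V2 v ->
        u.1 * v.2 - u.2 * v.1 < 0].

Definition ray (R : realType) (v : plane R) : set (plane R) :=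
  [set r *: v | r in [set r : R | 0 < r]].

Lemma polar_exists (R : realType) (v : plane R) : v != 0 ->
  exists r t : R, 0 < r /\ v = (r * cos t, r * sin t).
Proof.
case: v => x y v0; pose r := Num.sqrt (x ^+ 2 + y ^+ 2).
have s0 : 0 < x ^+ 2 + y ^+ 2.
  rewrite lt_def paddr_eq0 ?sqr_ge0// !sqrf_eq0 addr_ge0 ?sqr_ge0// andbT.
  by apply: contra v0 => /andP[/eqP -> /eqP ->].
have r0 : 0 < r by rewrite sqrtr_gt0.
have rn : r != 0 by rewrite gt_eqF.
have rr : r ^+ 2 = x ^+ 2 + y ^+ 2 by rewrite sqr_sqrtr// ltW.
have xr : -1 <= x / r <= 1.
  rewrite -ler_norml normrM normfV (gtr0_norm r0) ler_pdivrMr// mul1r.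
  by rewrite -(sqrtr_sqr x) ler_wsqrtr// lerDl sqr_ge0.
have yr : Num.sqrt (1 - (x / r) ^+ 2) = `|y| / r.
  have -> : 1 - (x / r) ^+ 2 = (y / r) ^+ 2.
    apply/eqP; rewrite subr_eq !expr_div_n -mulrDl addrC -rr divff//.
    by rewrite expf_neq0.
  by rewrite sqrtr_sqr normrM normfV (gtr0_norm r0).
have [y0|y0] := leP 0 y.
- exists r, (acos (x / r)); split=> //.
  rewrite acosK ?in_itv//= sin_acos// yr (ger0_norm y0).
  by rewrite ![r * (_ / r)]mulrC !divfK.
- exists r, (- acos (x / r)); split=> //.
  rewrite cosN sinN acosK ?in_itv//= sin_acos// yr (ltr0_norm y0) mulNr opprK.
  by rewrite ![r * (_ / r)]mulrC !divfK.
Qed.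

Lemma ray_strict_sector (R : realType) (v : plane R) :
  v != 0 -> strict_sector (ray v).
Proof.
move=> /polar_exists[r [t [r0 ->]]]; exists true, false, t, t => I.
split; first by rewrite subrr pi_gt0.
  by exists t; rewrite in_itv/= lexx.
apply/seteqP; split=> [w [s /= s0 <-]|w [s [u [s0]]]].
  exists (s * r), t; split; rewrite ?mulr_gt0 ?in_itv/= ?lexx//.
  by rewrite -!mulrA.
rewrite in_itv/= -eq_le => /eqP <- ->.
exists (s / r); first by rewrite /= divr_gt0.
congr pair; rewrite /= /GRing.scale/= mulrA divfK ?gt_eqF//.
Qed.

Definition ray_sector (R : realType) (v : plane R) (v0 : v != 0) : sector R :=
  exist _ (ray v) (ray_strict_sector v0).

Record gradedLie (Gam : zmodType) := GradedLie {
  lie_sort :> lmodType rat;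
  lie_br : lie_sort -> lie_sort -> lie_sort;
  lie_piece : Gam -> set lie_sort;
  lie_linearr : forall x, linear (lie_br x);
  lie_linearl : forall y, linear (lie_br ^~ y);
  lie_alt : forall x, lie_br x x = 0;
  lie_jacobi : forall x y z,
    lie_br x (lie_br y z) + lie_br y (lie_br z x) + lie_br z (lie_br x y) = 0;
  lie_piece0 : forall k, lie_piece k 0;
  lie_piece_lin : forall k (q : rat) x y,
    lie_piece k x -> lie_piece k y -> lie_piece k (q *: x + y);
  lie_piece_br : forall k l x y,
    lie_piece k x -> lie_piece l y -> lie_piece (k + l) (lie_br x y);
  lie_direct_sum : forall x : lie_sort, exists! c : Gam -> lie_sort,
    [/\ forall k, lie_piece k (c k), finite_set [set k | c k != 0] &
        x = \sum_(k \in [set: Gam]) c k]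
}.

(** Elements of a product of graded pieces are families [x : Gam -> g] with
    [x k] in the piece of degree [k].  The sums [\sum_(_ \in setT)] below have
    finite support for families supported on the lattice points of a cone
    [cone iota V Z Q] with [Q] negative definite on [Ker Z]; they are 0 by
    convention when the support is infinite. *)

Section GroupLaw.
Variables (Gam : zmodType) (g : gradedLie Gam).

Definition fam_br (x y : Gam -> g) : Gam -> g :=
  fun k => \sum_(l \in [set: Gam]) lie_br (x l) (y (k - l)).

(** Words in two letters: [false] stands for X and [true] for Y. *)

Fixpoint bracket_word (x y : Gam -> g) (w : seq bool) : Gam -> g :=
  match w with
  | [::] => fun=> 0
  | [:: c] => if c then y else x
  | c :: w' => fam_br (if c then y else x) (bracket_word x y w')
  end.

(** Coefficient of [w] in [exp X * exp Y]. *)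
Definition expXexpY_coef (w : seq bool) : rat :=
  let r := count_mem false w in
  let s := count_mem true w in
  if w == nseq r false ++ nseq s true then (r`! * s`!)%:R^-1 else 0.

(** Coefficient of [w] in [(exp X * exp Y - 1) ^ k]. *)
Fixpoint pow_coef (k : nat) (w : seq bool) : rat :=
  if k is k'.+1 then
    \sum_(1 <= i < (size w).+1) expXexpY_coef (take i w) * pow_coef k' (drop i w)
  else (w == [::])%:R.

(** Coefficient of [w] in [log (exp X * exp Y)]. *)
Definition log_coef (w : seq bool) : rat :=
  \sum_(1 <= k < (size w).+1) (-1) ^+ k.-1 / k%:R * pow_coef k w.

(** The Baker-Campbell-Hausdorff product [log (exp x * exp y)], in Dynkin's
    form: a word [w] of length [n] is replaced by [1/n] times its
    right-nested bracket. *)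
Definition bch (x y : Gam -> g) : Gam -> g :=
  fun k => \sum_(n \in [set: nat])
    n%:R^-1 *: \sum_(w : n.-tuple bool) log_coef w *: bracket_word x y w k.

End GroupLaw.

Section Stability.
Variables (R : realType) (Gam : zmodType) (E : vectType R).
Variables (iota : {additive Gam -> E}) (g : gradedLie Gam).

(** The R-linear extension of an additive [Z]; it exists and is unique under
    [real_span iota]. *)
Definition lin_ext (Z : Gam -> plane R) (x : E) : plane R :=
  xget 0 [set v | exists f : {linear E -> plane R},
                    (forall k, f (iota k) = Z k) /\ f x = v].

Definition neg_on_ker (Q : E -> R) (Z : Gam -> plane R) : Prop :=
  forall x : E, x != 0 -> lin_ext Z x = 0 -> Q x < 0.

Definition nonzero := {k : Gam | k != 0}.

(** All norms on [E] being equivalent, the choice of [N] is immaterial. *)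
Definition Stab : set ((Gam -> plane R) * (nonzero -> g)) :=
  [set Za | [/\ zmod_morphism Za.1,
    forall k, lie_piece (sval k) (Za.2 k) &
    exists N : E -> R, is_norm N /\
      exists C : R, 0 < C /\
        forall k, Za.2 k != 0 -> N (iota (sval k)) <= C * modulus (Za.1 (sval k))]].

Definition StabQ (Q : E -> R) : set ((Gam -> plane R) * (nonzero -> g)) :=
  [set Za | [/\ Stab Za, neg_on_ker Q Za.1 &
    forall k, Za.2 k != 0 -> 0 <= Q (iota (sval k))]].

(** Convex cone generated by [S]: no vertex is added, so that [0] is not in
    the cones [cone V Z Q] below. *)
Inductive cone_hull (S : set E) : E -> Prop :=
| cone_gen x : S x -> cone_hull S x
| cone_add x y : cone_hull S x -> cone_hull S y -> cone_hull S (x + y)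
| cone_scale (t : R) x : 0 < t -> cone_hull S x -> cone_hull S (t *: x).

Definition cone (V : sector R) (Z : Gam -> plane R) (Q : E -> R) : set E :=
  cone_hull [set x | [/\ x != 0, sval V (lin_ext Z x) & 0 <= Q x]].

(** The product of the pieces [g_k] over the lattice points [k] of the cone,
    as families extended by [0].  With the bracket [fam_br] it is the Lie
    algebra g_{V,Z,Q}; with the product [bch] it is the group G_{V,Z,Q}, whose
    elements are thus represented by their logarithms.  The embeddings between
    these groups for varying V and Q are inclusions of sets of families. *)
Definition G_ (V : sector R) (Z : Gam -> plane R) (Q : E -> R) : set (Gam -> g) :=
  [set x | forall k, lie_piece k (x k) /\ (x k != 0 -> cone V Z Q (iota k))].

(** The identity, since group elements are represented by their logarithms. *)
Definition log_G (A : Gam -> g) : Gam -> g := A.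

(** No embedding appears in the factorization property: [bch] does not depend
    on V or Q. *)
Definition hatStabQ (Q : E -> R) :
    set ((Gam -> plane R) * (sector R -> Gam -> g)) :=
  [set ZA | [/\ zmod_morphism ZA.1, neg_on_ker Q ZA.1,
    forall V, G_ V ZA.1 Q (ZA.2 V) &
    forall V V1 V2, clockwise_split V V1 V2 ->
      ZA.2 V = bch (ZA.2 V1) (ZA.2 V2)]].

Definition hat_equiv (Q Q' : E -> R)
    (ZA ZA' : (Gam -> plane R) * (sector R -> Gam -> g)) : Prop :=
  ZA.1 = ZA'.1 /\
  exists Q0 : E -> R,
    [/\ quadratic_form Q0,
        forall x, Q x <= Q0 x,
        forall x, Q' x <= Q0 x,
        neg_on_ker Q0 ZA.1 &
        forall V, [/\ G_ V ZA.1 Q0 (ZA.2 V), G_ V ZA.1 Q0 (ZA'.2 V) &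
                      ZA.2 V = ZA'.2 V]].

Definition defines (ZA : (Gam -> plane R) * (sector R -> Gam -> g)) :
    (Gam -> plane R) * (nonzero -> g) :=
  (ZA.1, fun k : nonzero =>
    match boolP (ZA.1 (sval k) != 0) with
    | AltTrue Zk0 => log_G (ZA.2 (ray_sector Zk0)) (sval k)
    | AltFalse _ => 0
    end).

End Stability.

(* Main.v *)
Require Import Defs.
From HB Require Import structures.
From mathcomp Require Import all_boot all_order all_algebra.
From mathcomp Require Import zify ring lra.
From mathcomp Require Import all_classical all_reals all_analysis.

(** A collection [A] with the factorization property is determined by its
    values on rays: below a given degree only finitely many lattice points of
    the cone of a sector matter, and cutting the sector along the rays through
    them expresses the component of [A_V] as a clockwise ordered product of
    ray elements. Conversely these ordered products define a collection from
    any [a]; the factorization property is associativity of the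
    Baker-Campbell-Hausdorff product.

    The group law is given by Dynkin's formula, so associativity has to be
    proved for it. The logarithm of a unipotent automorphism is a derivation,
    and on a graded Lie algebra extended by its degree derivation [d] such a
    derivation is inner, the element being read off from its value at [d].
    Applied to [exp (ad x) exp (ad y)] this gives Dynkin's formula together
    with [exp (ad (bch x y)) = exp (ad x) exp (ad y)], and associativity
    follows because the adjoint representation on the extensions by degree
    derivations is faithful.

    Finiteness and the support property come from one compactness argument:
    if [Q] is negative on [Ker Z] then [C |Z|^2 - Q] is positive definite for
    large [C]. *)

Set Implicit Arguments.
Unset Strict Implicit.
Unset Printing Implicit Defensive.

Import Order.TTheory GRing.Theory Num.Theory.
Import numFieldNormedType.Exports.

Local Open Scope classical_set_scope.
Local Open Scope ring_scope.

(** * Exponentials and logarithms of nilpotent elements *)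

(** Two obstacles shape the algebra: the group lives in an infinite product of pieces, and the
    adjoint representation of [g] may have a kernel. The first is met one degree at a time: the
    component at [k] of a [bch] product involves only the finitely many [divs S k], and the families
    truncated to them form a nilpotent Lie algebra, where exponentials and logarithms are finite
    sums. The second is met by choosing, for each [k], an additive [phi] with [phi k != 0]: the
    derivation it defines makes the component at [k] visible. A logarithm is read off from [s ^+ n]
    being polynomial in [n]; its uniqueness, the formula [s = exp D] and the Leibniz rule for the
    logarithm of an automorphism all come from comparing coefficients of powers of [n]. For the
    second claim, both collections are placed in [hatStabQ] for one form [Q0] above [Q] and [Q'],
    where injectivity of [defines] applies; the point is to construct [Q0]. *)

Lemma sum_widen (V : zmodType) (m n : nat) (F : nat -> V) :
  (m <= n)%N -> (forall i, (m <= i)%N -> F i = 0) ->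
  \sum_(i < n) F i = \sum_(i < m) F i.
Proof.
move=> mn F0; rewrite -!(big_mkord xpredT F) (@big_cat_nat _ _ _ m)//=.
by rewrite [X in _ + X]big_nat_cond [X in _ + X]big1 ?addr0// => i /andP[/andP[/F0]].
Qed.

(** Cauchy product of two truncated series: the terms beyond the triangle vanish, so truncation is
    compatible with products. *)
Lemma sum_triangle (V : zmodType) (m : nat) (F : nat -> nat -> V) :
  (forall i j, (m <= i + j)%N -> F i j = 0) ->
  \sum_(n < m) \sum_(i < n.+1) F i (n - i)%N = \sum_(i < m) \sum_(j < m) F i j.
Proof.
move=> F0.
have -> : \sum_(i < m) \sum_(j < m) F i j = \sum_(i < m) \sum_(j < m - i) F i j.
  apply: eq_bigr => i _; apply: sum_widen; first exact: leq_subr.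
  by move=> j; rewrite leq_subLR; exact: F0.
elim: m {F0} => [|m IHm]; first by rewrite !big_ord0.
rewrite big_ord_recr [RHS]big_ord_recr/= IHm subSnn [X in _ + X = _]big_ord_recr/=.
rewrite addrA subnn; congr (_ + _); last by rewrite big_ord1.
rewrite -big_split/=; apply: eq_bigr => i _.
by rewrite subSn ?(ltnW (ltn_ord i))// big_ord_recr.
Qed.

Section ExpLog.

(** The Vandermonde matrix of the nodes 0, ..., m - 1 is invertible and its inverse extracts each
    coefficient. This is what allows comparing coefficients of powers of [n]. *)
Lemma poly_family_eq0 (V : lmodType rat) (m : nat) (v : nat -> V) :
  (forall n : nat, \sum_(i < m) (n%:R ^+ i : rat) *: v i = 0) ->
  forall i, (i < m)%N -> v i = 0.
Proof.
move=> v0 i im.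
pose a : 'rV[rat]_m := \row_j (j : nat)%:R.
have Vu : Vandermonde m a \in unitmx.
  rewrite unitmxE unitfE det_Vandermonde; apply/prodf_neq0 => j _.
  apply/prodf_neq0 => k jk; rewrite !mxE subr_eq0 eqr_nat.
  by apply: contraTN jk => /eqP ->; rewrite ltnn.
pose B := invmx (Vandermonde m a); pose i0 := Ordinal im.
have : \sum_(j < m) B j i0 *: (\sum_(k < m) ((j : nat)%:R ^+ k : rat) *: v k) = 0.
  by apply: big1 => j _; rewrite v0 scaler0.
under eq_bigr => j _ do rewrite scaler_sumr.
rewrite exchange_big/= (bigD1 i0)//= [X in _ + X]big1 => [|k ki0]; last first.
  under eq_bigr => j _ do rewrite scalerA.
  rewrite -scaler_suml.
  have := congr1 (fun M : 'M[rat]_m => M k i0) (mulmxV Vu); rewrite !mxE (negbTE ki0).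
  under eq_bigr => j _ do rewrite !mxE mulrC.
  by move=> ->; rewrite scale0r.
under eq_bigr => j _ do rewrite scalerA.
rewrite addr0 -scaler_suml.
have := congr1 (fun M : 'M[rat]_m => M i0 i0) (mulmxV Vu); rewrite !mxE eqxx.
under eq_bigr => j _ do rewrite !mxE mulrC.
by move=> ->; rewrite scale1r.
Qed.

Variable A : algType rat.
Implicit Types a b u s D : A.

Definition expA m a : A := \sum_(i < m) (i`!%:R^-1 : rat) *: a ^+ i.

Definition logA m u : A :=
  \sum_(1 <= k < m) ((-1) ^+ k.-1 / k%:R : rat) *: u ^+ k.

(** [D] is the derivative at [0] of [n |-> s ^+ n], which is required to be
    polynomial in [n]; for [s] unipotent this is the logarithm. *)
Definition log_of s D : Prop :=
  exists (m : nat) (c : nat -> A),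
    [/\ forall i, (m <= i)%N -> c i = 0, c 0%N = 1, c 1%N = D &
        forall n : nat, s ^+ n = \sum_(i < m) (n%:R ^+ i : rat) *: c i].

Lemma expr0_ge a m i : a ^+ m = 0 -> (m <= i)%N -> a ^+ i = 0.
Proof. by move=> am mi; rewrite -(subnKC mi) exprD am mul0r. Qed.

Lemma expA_widen m n a : a ^+ m = 0 -> (m <= n)%N -> expA n a = expA m a.
Proof.
move=> am mn.
apply: (@sum_widen _ _ _ (fun i => (i`!%:R^-1 : rat) *: a ^+ i)) => // i mi.
by rewrite (expr0_ge am mi) scaler0.
Qed.

Lemma fact_neq0 n : n`!%:R != 0 :> rat.
Proof. by rewrite pnatr_eq0 -lt0n fact_gt0. Qed.

Lemma binomial_factV n i : (i <= n)%N ->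
  (n`!%:R^-1 * 'C(n, i)%:R : rat) = i`!%:R^-1 * (n - i)`!%:R^-1.
Proof.
move=> le_in; rewrite -invfM -natrM -[LHS]invrK invfM invrK.
congr (_^-1); rewrite -(bin_fact le_in) natrM.
by rewrite [_%:R * _]mulrC mulfK// pnatr_eq0 -lt0n bin_gt0.
Qed.

Lemma expA_mulr m a (p q : rat) : a ^+ m = 0 ->
  expA m (p *: a) * expA m (q *: a) = expA m ((p + q) *: a).
Proof.
move=> am; rewrite /expA mulr_suml.
under eq_bigr => i _ do rewrite mulr_sumr.
rewrite -(@sum_triangle _ m (fun i j => (i`!%:R^-1 *: (p *: a) ^+ i) *
    ((j`!%:R^-1 : rat) *: (q *: a) ^+ j))); last first.
  move=> i j mij; rewrite -scalerAl -scalerAr !exprZn -scalerAl -scalerAr -exprD.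
  by rewrite (expr0_ge am mij) !scaler0.
apply: eq_bigr => n _; rewrite exprZn [p + q]addrC exprDn.
rewrite scaler_suml scaler_sumr; apply: eq_bigr => i _.
rewrite -scalerAl -scalerAr !exprZn -scalerAl -scalerAr -exprD !scalerA.
have le_in : (i <= n)%N by rewrite -ltnS.
rewrite subnKC//; congr (_ *: _).
rewrite -[X in _ = _ * X]mulr_natr [X in _ = _ * X]mulrC mulrA binomial_factV//.
by rewrite -mulrA; congr (_ * _); rewrite mulrC.
Qed.

Lemma expA_expn m a n : a ^+ m = 0 -> expA m a ^+ n = expA m ((n%:R : rat) *: a).
Proof.
move=> am; elim: n => [|n IHn].
  rewrite expr0 scale0r /expA; case: m am => [|m am].
    by rewrite expr0 => <-; rewrite big_ord0.
  rewrite big_ord_recl big1 ?addr0 ?expr0 ?invr1 ?scale1r// => i _.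
  by rewrite expr0n scaler0.
by rewrite exprSr IHn -{2}[a]scale1r expA_mulr// -natr1.
Qed.

Lemma log_of_expA m a : a ^+ m = 0 -> log_of (expA m a) a.
Proof.
move=> am; exists m, (fun i => (i`!%:R^-1 : rat) *: a ^+ i); split.
- by move=> i mi; rewrite (expr0_ge am mi) scaler0.
- by rewrite expr0 invr1 scale1r.
- by rewrite expr1 invr1 scale1r.
- move=> n; rewrite expA_expn//; apply: eq_bigr => i _.
  by rewrite exprZn !scalerA mulrC.
Qed.

(** The binomial coefficient of [X] over [k] as a polynomial. Its linear coefficient is that of the
    series of log (1 + u). *)
Let binP k : {poly rat} := (k`!%:R^-1 : rat) *: \prod_(i < k) ('X - (i : nat)%:R%:P).

Let size_binP k : (size (binP k) <= k.+1)%N.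
Proof.
by rewrite (leq_trans (size_scale_leq _ _))// size_prod_XsubC /index_enum -enumT size_enum_ord.
Qed.

Let horner_binP k n : (binP k).[n%:R] = 'C(n, k)%:R.
Proof.
rewrite hornerZ horner_prod; under eq_bigr => i _ do rewrite hornerXsubC.
suff -> : \prod_(i < k) (n%:R - (i : nat)%:R : rat) = (n ^_ k)%:R.
  by rewrite -bin_ffact natrM mulrC mulfK// fact_neq0.
rewrite ffact_prod natr_prod.
have [nk|kn] := ltnP n k; last first.
  by apply: eq_bigr => i _; rewrite natrB// (leq_trans _ kn)// ltnW.
transitivity (0 : rat); last apply/esym.
  by apply/eqP/prodf_eq0; exists (Ordinal nk); rewrite //= subrr.
by apply/eqP/prodf_eq0; exists (Ordinal nk); rewrite //= subnn.
Qed.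

Let coef_binP0 k : (binP k)`_0 = (k == 0%N)%:R.
Proof. by rewrite -horner_coef0 (horner_binP k 0) bin0n. Qed.

Let coef_binP1 k : (binP k)`_1 = if k == 0%N then 0 else (-1) ^+ k.-1 / k%:R.
Proof.
case: k => [|k]; first by rewrite /binP big_ord0 coefZ coef1 mulr0.
rewrite /binP coefZ big_ord_recl subr0 coefXM/= -horner_coef0 horner_prod.
under eq_bigr => i _ do rewrite hornerXsubC sub0r.
rewrite prodrN card_ord mulrCA; congr (_ * _).
have -> : \prod_(i < k) ((lift ord0 i : nat)%:R : rat) = k`!%:R.
  rewrite fact_prod big_add1 -natr_prod big_mkord.
  by congr (_%:R); apply: eq_bigr.
by rewrite factS natrM invfM -mulrA mulVf ?mulr1 ?fact_neq0.
Qed.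

(** By the binomial theorem, (1 + u)^n is the sum of ['C(n, k)] u^k, which is polynomial in [n]
    because [u] is nilpotent; the linear coefficients of the binomial polynomials give the
    logarithmic series. *)
Lemma log_of_logA m u : u ^+ m = 0 -> log_of (1 + u) (logA m u).
Proof.
move=> um; exists m, (fun i => \sum_(k < m) (binP k)`_i *: u ^+ k); split.
- move=> i mi; apply: big1 => k _; rewrite nth_default ?scale0r//.
  by rewrite (leq_trans (size_binP k))// (leq_trans _ mi).
- case: m um => [|m um]; first by rewrite expr0 => ->; rewrite big_ord0.
  rewrite big_ord_recl big1 => [|i _]; rewrite coef_binP0 ?scale0r//.
  by rewrite addr0 scale1r.
- rewrite /logA; case: m um => [|m um]; first by rewrite big_ord0 big_geq.
  rewrite big_ord_recl coef_binP1 scale0r add0r big_add1/= big_mkord.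
  by apply: eq_bigr => i _; rewrite coef_binP1.
- move=> n; rewrite addrC exprD1n.
  transitivity (\sum_(k < m) ('C(n, k)%:R : rat) *: u ^+ k).
    (* The ranges [m] and [n.+1] are both widened to [N]: [u ^+ k] vanishes from [m] on, and
       ['C(n, k)] from [n.+1] on. *)
    have E N : (m <= N)%N -> (n.+1 <= N)%N ->
        \sum_(k < m) ('C(n, k)%:R : rat) *: u ^+ k =
        \sum_(i < n.+1) u ^+ i *+ 'C(n, i).
      move=> mN nN; rewrite -(@sum_widen _ m N (fun k => ('C(n, k)%:R : rat) *: u ^+ k))//.
        under [RHS]eq_bigr => i _ do rewrite -scaler_nat.
        rewrite -[RHS](@sum_widen _ _ N (fun k => ('C(n, k)%:R : rat) *: u ^+ k))//.
        by move=> k nk; rewrite bin_small// scale0r.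
      by move=> k mk; rewrite (expr0_ge um mk) scaler0.
    by rewrite (E (m + n.+1)%N) ?leq_addr ?leq_addl.
  under [RHS]eq_bigr => i _ do rewrite scaler_sumr.
  rewrite exchange_big/=; apply: eq_bigr => k _.
  under eq_bigr => i _ do rewrite scalerA.
  rewrite -scaler_suml -horner_binP (@horner_coef_wide _ m).
    by under eq_bigr => i _ do rewrite mulrC.
  by rewrite (leq_trans (size_binP k)).
Qed.

Lemma log_of_inj s D D' : log_of s D -> log_of s D' -> D = D'.
Proof.
move=> [m [c [cm c0 <- cE]]] [m' [c' [cm' c0' <- cE']]]; apply/eqP.
rewrite -subr_eq0; apply/eqP.
apply: (@poly_family_eq0 _ (m + m' + 2) (fun i => c i - c' i)) => [n|]; last first.
  by rewrite addn2.
under eq_bigr => i _ do rewrite scalerBr.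
rewrite big_split/= sumrN.
rewrite (@sum_widen _ m _ (fun i => (n%:R ^+ i : rat) *: c i)); last first.
- by move=> i /cm ->; rewrite scaler0.
- by rewrite -addnA leq_addr.
rewrite (@sum_widen _ m' _ (fun i => (n%:R ^+ i : rat) *: c' i)); last first.
- by move=> i /cm' ->; rewrite scaler0.
- by rewrite addnAC leq_addl.
by rewrite -cE -cE' subrr.
Qed.

(** The coefficients are forced to be [D ^+ i] divided by i!, as for a one-parameter group
    determined by its derivative at 0. *)
Lemma log_ofP s D : log_of s D -> exists m, forall p, (m <= p)%N ->
  [/\ D ^+ p = 0, s = expA p D & forall n : nat,
    s ^+ n = \sum_(i < p) (n%:R ^+ i : rat) *: ((i`!%:R^-1 : rat) *: D ^+ i)].
Proof.
move=> [m [c [cm c0 c1 cE]]].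
have cE' p n : (m <= p)%N -> s ^+ n = \sum_(i < p) (n%:R ^+ i : rat) *: c i.
  move=> mp; rewrite cE.
  rewrite -(@sum_widen _ _ p (fun i => (n%:R ^+ i : rat) *: c i))// => i mi.
  by rewrite cm// scaler0.
have cS j : j.+1%:R *: c j.+1 = D * c j :> A.
  pose M := (m + j).+2.
  (* Coefficient of n^i in s^(n + p) = s^n s^p. For i = 1 it says that the derivative of s^p in [p]
     is D s^p, and comparing powers of [p] gives the recursion [cS]. *)
  have coefM p i : (i < M)%N ->
      \sum_(k < M) ('C(k, i)%:R * p%:R ^+ (k - i) : rat) *: c k = c i * s ^+ p.
    move=> iM; apply/eqP; rewrite -subr_eq0; apply/eqP; move: i iM.
    apply: (@poly_family_eq0 _ M (fun i =>
      \sum_(k < M) ('C(k, i)%:R * p%:R ^+ (k - i) : rat) *: c k - c i * s ^+ p)).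
    move=> n; under eq_bigr => i _ do rewrite scalerBr scaler_sumr.
    rewrite big_split/= sumrN; apply/eqP; rewrite subr_eq0; apply/eqP.
    transitivity (s ^+ n * s ^+ p); last first.
      rewrite (cE' M) ?mulr_suml; last by rewrite /M; lia.
      by apply: eq_bigr => i _; rewrite scalerAl.
    rewrite -exprD (cE' M); last by rewrite /M; lia.
    rewrite exchange_big/=; apply: eq_bigr => k _.
    under eq_bigr => i _ do rewrite scalerA.
    rewrite -scaler_suml natrD addrC exprDn; congr (_ *: _).
    rewrite -(@sum_widen _ _ M (fun i => (p%:R ^+ (k - i) * n%:R ^+ i : rat) *+ 'C(k, i)))//.
      by apply: eq_bigr => i _; rewrite -[RHS]mulr_natl mulrCA; congr (_ * _); rewrite mulrC.
    by move=> i ki; rewrite bin_small.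
  apply/eqP; rewrite -subr_eq0; apply/eqP.
  apply: (@poly_family_eq0 _ M (fun j => j.+1%:R *: c j.+1 - D * c j)); last first.
    by rewrite /M; lia.
  move=> p; under eq_bigr => i _ do rewrite scalerBr.
  rewrite big_split/= sumrN; apply/eqP; rewrite subr_eq0; apply/eqP.
  transitivity (D * s ^+ p); last first.
    rewrite (cE' M) ?mulr_sumr; last by rewrite /M; lia.
    by apply: eq_bigr => i _; rewrite scalerAr.
  rewrite -c1 -coefM// [RHS]big_ord_recl bin0n mul0r scale0r add0r.
  rewrite big_ord_recr/= cm ?scaler0 ?addr0; last by rewrite /M; lia.
  rewrite /M; apply: eq_bigr => i _.
  by rewrite /bump/= bin1 add1n subn1/= scalerA mulrC.
have cD j : c j = (j`!%:R^-1 : rat) *: D ^+ j.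
  elim: j => [|j IHj]; first by rewrite c0 expr0 invr1 scale1r.
  have := cS j; rewrite IHj -scalerAr -exprS => /(congr1 ( *:%R j.+1%:R^-1)).
  by rewrite !scalerA mulVf ?pnatr_eq0// scale1r factS natrM invfM.
exists m => p mp; split.
- have := cm p mp; rewrite cD => /eqP; rewrite scaler_eq0 invr_eq0.
  by rewrite (negbTE (fact_neq0 _)) => /eqP.
- rewrite -[LHS]expr1 (cE' p)//; apply: eq_bigr => i _.
  by rewrite expr1n scale1r cD.
- by move=> n; rewrite (cE' p)//; apply: eq_bigr => i _; rewrite cD.
Qed.

Lemma log_of_fun s s' D : log_of s D -> log_of s' D -> s = s'.
Proof.
move=> /log_ofP[m /(_ (m + _)%N) H] /log_ofP[m' /(_ (_ + m')%N) H'].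
have [//|_ -> _] := H m'; first exact: leq_addr.
by have [//|_ -> _] := H' m; first exact: leq_addl.
Qed.

End ExpLog.

(** * Noncommutative power series in two letters *)

Lemma sum_tuple_cons (V : zmodType) n (F : seq bool -> V) :
  \sum_(w : n.+1.-tuple bool) F w =
  \sum_(w : n.-tuple bool) F (false :: w) + \sum_(w : n.-tuple bool) F (true :: w).
Proof.
rewrite (reindex (fun p : bool * n.-tuple bool => [tuple of p.1 :: p.2])); last first.
  exists (fun w => (thead w, [tuple of behead w])) => [[c w] _|w _] /=.
    by congr pair; apply/val_inj.
  by rewrite [RHS]tuple_eta; apply/val_inj.
rewrite -(pair_big xpredT xpredT (fun c (w : n.-tuple bool) => F (c :: w)))/=.
by rewrite big_bool addrC.
Qed.

Lemma sum_tuple0 (V : zmodType) (F : seq bool -> V) :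
  \sum_(w : 0.-tuple bool) F w = F [::].
Proof.
by rewrite (bigD1 [tuple])//= big1 ?addr0// => w /eqP[]; exact: tuple0.
Qed.

(** Coefficients of the product of two noncommutative series. *)
Definition word_conv (c c' : seq bool -> rat) (w : seq bool) : rat :=
  \sum_(i < (size w).+1) c (take i w) * c' (drop i w).

Lemma conv_cons c c' x w :
  word_conv c c' (x :: w) = c [::] * c' (x :: w) + word_conv (fun v => c (x :: v)) c' w.
Proof. by rewrite /word_conv big_ord_recl. Qed.

Section Words.
Variables (A : algType rat) (a b : A).

Definition word_mul (w : seq bool) : A :=
  foldr (fun c r => (if c then b else a) * r) 1 w.

Definition word_sum n (c : seq bool -> rat) : A :=
  \sum_(w : n.-tuple bool) c w *: word_mul w.

Lemma word_mul_cons c w : word_mul (c :: w) = (if c then b else a) * word_mul w.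
Proof. by []. Qed.

Lemma word_mul_cat v w : word_mul (v ++ w) = word_mul v * word_mul w.
Proof. by elim: v => [|c v IHv]; rewrite /= ?mul1r// IHv mulrA. Qed.

Lemma word_sum0 c : word_sum 0 c = c [::] *: 1.
Proof. exact: (sum_tuple0 (fun w => c w *: word_mul w)). Qed.

Lemma word_sumS n c : word_sum n.+1 c =
  a * word_sum n (fun w => c (false :: w)) + b * word_sum n (fun w => c (true :: w)).
Proof.
rewrite /word_sum (sum_tuple_cons _ (fun w => c w *: word_mul w)) !mulr_sumr.
by congr (_ + _); apply: eq_bigr => w _; rewrite scalerAr.
Qed.

Lemma eq_word_sum n c c' : (forall w, size w = n -> c w = c' w) ->
  word_sum n c = word_sum n c'.
Proof. by move=> cc'; apply: eq_bigr => w _; rewrite cc' ?size_tuple. Qed.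

Lemma word_sumD n c c' :
  word_sum n (fun w => c w + c' w) = word_sum n c + word_sum n c'.
Proof. by rewrite -big_split; apply: eq_bigr => w _; rewrite scalerDl. Qed.

Lemma word_sumZ n q c : word_sum n (fun w => q * c w) = q *: word_sum n c.
Proof. by rewrite scaler_sumr; apply: eq_bigr => w _; rewrite scalerA. Qed.

(** Evaluating the letters at [a] and [b] is multiplicative, degree by degree; the induction peels
    off the first letter. *)
Lemma word_sum_conv n c c' :
  word_sum n (word_conv c c') = \sum_(i < n.+1) word_sum i c * word_sum (n - i) c'.
Proof.
elim: n c => [|n IHn] c.
  by rewrite big_ord1 !word_sum0 /word_conv big_ord1/= -scalerAl mul1r scalerA.
rewrite word_sumS big_ord_recl subn0 word_sum0 -scalerAl mul1r.
under [X in _ = _ + X]eq_bigr => i _ do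
  rewrite word_sumS mulrDl -!mulrA subSS.
rewrite big_split/= -!mulr_sumr -!IHn word_sumS scalerDr !scalerAr.
rewrite addrACA -!mulrDr -!word_sumZ -!word_sumD.
by congr (_ * _ + _ * _); apply: eq_word_sum => w _; rewrite conv_cons.
Qed.

(** [head_coef] and [tail_coef] are the coefficients of exp X and exp Y. *)
Definition head_coef (w : seq bool) : rat := 
  if w == nseq (size w) false then (size w)`!%:R^-1 else 0.
Definition tail_coef (w : seq bool) : rat := 
  if w == nseq (size w) true then (size w)`!%:R^-1 else 0.

Lemma word_sum_head n : word_sum n head_coef = n`!%:R^-1 *: a ^+ n.
Proof.
rewrite /word_sum (bigD1 [tuple of nseq n false])//= big1 => [|w]; last first.
  move=> /eqP wn; rewrite /head_coef size_tuple; case: eqP => wE; last by rewrite scale0r.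
  by case: wn; apply/val_inj.
rewrite /head_coef size_nseq eqxx addr0; congr (_ *: _).
by elim: n => // n IHn; rewrite /= IHn exprS.
Qed.

Lemma word_sum_tail n : word_sum n tail_coef = n`!%:R^-1 *: b ^+ n.
Proof.
rewrite /word_sum (bigD1 [tuple of nseq n true])//= big1 => [|w]; last first.
  move=> /eqP wn; rewrite /tail_coef size_tuple; case: eqP => wE; last by rewrite scale0r.
  by case: wn; apply/val_inj.
rewrite /tail_coef size_nseq eqxx addr0; congr (_ *: _).
by elim: n => // n IHn; rewrite /= IHn exprS.
Qed.

Lemma expXexpY_coef_conv w : expXexpY_coef w = word_conv head_coef tail_coef w.
Proof.
rewrite /word_conv /expXexpY_coef.
set r := count_mem false w; set s := count_mem true w.
(* Only one cut of [w] can contribute: the one after all its letters X, and only if they all precede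
   the letters Y. *)
have key (i : 'I_(size w).+1) : (take i w == nseq (size (take i w)) false) &&
    (drop i w == nseq (size (drop i w)) true) ->
    (i = r :> nat) /\ (w == nseq r false ++ nseq s true).
  move=> /andP[/eqP tE /eqP dE].
  have wE : w = nseq i false ++ nseq (size w - i) true.
    by rewrite -[LHS](cat_take_drop i) tE dE size_drop size_takel// -ltnS.
  have ri : r = i.
    have /(congr1 (count_mem false)) := wE.
    by rewrite count_cat !count_nseq/= mul1n mul0n addn0.
  have si : s = (size w - i)%N.
    by have /(congr1 (count_mem true)) := wE; rewrite count_cat !count_nseq/= mul1n mul0n.
  by split => //; rewrite ri si -wE.
have rs : (r + s = size w)%N.
  rewrite /r /s -(count_predC (pred1 false)); congr (_ + _)%N.
  by apply: eq_count => -[].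
case: ifP => [wE|wE]; last first.
  rewrite big1// => i _; rewrite /head_coef /tail_coef.
  case: ifP => tE; last by rewrite mul0r.
  case: ifP => dE; last by rewrite mulr0.
  by have [|_] := key i; rewrite ?tE ?dE ?wE.
have rw : (r < (size w).+1)%N by rewrite ltnS -rs leq_addr.
rewrite (bigD1 (Ordinal rw))//= big1 => [|i ir]; last first.
  rewrite /head_coef /tail_coef.
  case: ifP => tE; last by rewrite mul0r.
  case: ifP => dE; last by rewrite mulr0.
  have [|ri _] := key i; rewrite ?tE ?dE//.
  by move/negP: ir; case; apply/eqP/val_inj.
have tE : take r w = nseq r false by rewrite (eqP wE) take_size_cat ?size_nseq.
have dE : drop r w = nseq s true by rewrite (eqP wE) drop_size_cat ?size_nseq.
by rewrite addr0 /head_coef /tail_coef tE dE !size_nseq !eqxx natrM invfM.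
Qed.

Definition exp1_coef (w : seq bool) : rat := if w is [::] then 0 else expXexpY_coef w.

Lemma pow_coefS k w : pow_coef k.+1 w = word_conv exp1_coef (pow_coef k) w.
Proof.
rewrite /= /word_conv big_ord_recl take0/= mul0r add0r big_add1 big_mkord/=.
by apply: eq_bigr => i _; case: w i => [[]//|x w] i.
Qed.

(** The series exp X exp Y - 1 has no constant term, so each of the [k] factors uses up at least one
    letter. *)
Lemma pow_coef_gt k w : (size w < k)%N -> pow_coef k w = 0.
Proof.
elim: k w => // k IHk w wk; rewrite pow_coefS /word_conv big1// => i _.
case: w wk i => [|x w] wk [[|i] ilt] /=; rewrite ?mul0r//.
by rewrite IHk ?mulr0// size_drop; move: wk ilt => /=; lia.
Qed.

Lemma log_coef_wide m w : (size w < m)%N ->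
  log_coef w = \sum_(1 <= k < m) (-1) ^+ k.-1 / k%:R * pow_coef k w.
Proof.
move=> wm; rewrite /log_coef (@big_cat_nat _ _ _ (size w).+1 1 m)//=.
rewrite [X in _ + X]big_nat_cond [X in _ + X]big1 ?addr0// => k.
by move=> /andP[/andP[wk _] _]; rewrite pow_coef_gt ?mulr0.
Qed.

Variable m : nat.
Hypothesis nil : forall w, (m <= size w)%N -> word_mul w = 0.

Let u := \sum_(n < m) word_sum n exp1_coef.

Lemma word_sum_pow k : \sum_(n < m) word_sum n (pow_coef k) = u ^+ k.
Proof.
elim: k => [|k IHk].
  (* For m = 0 the hypothesis on the empty word reads 1 = 0. *)
  rewrite expr0; case: m nil => [|m'] nil'.
    by rewrite big_ord0 -(nil' [::]).
  rewrite big_ord_recl word_sum0 scale1r big1 ?addr0// => i _.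
  by rewrite /word_sum big1// => w _; rewrite /= -size_eq0 size_tuple scale0r.
rewrite exprS -IHk mulr_suml.
under [RHS]eq_bigr => i _ do rewrite mulr_sumr.
rewrite -(@sum_triangle _ m (fun i j => word_sum i exp1_coef * word_sum j (pow_coef k))).
  apply: eq_bigr => n _; rewrite -word_sum_conv.
  by apply: eq_word_sum => w _; rewrite pow_coefS.
move=> i j mij; rewrite /word_sum mulr_suml big1// => v _.
rewrite mulr_sumr big1// => w _; rewrite -scalerAl -scalerAr -word_mul_cat.
by rewrite nil ?scaler0// size_cat !size_tuple.
Qed.

Lemma word_mul_nilp : a ^+ m = 0 /\ b ^+ m = 0.
Proof.
have E c : word_mul (nseq m c) = (if c then b else a) ^+ m.
  by elim: (m) => // n IHn; rewrite exprS -IHn.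
by split; [have := E false|have := E true] => /= <-; rewrite nil// size_nseq.
Qed.

Lemma sum_exp1_coef : 1 + u = expA m a * expA m b.
Proof.
rewrite /expA mulr_suml; under [RHS]eq_bigr => i _ do rewrite mulr_sumr.
rewrite -(@sum_triangle _ m (fun i j => (i`!%:R^-1 *: a ^+ i) *
    ((j`!%:R^-1 : rat) *: b ^+ j))).
  transitivity (\sum_(n < m) word_sum n (@expXexpY_coef)).
    rewrite /u; case: m nil => [|m'] nil'.
      by rewrite !big_ord0 addr0 -(nil' [::]).
    rewrite !big_ord_recl addrA; congr (_ + _); last first.
      by apply: eq_bigr => i _; apply: eq_word_sum => -[].
    by rewrite !word_sum0 scale0r addr0 [expXexpY_coef _]invr1 scale1r.
  apply: eq_bigr => n _.
  rewrite (@eq_word_sum _ _ (word_conv head_coef tail_coef)) => [|w _]; last first.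
    exact: expXexpY_coef_conv.
  rewrite word_sum_conv; apply: eq_bigr => i _.
  by rewrite word_sum_head word_sum_tail.
move=> i j mij; rewrite -word_sum_head -word_sum_tail.
rewrite /word_sum mulr_suml big1// => v _.
rewrite mulr_sumr big1// => w _; rewrite -scalerAl -scalerAr -word_mul_cat.
by rewrite nil ?scaler0// size_cat !size_tuple.
Qed.

(** Since words of length at least [m] evaluate to 0, evaluation carries the powers of exp X exp Y -
    1 to the powers of [u], hence the formal logarithm to [logA m u]. *)
Lemma log_of_word_sum :
  log_of (expA m a * expA m b) (\sum_(n < m) word_sum n (@log_coef)).
Proof.
have um : u ^+ m = 0.
  rewrite -word_sum_pow big1// => i _; rewrite /word_sum big1// => w _.
  by rewrite pow_coef_gt ?scale0r// size_tuple.
rewrite -sum_exp1_coef.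
suff -> : \sum_(n < m) word_sum n (@log_coef) = logA m u by exact: log_of_logA.
rewrite /logA; under [RHS]eq_bigr => k _ do rewrite -word_sum_pow scaler_sumr.
rewrite exchange_big/=; apply: eq_bigr => n _.
rewrite /word_sum; under [RHS]eq_bigr => k _ do rewrite scaler_sumr.
rewrite exchange_big/=; apply: eq_bigr => w _.
rewrite (@log_coef_wide m) ?size_tuple// scaler_suml.
by apply: eq_bigr => k _; rewrite scalerA.
Qed.

End Words.

(** * Lie algebras over the rationals *)

(** The factor [rat] makes the space of endomorphisms a nontrivial ring even
    for [W = 0]. *)
Record endo (W : lmodType rat) := Endo {
  endo_fun :> W * rat^o -> W * rat^o;
  endo_linear : linear endo_fun }.

Section EndoAlgebra.
Variable W : lmodType rat.
Implicit Types f g h : endo W.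

HB.instance Definition _ := gen_eqMixin (endo W).
HB.instance Definition _ := gen_choiceMixin (endo W).

Lemma endoP f g : (forall p, f p = g p) -> f = g.
Proof.
case: f g => f lf [g lg] /= fg; have {}fg : f = g by exact/funext.
by move: lf lg; rewrite fg => lf lg; congr Endo; exact: Prop_irrelevance.
Qed.

HB.instance Definition _ f :=
  GRing.isLinear.Build rat (W * rat^o)%type (W * rat^o)%type *:%R (endo_fun f)
    (endo_linear f).

Fact endo0_subproof : linear (fun _ : W * rat^o => 0 : W * rat^o).
Proof. by move=> q p p'; rewrite scaler0 addr0. Qed.
Definition endo0 := Endo endo0_subproof.

Fact endoN_subproof f : linear (fun p => - f p).
Proof. by move=> q p p'; rewrite linearP opprD scalerN. Qed.
Definition endoN f := Endo (endoN_subproof f).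

Fact endoD_subproof f g : linear (fun p => f p + g p).
Proof. by move=> q p p'; rewrite !linearP scalerDr addrACA. Qed.
Definition endoD f g := Endo (endoD_subproof f g).

Fact endoZ_subproof (k : rat) f : linear (fun p => k *: f p).
Proof. by move=> q p p'; rewrite linearP scalerDr !scalerA mulrC. Qed.
Definition endoZ k f := Endo (endoZ_subproof k f).

Fact endo1_subproof : linear (fun p : W * rat^o => p).
Proof. by []. Qed.
Definition endo1 := Endo endo1_subproof.

Fact endoM_subproof f g : linear (fun p => f (g p)).
Proof. by move=> q p p'; rewrite !linearP. Qed.
Definition endoM f g := Endo (endoM_subproof f g).

Fact endoDA : associative endoD.
Proof. by move=> f g h; apply: endoP => p; exact: addrA. Qed.
Fact endoDC : commutative endoD.
Proof. by move=> f g; apply: endoP => p; exact: addrC. Qed.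
Fact endo0D : left_id endo0 endoD.
Proof. by move=> f; apply: endoP => p; exact: add0r. Qed.
Fact endoND : left_inverse endo0 endoN endoD.
Proof. by move=> f; apply: endoP => p; exact: addNr. Qed.
HB.instance Definition _ :=
  GRing.isZmodule.Build (endo W) endoDA endoDC endo0D endoND.

Fact endoMA : associative endoM.
Proof. by move=> f g h; apply: endoP. Qed.
Fact endo1M : left_id endo1 endoM.
Proof. by move=> f; apply: endoP. Qed.
Fact endoM1 : right_id endo1 endoM.
Proof. by move=> f; apply: endoP. Qed.
Fact endoMDl : left_distributive endoM +%R.
Proof. by move=> f g h; apply: endoP. Qed.
Fact endoMDr : right_distributive endoM +%R.
Proof. by move=> f g h; apply: endoP => p; rewrite /= linearD. Qed.
Fact endo1_neq0 : endo1 != 0.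
Proof.
apply/eqP => /(congr1 (fun f : endo W => (f (0, 1)).2)) /= /eqP.
by rewrite oner_eq0.
Qed.
HB.instance Definition _ := GRing.Zmodule_isNzRing.Build (endo W)
  endoMA endo1M endoM1 endoMDl endoMDr endo1_neq0.

Fact endoZA a b f : endoZ a (endoZ b f) = endoZ (a * b) f.
Proof. by apply: endoP => p; exact: scalerA. Qed.
Fact endo1Z : left_id 1 endoZ.
Proof. by move=> f; apply: endoP => p; exact: scale1r. Qed.
Fact endoZDr : right_distributive endoZ +%R.
Proof. by move=> a f g; apply: endoP => p; exact: scalerDr. Qed.
Fact endoZDl f : {morph endoZ^~ f : a b / a + b}.
Proof. by move=> a b; apply: endoP => p; exact: scalerDl. Qed.
HB.instance Definition _ := GRing.Zmodule_isLmodule.Build rat (endo W)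
  endoZA endo1Z endoZDr endoZDl.

Fact endo_scalerAl (a : rat) f g : a *: (f * g) = (a *: f) * g.
Proof. by apply: endoP. Qed.
HB.instance Definition _ := GRing.Lmodule_isLalgebra.Build rat (endo W) endo_scalerAl.
Fact endo_scalerAr (a : rat) f g : a *: (f * g) = f * (a *: g).
Proof. by apply: endoP => p; rewrite /= linearZ. Qed.
HB.instance Definition _ := GRing.Lalgebra_isAlgebra.Build rat (endo W) endo_scalerAr.

Lemma endo_mulE f g p : (f * g) p = f (g p). Proof. by []. Qed.
Lemma endo_addE f g p : (f + g) p = f p + g p. Proof. by []. Qed.
Lemma endo_scaleE (a : rat) f p : (a *: f) p = a *: f p. Proof. by []. Qed.
Lemma endo_zeroE p : (0 : endo W) p = 0. Proof. by []. Qed.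
Lemma endo_sumE I r (P : pred I) (F : I -> endo W) p :
  (\sum_(i <- r | P i) F i) p = \sum_(i <- r | P i) F i p.
Proof.
exact: (big_morph (fun f : endo W => f p) (fun f g => endo_addE f g p) (endo_zeroE p)).
Qed.

End EndoAlgebra.

Record lieQ := LieQ {
  lieQ_sort :> lmodType rat;
  lbr : lieQ_sort -> lieQ_sort -> lieQ_sort;
  lbr_linearr : forall x, linear (lbr x);
  lbr_linearl : forall y, linear (lbr ^~ y);
  lbr_anti : forall x y, lbr x y = - lbr y x;
  lbr_jacobi : forall x y z,
    lbr x (lbr y z) = lbr (lbr x y) z + lbr y (lbr x z) }.

Arguments lbr {l} : simpl never.

Section LieTheory.
Variable L : lieQ.
Implicit Types (x y z : L) (q : rat).

HB.instance Definition _ x :=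
  GRing.isLinear.Build rat L L *:%R (lbr x) (lbr_linearr x).

Lemma lbrDr x y z : lbr x (y + z) = lbr x y + lbr x z. Proof. exact: linearD. Qed.
Lemma lbrZr q x y : lbr x (q *: y) = q *: lbr x y. Proof. exact: linearZ. Qed.
Lemma lbr0r x : lbr x 0 = 0. Proof. exact: linear0. Qed.
Lemma lbrNr x y : lbr x (- y) = - lbr x y. Proof. exact: linearN. Qed.
Lemma lbr_sumr I r (P : pred I) (F : I -> L) x :
  lbr x (\sum_(i <- r | P i) F i) = \sum_(i <- r | P i) lbr x (F i).
Proof. exact: linear_sum. Qed.
Lemma lbrDl x y z : lbr (x + y) z = lbr x z + lbr y z.
Proof. by rewrite !(lbr_anti _ z) lbrDr opprD. Qed.
Lemma lbrZl q x y : lbr (q *: x) y = q *: lbr x y.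
Proof. by rewrite !(lbr_anti _ y) lbrZr scalerN. Qed.
Lemma lbr0l x : lbr 0 x = 0. Proof. by rewrite lbr_anti lbr0r oppr0. Qed.
Lemma lbrNl x y : lbr (- x) y = - lbr x y.
Proof. by rewrite !(lbr_anti _ y) lbrNr. Qed.
Lemma lbr_suml I r (P : pred I) (F : I -> L) x :
  lbr (\sum_(i <- r | P i) F i) x = \sum_(i <- r | P i) lbr (F i) x.
Proof.
by rewrite lbr_anti lbr_sumr -sumrN; apply: eq_bigr => i _; rewrite [RHS]lbr_anti.
Qed.
Lemma lbrxx x : lbr x x = 0.
Proof.
have /eqP := lbr_anti x x; rewrite -addr_eq0 -mulr2n -scaler_nat scaler_eq0.
by rewrite pnatr_eq0 => /eqP.
Qed.

Fixpoint lie_word x y (w : seq bool) : L :=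
  match w with
  | [::] => 0
  | [:: c] => if c then y else x
  | c :: w' => lbr (if c then y else x) (lie_word x y w')
  end.

Definition ad_word x y (w : seq bool) (v : L) : L :=
  foldr (fun c v => lbr (if c then y else x) v) v w.

Definition dynkin_term x y n : L :=
  n%:R^-1 *: \sum_(w : n.-tuple bool) log_coef w *: lie_word x y w.

Definition bchL m x y : L := \sum_(n < m) dynkin_term x y n.

Definition nilpotent m :=
  forall (s : seq L) v, (m <= size s)%N -> foldr (@lbr L) v s = 0.

Definition derivation (d : L -> L) :=
  linear d /\ forall x y, d (lbr x y) = lbr (d x) y + lbr x (d y).

End LieTheory.

(** * Extension of a Lie algebra by a derivation *)

Section Semidirect.
Variables (L : lieQ) (d : L -> L) (dd : derivation d).
Let M := (L * rat^o)%type.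

(** The pair [(x, a)] stands for x + a d, with [d, x] = d x. *)
Definition semi_br (p p' : M) : M :=
  (lbr p.1 p'.1 + p.2 *: d p'.1 - p'.2 *: d p.1, 0).

Let dP q x y : d (q *: x + y) = q *: d x + d y. Proof. exact: dd.1. Qed.
Let d0 : d 0 = 0.
Proof. by have := dP (-1) 0 0; rewrite addr0 !scaler0 scaleN1r addNr. Qed.
Let dD x y : d (x + y) = d x + d y.
Proof. by have := dP 1 x y; rewrite !scale1r. Qed.
Let dZ q x : d (q *: x) = q *: d x.
Proof. by rewrite -[q *: x]addr0 dP d0 addr0. Qed.
Let dN x : d (- x) = - d x.
Proof. by rewrite -scaleN1r dZ scaleN1r. Qed.

Fact semi_linearr p : linear (semi_br p).
Proof.
move=> q [x a] [y b]; apply: injective_projections; rewrite /= ?scaler0 ?addr0//.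
rewrite lbrDr lbrZr dP !scalerDr scalerN !scalerDl -!scalerA opprD.
rewrite !scalerA [p.2 * q]mulrC.
by rewrite [X in X + _ = _]addrACA [LHS]addrACA.
Qed.

Fact semi_anti p p' : semi_br p p' = - semi_br p' p.
Proof.
apply: injective_projections; rewrite /= ?oppr0// !opprD opprK lbr_anti.
by rewrite [RHS]addrAC.
Qed.

Fact semi_linearl p : linear (semi_br^~ p).
Proof.
by move=> q p1 p2; rewrite !(semi_anti _ p) semi_linearr opprD scalerN.
Qed.

Fact semi_jacobi p1 p2 p3 : semi_br p1 (semi_br p2 p3) =
  semi_br (semi_br p1 p2) p3 + semi_br p2 (semi_br p1 p3).
Proof.
case: p1 p2 p3 => [u a] [v b] [w c]; apply: injective_projections; rewrite /= ?addr0//.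
rewrite !scale0r !subr0 !addr0 !lbrDr !lbrNr !lbrDl !lbrNl !lbrZr !lbrZl.
rewrite !dD !dN !dZ !scalerDr !scalerN !dd.2 lbr_jacobi.
rewrite [lbr v (d u)]lbr_anti !scalerN !opprK ?scalerDr ?opprD ?opprK ?scalerN ?scalerA.
rewrite [b * a]mulrC [c * a]mulrC [c * b]mulrC.
rewrite [RHS](AC ((3*4)*(3*4)) (1*8*12*5*(2*9*13*6)*(3*11)*(4*10)*(7*14))).
by rewrite /= !addNr subrr !addr0.
Qed.

Definition semidirect : lieQ :=
  LieQ semi_linearr semi_linearl semi_anti semi_jacobi.

Lemma semi_brE (p p' : M) :
  @lbr semidirect p p' = (lbr p.1 p'.1 + p.2 *: d p'.1 - p'.2 *: d p.1, 0).
Proof. by []. Qed.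

Fact adE_subproof (x : L) : linear (@lbr semidirect (x, 0)).
Proof. exact: lbr_linearr. Qed.
(** The factor [rat] in [endo L] serves here as the line spanned by [d]. *)
Definition adE (x : L) : endo L := Endo (adE_subproof x).

Lemma adEE (x : L) (p : M) : adE x p = (lbr x p.1 - p.2 *: d x, 0).
Proof. by rewrite [LHS]semi_brE/= scale0r addr0. Qed.

Lemma adE_derivation (x : L) (p q : semidirect) :
  adE x (lbr p q) = lbr (adE x p : semidirect) q + lbr p (adE x q : semidirect).
Proof. exact: (@lbr_jacobi semidirect (x, 0)). Qed.

Lemma word_mul_adE (x y u : L) w :
  word_mul (adE x) (adE y) w (u, 0) = (ad_word x y w u, 0).
Proof.
elim: w => [//|c w IHw]; rewrite word_mul_cons endo_mulE IHw.
by case: c; rewrite adEE/= scale0r subr0.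
Qed.

(** The last letter acts first and already lands in [L]; only from then on does nilpotency of [L]
    apply, hence the strict inequality. *)
Lemma word_mul_adE_nil m (x y : L) w :
  nilpotent L m -> (m < size w)%N -> word_mul (adE x) (adE y) w = 0.
Proof.
move=> nilL; elim/last_ind: w => [//|w c _]; rewrite size_rcons ltnS => mw.
rewrite -cats1 word_mul_cat word_mul_cons mulr1; apply: endoP => p; rewrite endo_mulE.
have -> : (if c then adE y else adE x) p = (((if c then adE y else adE x) p).1, 0).
  by case: c; rewrite adEE.
rewrite word_mul_adE; congr pair; set v := _.1.
rewrite -[RHS](nilL [seq if c then y else x | c <- w] v).
  by elim: w {mw} => [//|c' w IHw]; rewrite /= -IHw.
by rewrite size_map.
Qed.

(** For [x] of degree one, [ad x] sends [d] to [- x], so a product of adjoint maps applied to [d]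
    becomes a right-nested bracket. This is how the brackets of Dynkin's formula arise. *)
Lemma word_mul_adE_der (x y : L) w : d x = x -> d y = y -> (0 < size w)%N ->
  word_mul (adE x) (adE y) w (0, 1) = (- lie_word x y w, 0).
Proof.
move=> dx dy; elim: w => [//|c [|c' w] IHw] _.
  rewrite word_mul_cons mulr1; by case: c; rewrite adEE/= lbr0r sub0r scale1r ?dx ?dy.
rewrite word_mul_cons endo_mulE IHw// 
  -[lie_word x y (c :: _)]/(lbr (if c then y else x) (lie_word x y (c' :: w))).
by case: c; rewrite adEE/= lbrNr scale0r subr0.
Qed.

Definition morphic (s : endo L) :=
  forall p q : semidirect, s (lbr p q) = lbr (s p : semidirect) (s q : semidirect).

Lemma morphicM s s' : morphic s -> morphic s' -> morphic (s * s').
Proof. by move=> hs hs' p q; rewrite !endo_mulE hs' hs. Qed.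

Lemma morphicX s n : morphic s -> morphic (s ^+ n).
Proof.
by move=> hs; elim: n => [|n IHn]; rewrite ?expr0 // exprS; exact: morphicM.
Qed.

(** The divided powers of a derivation satisfy the Leibniz formula without binomial coefficients,
    and summing it gives multiplicativity. *)
Lemma morphic_exp m (a : endo L) :
  (forall p q : semidirect,
     a (lbr p q) = lbr (a p : semidirect) q + lbr p (a q : semidirect)) ->
  a ^+ m = 0 -> morphic (expA m a).
Proof.
move=> ader am p q.
pose E n (r : semidirect) : semidirect := (n`!%:R^-1 : rat) *: (a ^+ n) r.
have EE n r : E n r = (n`!%:R^-1 : rat) *: (a ^+ n) r by [].
clearbody E.
have ES n r : a (E n r) = n.+1%:R *: E n.+1 r.
  rewrite !EE linearZ/= -endo_mulE -exprS scalerA factS natrM invfM mulrA.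
  by rewrite divff ?mul1r// pnatr_eq0.
have leib n : E n (lbr p q) = \sum_(i < n.+1) lbr (E i p) (E (n - i)%N q).
  elim: n => [|n IHn].
    by rewrite big_ord1 !EE !expr0 invr1 !scale1r.
  apply: (@scalerI _ _ (n.+1%:R : rat)); first by rewrite pnatr_eq0.
  rewrite -ES IHn linear_sum/=.
  under eq_bigr => i _ do rewrite ader !ES lbrZl lbrZr -(subSn (leq_ord i)).
  (* After multiplication by n + 1, the two halves of the Leibniz rule carry the factors i and n + 1
     - i, which add up to n + 1. *)
  rewrite big_split scaler_sumr.
  have -> : \sum_(i < n.+1) i.+1%:R *: lbr (E i.+1 p) (E (n - i)%N q) =
      \sum_(i < n.+2) i%:R *: lbr (E i p) (E (n.+1 - i)%N q).
    by rewrite [RHS]big_ord_recl scale0r add0r.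
  have -> : \sum_(i < n.+1) (n.+1 - i)%:R *: lbr (E i p) (E (n.+1 - i)%N q) =
      \sum_(i < n.+2) (n.+1 - i)%:R *: lbr (E i p) (E (n.+1 - i)%N q).
    by rewrite [RHS]big_ord_recr/= subnn scale0r addr0.
  rewrite -big_split; apply: eq_bigr => i _ /=.
  by rewrite -scalerDl -natrD subnKC// -ltnS.
have expE K r : (m <= K)%N -> expA m a r = \sum_(i < K) E i r.
  move=> mK; rewrite -(expA_widen am mK) endo_sumE.
  by apply: eq_bigr => i _; rewrite EE endo_scaleE.
have E0 i r : (m <= i)%N -> E i r = 0.
  by move=> mi; rewrite EE (expr0_ge am mi) endo_zeroE scaler0.
(* With 2m terms, i + j beyond the range forces i or j to be at least [m], where the divided powers
   vanish. *)
rewrite !(expE (m + m)%N) ?leq_addr//.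
under eq_bigr => n _ do rewrite leib.
rewrite (@sum_triangle _ _ (fun i j => lbr (E i p) (E j q))) => [|i j mij].
  by rewrite lbr_suml; apply: eq_bigr => i _; rewrite lbr_sumr.
have [mi|im] := leqP m i; first by rewrite E0// lbr0l.
by rewrite [E j q]E0 ?lbr0r//; lia.
Qed.

(** Every [s ^+ n] respects the bracket and both sides are polynomial in [n]; the coefficients of
    [n] give the Leibniz rule. *)
Lemma morphic_log s D : morphic s -> log_of s D ->
  forall p q : semidirect,
    D (lbr p q) = lbr (D p : semidirect) q + lbr p (D q : semidirect).
Proof.
move=> hs /log_ofP[m H] p q.
pose c i (r : semidirect) : semidirect := (i`!%:R^-1 : rat) *: (D ^+ i) r.
have sE n K r : (m <= K)%N -> (s ^+ n) r = \sum_(i < K) (n%:R ^+ i : rat) *: c i r.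
  by move=> /H[_ _ ->]; rewrite endo_sumE.
have c0 i r : (m <= i)%N -> c i r = 0.
  by move=> /H[+ _ _]; rewrite /c => ->; rewrite endo_zeroE scaler0.
pose K := (m + m).+2.
have := @poly_family_eq0 _ K (fun k => c k (lbr p q) -
  \sum_(i < k.+1) lbr (c i p) (c (k - i)%N q)) _ 1%N isT.
rewrite big_ord_recr big_ord1/= /c !expr0 !expr1 invr1 !scale1r.
move=> H1; apply/eqP; rewrite -subr_eq0 [X in _ - X]addrC; apply/eqP; apply: H1 => n.
under eq_bigr => i _ do rewrite scalerBr.
rewrite big_split/= sumrN -sE; last by rewrite /K; lia.
apply/eqP; rewrite subr_eq0 (morphicX _ hs); apply/eqP.
rewrite !(sE _ K) ?/K; [|lia|lia].
rewrite lbr_suml; under eq_bigr => i _ do rewrite lbr_sumr.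
rewrite -(@sum_triangle _ _ (fun i j => lbr ((n%:R ^+ i : rat) *: c i p)
   ((n%:R ^+ j : rat) *: c j q))) => [|i j mij].
  apply: eq_bigr => k _; rewrite scaler_sumr; apply: eq_bigr => i _.
  by rewrite lbrZl lbrZr scalerA -exprD subnKC// -ltnS.
rewrite lbrZl lbrZr; have [mi|im] := leqP m i; first by rewrite c0// lbr0l !scaler0.
by rewrite [c j q]c0 ?lbr0r ?scaler0//; lia.
Qed.

End Semidirect.

(** * Families truncated to finitely many degrees *)

Lemma sum_seq_reindex (G : eqType) (V : zmodType) (s : seq G) (f h : G -> G)
    (F : G -> V) : uniq s -> cancel f h -> cancel h f ->
  \sum_(p <- s | f p \in s) F (f p) = \sum_(m <- s | h m \in s) F m.
Proof.
move=> us fK hK; rewrite -[LHS]big_filter -[RHS]big_filter -(big_map f xpredT F).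
apply/perm_big/uniq_perm; rewrite ?filter_uniq//.
  by rewrite map_inj_uniq ?filter_uniq//; exact: can_inj fK.
move=> m; rewrite mem_filter; apply/mapP/andP => [[p]|[hm ms]].
  by rewrite mem_filter => /andP[fs ps] ->; rewrite fK.
by exists (h m); rewrite ?hK// mem_filter hK ms.
Qed.

Section TruncatedFamilies.
Variables (G : zmodType) (L : lieQ) (s : seq G).
Hypothesis us : uniq s.
(** What the Jacobi identity needs: a partial sum must not leave [s] when the three terms and their
    total lie in [s]. *)
Hypothesis clos : forall l m n,
  l \in s -> m \in s -> n \in s -> l + m + n \in s -> l + m \in s.

(** All families are kept as elements, but components outside [s] are invisible to the bracket. *)
Definition tfam_br (x y : G -> L) : G -> L := fun k =>
  if k \in s then \sum_(l <- s | k - l \in s) lbr (x l) (y (k - l)) else 0.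

Fact tfam_linearr x : linear (tfam_br x).
Proof.
move=> q y z; apply/funext => k; rewrite /tfam_br [RHS]/GRing.add/= /GRing.scale/=.
case: ifP => _; last by rewrite scaler0 addr0.
rewrite scaler_sumr -big_split/=; apply: eq_bigr => l _.
by rewrite lbrDr lbrZr.
Qed.

Fact tfam_anti x y : tfam_br x y = - tfam_br y x.
Proof.
apply/funext => k; rewrite /tfam_br [RHS]/GRing.opp/=.
case: ifP => _; last by rewrite oppr0.
pose f l := k - l.
have fK : cancel f f by move=> l; rewrite /f opprB addrC subrK.
rewrite -sumrN -(sum_seq_reindex (fun l => - lbr (y l) (x (k - l))) us fK fK).
by apply: eq_bigr => l _; rewrite lbr_anti -[in X in _ = - lbr _ (x X)]/(f (f l)) fK.
Qed.

Fact tfam_linearl y : linear (tfam_br^~ y).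
Proof. by move=> q x z; rewrite !(tfam_anti _ y) tfam_linearr opprD scalerN. Qed.

Let tfam_br2 x y z k : k \in s -> tfam_br x (tfam_br y z) k =
  \sum_(l <- s) \sum_(m <- s | k - l - m \in s)
    lbr (x l) (lbr (y m) (z (k - l - m))).
Proof.
move=> ks; rewrite {1}/tfam_br ks big_mkcond/= big_seq [RHS]big_seq.
apply: eq_bigr => l ls; rewrite /tfam_br.
case: ifPn => kl; first by rewrite ?kl lbr_sumr.
rewrite big_seq_cond big1// => m /andP[ms klm].
have E : m + (k - l - m) = k - l by rewrite addrC subrK.
by move/negP: kl; case; rewrite -E (clos ms klm ls)// E subrK.
Qed.

Fact tfam_jacobi x y z : tfam_br x (tfam_br y z) =
  tfam_br (tfam_br x y) z + tfam_br y (tfam_br x z).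
Proof.
apply/funext => k; rewrite [RHS]/GRing.add/=.
have [ks|ks] := boolP (k \in s); last by rewrite /tfam_br !(negbTE ks) addr0.
rewrite !tfam_br2//.
have -> : tfam_br (tfam_br x y) z k = \sum_(l <- s) \sum_(m <- s | k - l - m \in s)
    lbr (lbr (x l) (y m)) (z (k - l - m)).
  rewrite {1}/tfam_br ks big_mkcond/= big_seq.
  transitivity (\sum_(p <- s) \sum_(l <- s)
      if (p - l \in s) && (k - p \in s)
      then lbr (lbr (x l) (y (p - l))) (z (k - p)) else 0).
    rewrite [RHS]big_seq; apply: eq_bigr => p ps; rewrite /tfam_br ps.
    case: ifP => kp; last by rewrite big1// => l _; rewrite andbF.
    by rewrite lbr_suml big_mkcond; apply: eq_bigr => l _; rewrite andbT.
  rewrite exchange_big/= big_seq [RHS]big_seq; apply: eq_bigr => l ls.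
  pose F m := if k - l - m \in s then lbr (lbr (x l) (y m)) (z (k - l - m)) else 0.
  transitivity (\sum_(p <- s | p - l \in s) F (p - l)).
    rewrite [RHS]big_mkcond; apply: eq_bigr => p _; rewrite /F opprB addrA subrK.
    by case: (p - l \in s).
  rewrite (@sum_seq_reindex _ _ _ _ (fun m => m + l) F us) => [||m]; last first.
  - by rewrite addrK.
  - by move=> m; rewrite subrK.
  rewrite [RHS]big_mkcond [LHS]big_mkcond/= big_seq [RHS]big_seq.
  apply: eq_bigr => m ms; rewrite /F; case: ifP => // ml; case: ifP => // klm.
  move: ml; rewrite (clos ms ls klm)//.
  have -> : k - l - m = k - (m + l) by rewrite opprD addrA addrAC.
  by rewrite addrC subrK.
rewrite [X in _ = _ + X](exchange_big_dep xpredT)//= -big_split/=.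
apply: eq_bigr => l _; rewrite [X in _ = _ + X]big_mkcond.
rewrite [X in _ = X + _]big_mkcond [LHS]big_mkcond -big_split/=.
apply: eq_bigr => m _; rewrite [k - m - l]addrAC.
by case: ifP => _; rewrite ?addr0// lbr_jacobi.
Qed.

Definition tfam : lieQ := LieQ tfam_linearr tfam_linearl tfam_anti tfam_jacobi.

Lemma tfamE (x y : tfam) k : @lbr tfam x y k =
  if k \in s then \sum_(l <- s | k - l \in s) lbr (x l) (y (k - l)) else 0.
Proof. by []. Qed.

Definition grading_der (phi : G -> rat) (x : G -> L) : G -> L :=
  fun k => phi k *: x k.

Lemma grading_derivation (phi : G -> rat) :
  (forall k l, phi (k + l) = phi k + phi l) -> @derivation tfam (grading_der phi).
Proof.
move=> phiD; split.
  move=> q x y; apply/funext => k.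
  rewrite -[LHS]/(phi k *: (q *: x k + y k)).
  by rewrite -[RHS]/(q *: (phi k *: x k) + phi k *: y k) scalerDr !scalerA mulrC.
move=> x y; apply/funext => k; rewrite -[LHS]/(phi k *: @lbr tfam x y k).
rewrite -[RHS]/(@lbr tfam (grading_der phi x) y k +
  @lbr tfam x (grading_der phi y) k) !tfamE.
case: ifP => _; last by rewrite scaler0 addr0.
rewrite scaler_sumr -big_split/=; apply: eq_bigr => l _.
by rewrite lbrZl lbrZr -scalerDl -phiD [l + _]addrC subrK.
Qed.

Section Nilpotency.
Variables (F : realFieldType) (ht : G -> F) (N : nat).
Hypothesis htD : forall k l, ht (k + l) = ht k + ht l.
Hypothesis ht1 : forall k, k \in s -> 1 <= ht k.
Hypothesis htN : forall k, k \in s -> ht k < N%:R.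

(** A nested bracket in degree [k] decomposes [k] into as many elements of [s] as it has entries,
    each of height at least 1. At least one bracket must be taken, since an arbitrary family need
    not vanish outside [s]. *)
Lemma tfam_nilpotent : nilpotent tfam N.+1.
Proof.
have key (t : seq tfam) (v : tfam) k : (0 < size t)%N -> k \in s ->
    ht k < (size t).+1%:R -> foldr (@lbr tfam) v t k = 0.
  elim: t k => [//|x t IHt] k _ ks kt.
  rewrite -[LHS]/(@lbr tfam x (foldr (@lbr tfam) v t) k).
  rewrite tfamE ks big_seq_cond big1// => l /andP[ls kl].
  have lk : ht (k - l) < (size t).+1%:R.
    rewrite -(ltrD2r 1) natr1 (le_lt_trans _ kt)//.
    by rewrite -[in leRHS](subrK l k) [leRHS]htD lerD2l ht1.
  have [t0|t0] := posnP (size t); last by rewrite IHt ?lbr0r.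
  by move: lk; rewrite t0 ltNge ht1.
move=> t v Nt; apply/funext => k.
have [ks|ks] := boolP (k \in s); last first.
  case: t Nt => [//|x t] _.
  by rewrite -[LHS]/(@lbr tfam x (foldr (@lbr tfam) v t) k) tfamE (negbTE ks).
rewrite key//; first exact: leq_trans Nt.
by rewrite (lt_le_trans (htN ks))// ler_nat; lia.
Qed.
End Nilpotency.

Lemma eq_lie_word (x y x' y' : tfam) (w : seq bool) :
  {in s, x =1 x'} -> {in s, y =1 y'} ->
  {in s, @lie_word tfam x y w =1 @lie_word tfam x' y' w}.
Proof.
move=> xx' yy'.
have cc' c : {in s, (if c then y else x) =1 (if c then y' else x')}.
  by case: c.
elim: w => [//|c [|c' w] IHw] k ks; first exact: cc'.
rewrite -[LHS]/(@lbr tfam (if c then y else x) (@lie_word tfam x y (c' :: w)) k).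
rewrite -[RHS]/(@lbr tfam (if c then y' else x') (@lie_word tfam x' y' (c' :: w)) k).
rewrite !tfamE ks.
rewrite big_seq_cond [RHS]big_seq_cond; apply: eq_bigr => l /andP[ls kl].
by rewrite cc'// IHw.
Qed.

Lemma fam_sumE I r (P : pred I) (f : I -> G -> L) k :
  (\sum_(i <- r | P i) f i) k = \sum_(i <- r | P i) f i k.
Proof. exact: (big_morph (fun f : G -> L => f k)). Qed.

Lemma dynkin_term_tfamE (x y : tfam) n k : @dynkin_term tfam x y n k =
  n%:R^-1 *: \sum_(w : n.-tuple bool) log_coef w *: @lie_word tfam x y w k.
Proof. by rewrite /dynkin_term /GRing.scale/= fam_sumE. Qed.

Lemma eq_bchL (x y x' y' : tfam) m : {in s, x =1 x'} -> {in s, y =1 y'} ->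
  {in s, @bchL tfam m x y =1 @bchL tfam m x' y'}.
Proof.
move=> xx' yy' k ks; rewrite /bchL !fam_sumE; apply: eq_bigr => n _.
rewrite !dynkin_term_tfamE; congr (_ *: _); apply: eq_bigr => w _.
by rewrite (eq_lie_word _ xx' yy').
Qed.

End TruncatedFamilies.

(** * Dynkin's formula *)

Section Dynkin.
Variables (L : lieQ) (n : nat).

Let s : seq int := [seq Posz i.+1 | i <- iota 0 n.+1].

Let mem_s (k : int) : (k \in s) = (0 < k <= n.+1%:Z).
Proof.
apply/mapP/idP => [[i]|k0]; first by rewrite mem_iota => + ->; lia.
by exists (absz k).-1; rewrite ?mem_iota; lia.
Qed.

Let us : uniq s. Proof. by rewrite map_inj_uniq ?iota_uniq// => i j [->]. Qed.

Let clos l m k : l \in s -> m \in s -> k \in s -> l + m + k \in s -> l + m \in s.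
Proof. by rewrite !mem_s; lia. Qed.

Let T := tfam L us clos.
Let phi (k : int) : rat := k%:~R.
Let phiD k l : phi (k + l) = phi k + phi l. Proof. exact: intrD. Qed.
Let d : T -> T := grading_der (L := L) phi.
Let dd : derivation d := grading_derivation L us clos phiD.
Let S := semidirect dd.

(** The monomial v t^i. *)
Let sing (i : nat) (v : L) : int -> L := fun k => if k == i%:Z then v else 0.

Let lbr_sing (x v : L) i : (0 < i)%N ->
  @lbr T (sing 1 x) (sing i v) = if (i <= n)%N then sing i.+1 (lbr x v) else 0.
Proof.
move=> i0; apply/funext => k; rewrite tfamE.
have -> : (if (i <= n)%N then sing i.+1 (lbr x v) else 0) k =
    if (i <= n)%N && (k == i.+1%:Z) then lbr x v else 0.
  by case: ifP.
case: ifPn => ks; last first.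
  by case: ifP => // /andP[iN /eqP kE]; move: ks; rewrite mem_s; lia.
rewrite big_mkcond (bigD1_seq 1)//=.
rewrite big1 => [|l l1]; last by rewrite /sing (negbTE l1) lbr0l if_same.
rewrite addr0 /sing eqxx mem_s; move: ks; rewrite mem_s => ks.
have [kE|kE] := eqVneq (k - 1) i%:Z; last first.
  by rewrite lbr0r if_same; case: ifP => // /andP[_ /eqP kE']; move: kE; rewrite kE'; lia.
have -> : k == i.+1%:Z by lia.
have -> : (i <= n)%N by lia.
by have -> : 0 < k - 1 <= n.+1%:Z by lia.
Qed.

Let d_sing v : d (sing 1 v) = sing 1 v.
Proof.
apply/funext => k; rewrite /d /grading_der /sing.
by case: eqP => [->|_]; rewrite ?scale1r ?scaler0.
Qed.

Lemma ad_word_sing (x y v : L) w : @ad_word T (sing 1 x) (sing 1 y) w (sing 1 v) =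
  if (size w <= n)%N then sing (size w).+1 (ad_word x y w v) else 0.
Proof.
elim: w => [//|c w IHw].
rewrite -[LHS]/(@lbr T (if c then sing 1 y else sing 1 x)
   (@ad_word T (sing 1 x) (sing 1 y) w (sing 1 v))) {}IHw.
have -> : (if c then sing 1 y else sing 1 x) = sing 1 (if c then y else x).
  by case: c.
rewrite [size (c :: w)]/=; case: (leqP (size w) n) => wn; last first.
  by rewrite lbr0r; case: ifP => //; lia.
by rewrite lbr_sing.
Qed.

Lemma lie_word_sing (x y : L) w : (0 < size w)%N ->
  @lie_word T (sing 1 x) (sing 1 y) w =
  if (size w <= n.+1)%N then sing (size w) (lie_word x y w) else 0.
Proof.
elim: w => [//|c [|c' w] IHw] _; first by case: c.
rewrite -[LHS]/(@lbr T (if c then sing 1 y else sing 1 x)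
   (@lie_word T (sing 1 x) (sing 1 y) (c' :: w))) IHw//.
have -> : (if c then sing 1 y else sing 1 x) = sing 1 (if c then y else x).
  by case: c.
case: (leqP (size (c' :: w)) n.+1) => wn; last first.
  by rewrite lbr0r; case: ifP => //; move: wn => /=; lia.
by rewrite lbr_sing.
Qed.

(** Dynkin's trick, in [L[t]] truncated beyond [t^(n+1)] and extended by the
    derivation [d = t d/dt]. Write [L_n] for the left-hand side and [z_n] for
    [dynkin_term x y n]. The logarithm [D] of the automorphism
    [exp (ad xt) exp (ad yt)] is a derivation; [d (v t) = v t] and
    [ad (u t) d = - u t], so the coefficient of [t^(n+1)] in
    [D [d, v t] = [D d, v t] + [d, D (v t)]] reads
    [L_n v = - n [z_n, v] + (n + 1) L_n v]. *)
Lemma dynkin_term_ad_pos (x y v : L) : (0 < n)%N ->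
  \sum_(w : n.-tuple bool) log_coef w *: ad_word x y w v = lbr (dynkin_term x y n) v.
Proof.
move=> n0; pose X : T := sing 1 x; pose Y : T := sing 1 y; pose V : T := sing 1 v.
have nilT : nilpotent T n.+3.
  apply: (@tfam_nilpotent _ _ _ _ _ rat phi n.+2 phiD) => k; rewrite mem_s /phi => kn.
    by rewrite (ler_int _ 1); lia.
  by rewrite -[_%:R]/((n.+2%:Z)%:~R) ltr_int; lia.
(* [n.+4] is one more than the nilpotency bound [n.+3], by the strict inequality in
   [word_mul_adE_nil]. *)
pose A := adE dd X; pose B := adE dd Y; pose m := n.+4.
have nilw w : (m <= size w)%N -> word_mul A B w = 0.
  by move=> mw; apply: word_mul_adE_nil nilT _.
have wad w u : word_mul A B w (u, 0) = (@ad_word T X Y w u, 0).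
  exact: word_mul_adE.
have wder w : (0 < size w)%N -> word_mul A B w (0, 1) = (- @lie_word T X Y w, 0).
  by apply: word_mul_adE_der; exact: d_sing.
have [Am Bm] := word_mul_nilp nilw.
have logD := log_of_word_sum nilw.
set D := \sum_(_ < _) _ in logD.
have morD : morphic dd (expA m A * expA m B).
  by apply: morphicM; apply: morphic_exp => // p q; exact: adE_derivation.
have := morphic_log morD logD ((0, 1) : S) ((V, 0) : S).
have -> : lbr ((0, 1) : S) ((V, 0) : S) = ((V, 0) : S).
  by rewrite semi_brE/= lbr0l add0r scale1r scale0r subr0 d_sing.
pose ev (p : S) (k : int) : L := p.1 k.
have evD p q k : ev (p + q) k = ev p k + ev q k by [].
have evZ a p k : ev (a *: p) k = a *: ev p k by [].
have ev_sum I r (P : pred I) (F : I -> S) k :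
    ev (\sum_(i <- r | P i) F i) k = \sum_(i <- r | P i) ev (F i) k.
  exact: (big_morph (fun p => ev p k)).
have DE (p : S) k : ev (D p) k = \sum_(j < m) \sum_(w : j.-tuple bool)
    log_coef w *: ev (word_mul A B w p) k.
  rewrite /D endo_sumE ev_sum; apply: eq_bigr => j _.
  by rewrite endo_sumE ev_sum; apply: eq_bigr => w _; rewrite endo_scaleE evZ.
have DV : ev (D (V, 0)) n.+1 = \sum_(w : n.-tuple bool) log_coef w *: ad_word x y w v.
  have nm : (n < m)%N by rewrite /m; lia.
  rewrite DE (bigD1 (Ordinal nm))//= [X in _ + X]big1 ?addr0 => [|j jn].
    apply: eq_bigr => w _; rewrite wad /ev/= ad_word_sing size_tuple leqnn.
    by rewrite /sing eqxx.
  rewrite big1// => w _; rewrite wad /ev/= ad_word_sing size_tuple.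
  case: ifP => _; last by rewrite scaler0.
  rewrite /sing ifN ?scaler0//; apply: contra jn => /eqP[nj].
  by apply/eqP/val_inj => /=; rewrite nj.
(* The sign comes from ad (u t) d = - u t, and the factor [n] undoes the division by [n] in
   [dynkin_term]. *)
have Dd : ev (D (0, 1)) n = - n%:R *: dynkin_term x y n.
  have nm : (n < m)%N by rewrite /m; lia.
  rewrite DE (bigD1 (Ordinal nm))//= [X in _ + X]big1 ?addr0 => [|j jn].
    rewrite /dynkin_term scalerA mulNr divff ?pnatr_eq0 -?lt0n// scaleN1r -sumrN.
    apply: eq_bigr => w _; rewrite wder ?size_tuple//.
    rewrite /ev -[(_, _).1]/(- _) lie_word_sing ?size_tuple// leqW//.
    by rewrite -scalerN -[LHS]/(_ *: - sing n _ n) /sing eqxx.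
  rewrite big1// => w _; case: (posnP j) => j0.
    by rewrite /log_coef big_geq ?scale0r// size_tuple j0.
  rewrite wder ?size_tuple// /ev -[(_, _).1]/(- _).
  rewrite lie_word_sing ?size_tuple//.
  case: ifP => _; last by rewrite oppr0 scaler0.
  rewrite -[X in _ *: X]/(- sing j _ n) /sing ifN ?oppr0 ?scaler0//.
  by apply: contra jn => /eqP[nj]; apply/eqP/val_inj => /=; rewrite nj.
have br_sing (u : T) : @lbr T u V n.+1 = lbr (u n) v.
  have n1s : n.+1%:Z \in s by rewrite mem_s; lia.
  have ns : n%:Z \in s by rewrite mem_s; lia.
  have -> : lbr (u n) v = if n.+1%:Z - n%:Z \in s then lbr (u n) (V (n.+1%:Z - n%:Z)) else 0.
    by have -> : n.+1%:Z - n%:Z = 1 by lia; rewrite mem_s.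
  rewrite tfamE n1s big_mkcond (bigD1_seq n%:Z)//= big1 ?addr0// => l ln.
  rewrite /V /sing; case: (n.+1%:Z - l =P 1) => nl; last by rewrite lbr0r if_same.
  by case/eqP: ln; move: nl; lia.
have evbr (p q : S) k : ev (lbr p q) k = @lbr T p.1 q.1 k + p.2 *: d q.1 k - q.2 *: d p.1 k.
  by [].
(* As n > 0, [V] has no component in degree n + 1, so a possible multiple of [d] in D d contributes
   nothing to [D d, v t] there. *)
have Vn : V n.+1 = 0 by rewrite /V /sing; case: n n0.
move=> /(congr1 (fun p => ev p n.+1)); rewrite evD DV !evbr br_sing.
rewrite -/(ev _ _) Dd -[(V, 0).1]/V -[(0, 1).2]/1 -[(0, 1).1]/0 -[(V, 0).2]/0.
have -> : d 0 = 0 by apply/funext => k; exact: scaler0.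
have -> : d (D (V, 0)).1 n.+1 = n.+1%:R *: ev (D (V, 0)) n.+1 by [].
rewrite [d V]d_sing [sing 1 v _]Vn lbr0l scale1r !scale0r !scaler0 DV.
rewrite subr0 addr0 add0r subr0 lbrZl; set P := \sum_w _.
rewrite -natr1 scalerDl scale1r addrA -[LHS]add0r => /addIr/esym/eqP.
rewrite scaleNr addrC subr_eq0 => /eqP; apply: scalerI.
by rewrite pnatr_eq0 -lt0n.
Qed.

End Dynkin.

Lemma dynkin_term_ad (L : lieQ) n (x y v : L) :
  \sum_(w : n.-tuple bool) log_coef w *: ad_word x y w v = lbr (dynkin_term x y n) v.
Proof.
(* In length 0 both sides vanish: the empty word has coefficient 0, and the inverse of 0 is 0. *)
case: n => [|n]; last exact: dynkin_term_ad_pos.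
rewrite (sum_tuple0 (fun w => log_coef w *: ad_word x y w v)).
by rewrite /log_coef big_geq// scale0r /dynkin_term invr0 scale0r lbr0l.
Qed.

(** * Associativity in a nilpotent Lie algebra *)

Section Associativity.
Variables (L : lieQ) (d : L -> L) (dd : derivation d).
Let M := semidirect dd.

Let lie_word_inl (x y : L) w :
  @lie_word M (x, 0) (y, 0) w = (lie_word x y w, 0).
Proof.
elim: w => [//|c [|c' w] IHw]; first by case: c.
rewrite -[LHS]/(@lbr M (if c then (y, 0) else (x, 0)) (@lie_word M (x, 0) (y, 0) (c' :: w))).
rewrite IHw semi_brE.
by case: c => /=; rewrite !scale0r subr0 addr0.
Qed.

Let inl_sum I r (P : pred I) (F : I -> L) :
  \sum_(i <- r | P i) ((F i, 0) : M) = (\sum_(i <- r | P i) F i, 0) :> M.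
Proof.
by apply/esym; apply: (big_morph (fun u : L => (u, 0) : M)) => // u v;
  apply: injective_projections; rewrite //= addr0.
Qed.

Let inlZ q (u : L) : q *: ((u, 0) : M) = (q *: u, 0).
Proof. by apply: injective_projections; rewrite //= scaler0. Qed.

Let bchL_inl m (x y : L) : @bchL M m (x, 0) (y, 0) = (bchL m x y, 0).
Proof.
rewrite /bchL -inl_sum; apply: eq_bigr => j _; rewrite /dynkin_term -inlZ -inl_sum.
by congr (_ *: _); apply: eq_bigr => w _; rewrite lie_word_inl inlZ.
Qed.

Lemma log_of_bchL m (x y : L) :
  (forall w, (m <= size w)%N -> word_mul (adE dd x) (adE dd y) w = 0) ->
  log_of (expA m (adE dd x) * expA m (adE dd y)) (adE dd (bchL m x y)).
Proof.
move=> nilw; have := log_of_word_sum nilw; set D := \sum_(_ < _) _.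
suff -> : D = adE dd (bchL m x y) by [].
apply: endoP => p; rewrite /D endo_sumE.
rewrite -[RHS]/(@lbr M (bchL m x y, 0) p) -bchL_inl /bchL lbr_suml.
(* [dynkin_term_ad] is used in the extension [M], so the equality holds on [d] as well as on [L]. *)
apply: eq_bigr => j _; rewrite -dynkin_term_ad endo_sumE; apply: eq_bigr => w _.
rewrite endo_scaleE; congr (_ *: _).
elim: (tval w) => [//|c v IHv]; rewrite word_mul_cons endo_mulE IHv.
by case: c.
Qed.

(** Both sides have the same exponential in the adjoint representation on
    the extension of [L] by [d], where [ad z] maps [d] to [- d z]. *)
Lemma bchL_assoc_der N m (x y z : L) : nilpotent L N -> (N < m)%N ->
  d (bchL m (bchL m x y) z) = d (bchL m x (bchL m y z)).
Proof.
move=> nilL Nm.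
have lg u v : log_of (expA m (adE dd u) * expA m (adE dd v)) (adE dd (bchL m u v)).
  by apply: log_of_bchL => w mw; apply: word_mul_adE_nil nilL _; exact: leq_trans mw.
have adm u : adE dd u ^+ m = 0.
  have [] // := @word_mul_nilp _ (adE dd u) (adE dd u) m.
  by move=> w mw; apply: word_mul_adE_nil nilL _; exact: leq_trans mw.
have expM u v : expA m (adE dd u) * expA m (adE dd v) = expA m (adE dd (bchL m u v)).
  by apply: log_of_fun (lg u v) _; exact: log_of_expA.
(* Multiplication of endomorphisms is associative, so both bracketings are logarithms of the same
   triple product. *)
have := lg (bchL m x y) z; rewrite -expM -mulrA expM => /log_of_inj/(_ (lg _ _)).
move=> /(congr1 (fun f : endo L => (f (0, 1)).1)); rewrite !adEE/= !lbr0r !sub0r !scale1r.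
exact: oppr_inj.
Qed.

End Associativity.

Lemma lie_word_ge2 (L : lieQ) (x y : L) w : lbr x y = 0 -> (1 < size w)%N ->
  lie_word x y w = 0.
Proof.
move=> xy; elim: w => [//|c [//|c' w] IHw] _.
rewrite -[LHS]/(lbr (if c then y else x) (lie_word x y (c' :: w))).
case: w IHw => [_|c'' w IHw]; last by rewrite IHw ?lbr0r.
by case: c; case: c'; rewrite /= ?lbrxx ?xy// lbr_anti xy oppr0.
Qed.

Lemma lie_word_rcons (L : lieQ) (x y : L) w c :
  lie_word x y (rcons w c) = ad_word x y w (if c then y else x).
Proof.
elim: w => [//|c' w IHw]; rewrite rcons_cons.
rewrite -[RHS]/(lbr (if c' then y else x) (ad_word x y w (if c then y else x))) -IHw.
by case: w {IHw}.
Qed.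

Lemma lie_word_nil (L : lieQ) N (x y : L) w :
  nilpotent L N -> (N < size w)%N -> lie_word x y w = 0.
Proof.
move=> nilL; case/lastP: w => [//|w c]; rewrite size_rcons ltnS lie_word_rcons => Nw.
rewrite -[RHS](nilL [seq if c then y else x | c <- w] (if c then y else x)).
  by elim: w {Nw} => [//|c' w IHw]; rewrite /= -IHw.
by rewrite size_map.
Qed.

Lemma log_coef1 c : log_coef [:: c] = 1.
Proof.
rewrite /log_coef big_nat1/= expr0 divr1 mul1r big_nat1/= mulr1.
by case: c; rewrite /expXexpY_coef/= invr1.
Qed.

Lemma bchL_commuting (L : lieQ) m (x y : L) : lbr x y = 0 -> (1 < m)%N ->
  bchL m x y = x + y.
Proof.
case: m => [//|[//|m]] xy _; rewrite /bchL !big_ord_recl big1 => [|j _].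
  rewrite {1}/dynkin_term invr0 scale0r add0r addr0 /dynkin_term invr1 scale1r.
  rewrite (sum_tuple_cons _ (fun w => log_coef w *: lie_word x y w)).
  rewrite (sum_tuple0 (fun w => log_coef (false :: w) *: lie_word x y (false :: w))).
  rewrite (sum_tuple0 (fun w => log_coef (true :: w) *: lie_word x y (true :: w))).
  by rewrite !log_coef1 !scale1r.
rewrite /dynkin_term big1 ?scaler0// => w _.
by rewrite lie_word_ge2 ?scaler0// size_tuple.
Qed.

(** * The Baker-Campbell-Hausdorff product of families supported on a cone *)

Section LieOfGraded.
Variables (Gam : zmodType) (g : gradedLie Gam).

Fact graded_anti (x y : g) : lie_br x y = - lie_br y x.
Proof.
have lD u v w : lie_br (u + v) w = lie_br u w + lie_br v w :> g.
  by have := lie_linearl w 1 u v; rewrite !scale1r.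
have rD u v w : lie_br w (u + v) = lie_br w u + lie_br w v :> g.
  by have := lie_linearr w 1 u v; rewrite !scale1r.
have := lie_alt (x + y); rewrite lD !rD !lie_alt add0r addr0 => /eqP.
by rewrite addr_eq0 => /eqP.
Qed.

Fact graded_jacobi (x y z : g) :
  lie_br x (lie_br y z) = lie_br (lie_br x y) z + lie_br y (lie_br x z).
Proof.
have r0 u : lie_br u 0 = 0 :> g.
  have /eqP := lie_linearr u 1 0 0.
  by rewrite !scale1r addr0 -subr_eq0 opprD addrA subrr add0r oppr_eq0 => /eqP.
have rN u v : lie_br u (- v) = - lie_br u v :> g.
  by have := lie_linearr u (-1) v 0; rewrite r0 !addr0 !scaleN1r.
rewrite [lie_br (lie_br x y) z]graded_anti [lie_br x z]graded_anti rN.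
apply/eqP; rewrite -subr_eq0 opprD !opprK addrA.
by rewrite -[X in X == _]addrA [_ + lie_br y _]addrC addrA lie_jacobi.
Qed.

Definition lieQ_of : lieQ :=
  LieQ (@lie_linearr _ g) (@lie_linearl _ g) graded_anti graded_jacobi.

Lemma graded_br0l (x : g) : lie_br 0 x = 0. Proof. exact: (@lbr0l lieQ_of). Qed.
Lemma graded_br0r (x : g) : lie_br x 0 = 0. Proof. exact: (@lbr0r lieQ_of). Qed.

End LieOfGraded.

Section PositiveCone.
Variables (R : realType) (Gam : zmodType).

(** What the group law uses of the lattice points of a strict cone. *)
Definition strictly_positive (S : set Gam) : Prop :=
  (forall k l, S k -> S l -> S (k + l)) /\
  exists ht : Gam -> R, [/\ forall k l, ht (k + l) = ht k + ht l,
    forall k, S k -> 1 <= ht k &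
    forall t, finite_set [set k | S k /\ ht k <= t]].

(** The component at [k] of a [bch] product of families supported on [S]
    depends only on the components at these finitely many points. *)
Definition divs (S : set Gam) (k : Gam) : seq Gam :=
  finmap.enum_fset (fset_set [set l | S l /\ (l = k \/ S (k - l))]).

Variables (S : set Gam).
Hypothesis posS : strictly_positive S.

Lemma finite_divs k : finite_set [set l | S l /\ (l = k \/ S (k - l))].
Proof.
have [SD [ht [htD ht1 fin]]] := posS.
apply: sub_finite_set (fin (ht k)) => l /= [Sl lk]; split => //.
case: lk => [->//|Skl]; rewrite -[in leRHS](subrK l k) [leRHS]htD lerDr.
by rewrite (le_trans _ (ht1 _ Skl)).
Qed.

Lemma mem_divs k l : l \in divs S k <-> S l /\ (l = k \/ S (k - l)).
Proof.
rewrite /divs in_fset_set; last exact: finite_divs.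
by split; [move/set_mem|move=> h; apply/mem_set].
Qed.

Lemma divs_self k : S k -> k \in divs S k.
Proof. by move=> Sk; apply/mem_divs; split => //; left. Qed.

Lemma divs_uniq k : uniq (divs S k). Proof. exact: finmap.fset_uniq. Qed.

Lemma divs_trans k l m : l \in divs S k -> S m -> S (l - m) -> m \in divs S k.
Proof.
have [SD _] := posS.
move=> /mem_divs[Sl lk] Sm Slm; apply/mem_divs; split => //; right.
case: lk => [<-//|Skl]; have -> : k - m = (k - l) + (l - m) by rewrite addrA subrK.
exact: SD.
Qed.

Lemma divs_clos k l m n : l \in divs S k -> m \in divs S k -> n \in divs S k ->
  l + m + n \in divs S k -> l + m \in divs S k.
Proof.
have [SD _] := posS.
move=> /mem_divs[Sl _] /mem_divs[Sm _] /mem_divs[Sn _] dv.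
by apply: divs_trans dv _ _; [exact: SD|rewrite addrC addrA addNr add0r].
Qed.

Variable g : gradedLie Gam.
Implicit Types x y z : Gam -> g.

Definition supp_in x : Prop := forall k, ~ S k -> x k = 0.

Let T k : lieQ := tfam (lieQ_of g) (divs_uniq k) (@divs_clos k).

Lemma fam_br_supp x y : supp_in x -> supp_in y -> supp_in (fam_br x y).
Proof.
have [SD _] := posS => xS yS k Sk; apply: fsbig1 => l _.
have [Sl|Sl] := pselect (S l); last by rewrite xS// graded_br0l.
rewrite yS ?graded_br0r// => Skl; apply: Sk.
by rewrite -(subrK l k); exact: SD.
Qed.

Lemma bracket_word_supp x y w : supp_in x -> supp_in y -> supp_in (bracket_word x y w).
Proof.
move=> xS yS; elim: w => [//|c [|c' w] IHw]; first by case: c.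
by apply: fam_br_supp => //; case: c.
Qed.

(** A nonzero term splits [l] into two points of [S]; both then divide [l], hence [k], and the
    infinite sum collapses to the truncated one. *)
Lemma fam_brE k x y : supp_in x -> supp_in y ->
  {in divs S k, fam_br x y =1 @lbr (T k) x y}.
Proof.
move=> xS yS l lk; rewrite /fam_br tfamE lk [RHS]big_mkcond/=.
pose F m : g := lie_br (x m) (y (l - m)).
have F0 m : m \notin divs S k \/ l - m \notin divs S k -> F m = 0.
  move=> H; rewrite /F; have [Sm|Sm] := pselect (S m); last by rewrite xS// graded_br0l.
  have [Slm|Slm] := pselect (S (l - m)); last by rewrite yS// graded_br0r.
  exfalso; case: H => /negP; apply; apply: divs_trans lk _ _ => //.
  by rewrite opprB addrC subrK.
transitivity (\sum_(m <- divs S k) F m).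
  by apply: fsbigTE => m mk; apply: F0; left.
by apply: eq_bigr => m _; case: ifPn => // lm; apply: F0; right.
Qed.

Lemma bracket_wordE k x y w : supp_in x -> supp_in y ->
  {in divs S k, bracket_word x y w =1 @lie_word (T k) x y w}.
Proof.
move=> xS yS; elim: w => [//|c [|c' w] IHw] l lk; first by case: c.
have cS : supp_in (if c then y else x) by case: c.
rewrite -[LHS]/(fam_br (if c then y else x) (bracket_word x y (c' :: w)) l).
rewrite (fam_brE cS (bracket_word_supp (c' :: w) xS yS) lk).
rewrite -[RHS]/(@lbr (T k) (if c then y else x) (@lie_word (T k) x y (c' :: w)) l).
rewrite !tfamE lk big_seq_cond [RHS]big_seq_cond.
by apply: eq_bigr => m /andP[mk lmk]; rewrite IHw.
Qed.

Lemma divs_nilpotent k : exists N, nilpotent (T k) N.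
Proof.
have [SD [ht [htD ht1 fin]]] := posS.
have [N htN] : exists N, forall l, l \in divs S k -> ht l < N%:R.
  exists (Num.truncn (ht k)).+1 => l /mem_divs[Sl lk].
  apply: le_lt_trans (truncnS_gt _).
  case: lk => [->//|Skl]; rewrite -[in leRHS](subrK l k) [leRHS]htD lerDr.
  by rewrite (le_trans _ (ht1 _ Skl)).
exists N.+1; apply: (@tfam_nilpotent _ _ _ _ _ R ht N htD) => // l /mem_divs[+ _].
exact: ht1.
Qed.

(** Reduces [bch] at the divisors of [k] to a finite Dynkin sum, with a bound that does not depend
    on the two families. *)
Lemma bchE k : exists N, [/\ (1 < N)%N, nilpotent (T k) N & forall m, (N < m)%N ->
  forall x y, supp_in x -> supp_in y -> {in divs S k, bch x y =1 @bchL (T k) m x y}].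
Proof.
have [N nilT] := divs_nilpotent k; exists N.+2; split => //.
  by move=> s v Ns; apply: nilT; lia.
move=> m Nm x y xS yS l lk; rewrite /bch.
pose F n : lieQ_of g := n%:R^-1 *: \sum_(w : n.-tuple bool) log_coef w *: bracket_word x y w l.
have F0 n : (m <= n)%N -> F n = 0.
  move=> mn; rewrite /F big1 ?scaler0// => w _.
  rewrite (bracket_wordE _ xS yS lk).
  by rewrite (lie_word_nil _ _ nilT) ?scaler0// size_tuple; lia.
transitivity (\sum_(n <- iota 0 m) F n).
  rewrite (@fsbigE _ _ _ _ _ (iota 0 m))//=; first last.
  - by move=> n _; rewrite mem_iota => nm; apply: F0; lia.
  - exact: iota_uniq.
  by apply: eq_bigl => n; apply/mem_set.
have -> : iota 0 m = index_iota 0 m by rewrite /index_iota subn0.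
rewrite big_mkord /bchL fam_sumE; apply: eq_bigr => n _.
rewrite dynkin_term_tfamE /F; congr (_ *: _); apply: eq_bigr => w _.
by rewrite (bracket_wordE _ xS yS lk).
Qed.

Let eq_bchT k m x y x' y' : {in divs S k, x =1 x'} -> {in divs S k, y =1 y'} ->
  {in divs S k, @bchL (T k) m x y =1 @bchL (T k) m x' y'}.
Proof. exact: (@eq_bchL _ (lieQ_of g) _ (divs_uniq k) (@divs_clos k)). Qed.

Lemma bch_supp x y : supp_in x -> supp_in y -> supp_in (bch x y).
Proof.
move=> xS yS k Sk; apply: fsbig1 => n _; rewrite big1 ?scaler0// => w _.
by rewrite bracket_word_supp ?scaler0.
Qed.

Lemma eq_bch k x y x' y' : supp_in x -> supp_in y -> supp_in x' -> supp_in y' ->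
  {in divs S k, x =1 x'} -> {in divs S k, y =1 y'} ->
  {in divs S k, bch x y =1 bch x' y'}.
Proof.
move=> xS yS x'S y'S xx' yy' l lk; have [N [_ _ bE]] := bchE k.
by rewrite !(bE N.+1)//; exact: eq_bchT xx' yy' l lk.
Qed.

Lemma bch0l x : supp_in x -> bch (fun=> 0) x = x.
Proof.
move=> xS; apply/funext => k; have [Sk|Sk] := pselect (S k); last first.
  by rewrite bch_supp// xS.
have [N [N1 _ bE]] := bchE k; rewrite (bE N.+1)//; last exact: divs_self.
by rewrite bchL_commuting ?lbr0l ?add0r// ltnW.
Qed.

Lemma bch0r x : supp_in x -> bch x (fun=> 0) = x.
Proof.
move=> xS; apply/funext => k; have [Sk|Sk] := pselect (S k); last first.
  by rewrite bch_supp// xS.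
have [N [N1 _ bE]] := bchE k; rewrite (bE N.+1)//; last exact: divs_self.
by rewrite bchL_commuting ?lbr0r ?addr0// ltnW.
Qed.

(** The grading derivation of [phi] multiplies the component at [k] by [phi k], a nonzero scalar
    that can be cancelled from [bchL_assoc_der]. *)
Lemma bchA x y z : 
  (forall k, S k -> exists phi : Gam -> rat,
     (forall k l, phi (k + l) = phi k + phi l) /\ phi k != 0) ->
  supp_in x -> supp_in y -> supp_in z -> bch (bch x y) z = bch x (bch y z).
Proof.
move=> sep xS yS zS; apply/funext => k.
have xyS := bch_supp xS yS; have yzS := bch_supp yS zS.
have [Sk|Sk] := pselect (S k); last by rewrite !bch_supp.
have kk := divs_self Sk; have [N [N1 nilT bE]] := bchE k.
have [phi [phiD phik]] := sep k Sk.
have E := bchL_assoc_der (grading_derivation (lieQ_of g) (divs_uniq k) (@divs_clos k) phiD)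
  (x : T k) (y : T k) (z : T k) nilT (ltnSn N).
have {E} := congr1 (fun f : Gam -> g => f k) E; rewrite /grading_der => /(scalerI phik) E.
rewrite !(bE N.+1)//.
rewrite (eq_bchT _ (bE N.+1 _ x y xS yS) (fun _ _ => erefl) kk)// E.
by rewrite (eq_bchT _ (fun _ _ => erefl) (bE N.+1 _ y z yS zS) kk).
Qed.

End PositiveCone.

(** * Quadratic forms and cones *)

Lemma continuous_add (R : realType) (T : topologicalType) (f h : T -> R) :
  continuous f -> continuous h -> continuous (fun x => f x + h x).
Proof. by move=> cf ch x; apply: cvgD; [exact: cf|exact: ch]. Qed.

Lemma continuous_mul (R : realType) (T : topologicalType) (f h : T -> R) :
  continuous f -> continuous h -> continuous (fun x => f x * h x).
Proof. by move=> cf ch x; apply: cvgM; [exact: cf|exact: ch]. Qed.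

Section QuadraticForms.
Variables (R : realType) (E : vectType R).
Implicit Types (F G Q : E -> R) (x y : E).

Definition polar Q x y : R := Q (x + y) - Q x - Q y.

Lemma quadZ Q t x : quadratic_form Q -> Q (t *: x) = t ^+ 2 * Q x.
Proof. by case. Qed.

Lemma quad0 Q : quadratic_form Q -> Q 0 = 0.
Proof. by move=> qQ; rewrite -(scale0r 0) quadZ// expr0n mul0r. Qed.

Lemma quadD Q x y : Q (x + y) = Q x + Q y + polar Q x y.
Proof. by rewrite /polar; ring. Qed.

Lemma polarC Q x y : polar Q x y = polar Q y x.
Proof. by rewrite /polar [y + x]addrC; ring. Qed.

Lemma polarP Q a x y z : quadratic_form Q ->
  polar Q x (a *: y + z) = a * polar Q x y + polar Q x z.
Proof. by move=> [_ /(_ x a y z)]. Qed.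

Lemma polar0 Q x : quadratic_form Q -> polar Q x 0 = 0.
Proof. by move=> qQ; rewrite /polar addr0 quad0// subr0 subrr. Qed.

Lemma polarZ Q a x y : quadratic_form Q -> polar Q x (a *: y) = a * polar Q x y.
Proof. by move=> qQ; rewrite -[a *: y]addr0 polarP// polar0// addr0. Qed.

Lemma quadratic_formD F G : quadratic_form F -> quadratic_form G ->
  quadratic_form (fun x => F x + G x).
Proof.
move=> qF qG; split => [t x|x a y z]; first by rewrite !quadZ// mulrDr.
have := polarP a x y z qF; have := polarP a x y z qG; rewrite /polar => hG hF.
by rewrite /=; lra.
Qed.

Lemma quadratic_formZ c F : quadratic_form F -> quadratic_form (fun x => c * F x).
Proof.
move=> qF; split => [t x|x a y z]; first by rewrite !quadZ// mulrCA.
by have := polarP a x y z qF; rewrite /polar => /(congr1 ( *%R c)) hF /=; lra.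
Qed.

Lemma quadratic_form_sqr (f : E -> R) : scalar f -> quadratic_form (fun x => f x ^+ 2).
Proof.
move=> lf.
have f0 : f 0 = 0.
  by have := lf (-1) 0 0; rewrite addr0 scaler0 mulN1r => ->; rewrite addNr.
have fZ a x : f (a *: x) = a * f x by rewrite -[a *: x]addr0 lf f0 addr0.
have fD x y : f (x + y) = f x + f y by rewrite -[x]scale1r lf mul1r scale1r.
by split => [t x|x a y z]; rewrite ?fZ ?fD ?fZ; ring.
Qed.

(** [E] carries no topology, so continuity is expressed in coordinates; splitting off one vector
    leaves a square, a smaller form and a linear polar term. *)
Lemma continuous_quad (n : nat) (X : 'I_n -> E) Q : quadratic_form Q ->
  continuous (fun c : 'rV[R]_n => Q (\sum_(i < n) c ord0 i *: X i)).
Proof.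
move=> qQ.
suff H (r : seq 'I_n) : continuous (fun c : 'rV[R]_n => Q (\sum_(i <- r) c ord0 i *: X i)).
  exact: H.
elim: r => [|j r IHr].
  under eq_fun => c do rewrite big_nil; exact: cst_continuous.
have pE (c : 'rV[R]_n) : polar Q (X j) (\sum_(i <- r) c ord0 i *: X i) =
    \sum_(i <- r) c ord0 i * polar Q (X j) (X i).
  elim: r {IHr} => [|i r IHr]; first by rewrite !big_nil polar0.
  by rewrite !big_cons polarP// IHr.
have E1 : (fun c : 'rV[R]_n => Q (\sum_(i <- j :: r) c ord0 i *: X i)) =
    (fun c : 'rV[R]_n => c ord0 j ^+ 2 * Q (X j) + Q (\sum_(i <- r) c ord0 i *: X i) +
       c ord0 j * \sum_(i <- r) c ord0 i * polar Q (X j) (X i)).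
  apply/funext => c; rewrite big_cons quadD quadZ// -pE; congr (_ + _).
  by rewrite polarC polarZ// polarC.
have cc i : continuous (fun c : 'rV[R]_n => c ord0 i) by exact: coord_continuous.
have sc : continuous (fun c : 'rV[R]_n => \sum_(i <- r) c ord0 i * polar Q (X j) (X i)).
  elim: r {IHr pE E1} => [|i r IHr].
    under eq_fun => c' do rewrite big_nil; exact: cst_continuous.
  under eq_fun => c' do rewrite big_cons.
  apply: continuous_add => //.
  by apply: continuous_mul; [exact: cc|exact: cst_continuous].
rewrite E1; apply: continuous_add; last by apply: continuous_mul; [exact: cc|exact: sc].
apply: continuous_add => //.
apply: continuous_mul; last exact: cst_continuous.
by under eq_fun do rewrite expr2; apply: continuous_mul; exact: cc.
Qed.

(** Compactness of the unit sphere. *)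
Lemma quad_dominated F G : quadratic_form F -> quadratic_form G ->
  (forall x, 0 <= G x) -> (forall x, x != 0 -> G x = 0 -> F x < 0) ->
  exists C, 0 < C /\ forall x, x != 0 -> F x < C * G x.
Proof.
move=> qF qG G0 FG.
pose n := \dim {:E}; pose X := vbasis {:E}.
pose lift (c : 'rV[R]_n) : E := \sum_(i < n) c ord0 i *: X`_i.
have bX : basis_of fullv X by exact: vbasisP.
have liftZ t c : lift (t *: c) = t *: lift c.
  by rewrite /lift scaler_sumr; apply: eq_bigr => i _; rewrite mxE scalerA.
have lift_surj x : exists c, x = lift c.
  exists (\row_i coord X i x); rewrite [LHS](coord_basis bX (memvf x)).
  by apply: eq_bigr => i _; rewrite mxE.
have lift_inj c : lift c = 0 -> c = 0.
  move=> c0; apply/rowP => i; rewrite mxE.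
  by rewrite -(coord_sum_free (fun j => c ord0 j) i (basis_free bX)) -/(lift c) c0 linear0.
have cF : continuous (F \o lift) := @continuous_quad n (fun i => X`_i) F qF.
have cG : continuous (G \o lift) := @continuous_quad n (fun i => X`_i) G qG.
(* Only the part of the sphere where [F] is nonnegative matters. There [G] is positive by
   hypothesis, so it has a positive minimum. *)
pose K := [set c : 'rV[R]_n | `|c| = 1] `&` [set c | 0 <= F (lift c)].
have scale x : x != 0 -> exists t c, [/\ 0 < t, `|c| = 1 & x = t *: lift c].
  have [c ->] := lift_surj x => c0.
  have nc : 0 < `|c|.
    rewrite normr_gt0; apply: contra c0 => /eqP ->.
    by rewrite -(scale0r 0) liftZ scale0r.
  exists `|c|, (`|c|^-1 *: c); split => //.
    by rewrite normrZ normfV normr_id mulVf// gt_eqF.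
  by rewrite -liftZ scalerA divff ?scale1r// gt_eqF.
have neg x C : 0 < C -> F x < 0 -> F x < C * G x.
  by move=> C0 Fx; rewrite (lt_le_trans Fx)// mulr_ge0// ltW.
have [K0|K0] := eqVneq K set0.
  exists 1; split => // x /scale[t [c [t0 c1 ->]]]; apply: neg => //.
  rewrite quadZ// pmulr_rlt0 ?exprn_gt0// ltNge; apply/negP => Fc.
  by have : K c by []; rewrite K0.
have cK : compact K.
  apply: bounded_closed_compact.
    by exists 1; split => // M M1 c [/= -> _]; exact: ltW.
  apply: closedI.
    apply: (@preimage_closed _ _ (fun c : 'rV[R]_n => `|c|) [set 1]).
      by move=> c _; exact: norm_continuous.
    exact: closed_eq.
  apply: (@preimage_closed _ _ (F \o lift) [set y | 0 <= y]).
    by move=> c _; exact: cF.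
  exact: closed_ge.
have K0' : K !=set0 by exact/set0P.
have wF : {within K, continuous (F \o lift)} by exact: continuous_subspaceT.
have wG : {within K, continuous (G \o lift)} by exact: continuous_subspaceT.
have [c1 /set_mem c1K F1] := EVT_max_rV K0' cK wF.
have [c2 /set_mem c2K G2] := EVT_min_rV K0' cK wG.
have Kpos c : K c -> 0 < G (lift c).
  move=> [/= cn Fc]; rewrite lt_neqAle G0 andbT eq_sym; apply/eqP => Gc.
  suff : F (lift c) < 0 by rewrite ltNge Fc.
  apply: FG => //; apply/eqP => /lift_inj c0; move: cn; rewrite c0 normr0.
  by move/eqP; rewrite eq_sym oner_eq0.
have g2 := Kpos _ c2K; have f1 : 0 <= F (lift c1) by case: c1K.
(* The maximum of [F] over the minimum of [G] on [K], plus 1 for a strict inequality. *)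
exists (F (lift c1) / G (lift c2) + 1); have C0 : 0 < F (lift c1) / G (lift c2) + 1.
  by rewrite ltr_wpDl// divr_ge0// ltW.
split => // x /scale[t [c [t0 c1' ->]]].
have [Fc|Fc] := ltP (F (lift c)) 0.
  by apply: neg => //; rewrite quadZ// pmulr_rlt0 ?exprn_gt0.
have Kc : K c by [].
rewrite !quadZ// mulrCA ltr_pM2l ?exprn_gt0// (le_lt_trans (F1 _ (mem_set Kc)))//.
rewrite mulrDl mul1r (le_lt_trans (y := F (lift c1) / G (lift c2) * G (lift c)))//.
  rewrite -mulrA ler_peMr//= mulrC ler_pdivlMr// mul1r.
  exact: (G2 _ (mem_set Kc)).
by rewrite ltrDl Kpos.
Qed.

End QuadraticForms.

Lemma finite_pos_lower_bound (R : realType) (T : choiceType) (A : set T) (h : T -> R) :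
  finite_set A -> (forall x, A x -> 0 < h x) ->
  exists e, 0 < e /\ forall x, A x -> e <= h x.
Proof.
move=> /finite_seqP[s ->]; elim: s => [|y s IHs] h0; first by exists 1.
have [|e [e0 he]] := IHs; first by move=> x xs; apply: h0; rewrite /= inE xs orbT.
exists (Num.min e (h y)); split.
  by rewrite lt_min e0 h0//= inE eqxx.
move=> x /=; rewrite inE => /predU1P[->|/he xe]; first by rewrite ge_min lexx orbT.
by rewrite ge_min xe.
Qed.

Section PositiveDefinite.
Variables (R : realType) (E : vectType R) (P : E -> R).
Hypotheses (qP : quadratic_form P) (P_gt0 : forall x, x != 0 -> 0 < P x).

Lemma posdef_ge0 x : 0 <= P x.
Proof. by have [->|/P_gt0/ltW//] := eqVneq x 0; rewrite quad0. Qed.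

(** [P] is evaluated at the point of the line x + R y where it is minimal; the factor 2 appears
    because [polar] is twice the bilinear form. *)
Lemma posdef_cauchy x y : polar P x y <= 2 * (Num.sqrt (P x) * Num.sqrt (P y)).
Proof.
have [->|y0] := eqVneq y 0.
  by rewrite polar0// mulr_ge0// mulr_ge0 ?sqrtr_ge0.
have Py := P_gt0 y0; have Px := posdef_ge0 x.
have := posdef_ge0 (x + (- (polar P x y / (2 * P y))) *: y).
rewrite quadD quadZ// polarZ//.
set b := polar P x y => H.
have b2 : b ^+ 2 <= 4 * (P x * P y).
  have -> : b ^+ 2 = 4 * P y * (b ^+ 2 / (4 * P y)).
    by rewrite mulrC divfK// mulf_neq0 ?gt_eqF.
  rewrite -mulrA ler_pM2l// [P x * _]mulrC ler_pM2l//.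
  have E1 : P x + (- (b / (2 * P y))) ^+ 2 * P y + - (b / (2 * P y)) * b =
      P x - b ^+ 2 / (4 * P y).
    by field; rewrite gt_eqF.
  by move: H; rewrite E1 subr_ge0.
rewrite (le_trans (ler_norm _))// -sqrtrM// -(@ler_pXn2r _ 2) ?nnegrE//.
  rewrite exprMn sqr_sqrtr ?mulr_ge0 ?(ltW Py)// -normrX ger0_norm ?sqr_ge0//.
  by rewrite -[2 ^+ 2]/(2 * 2 : R) -natrM.
Qed.

Lemma posdef_norm : is_norm (fun x => Num.sqrt (P x)).
Proof.
split=> [x|x /eqP|t x|x y]; first exact: sqrtr_ge0.
- rewrite sqrtr_eq0; have [//|/P_gt0] := eqVneq x 0.
  by rewrite ltNge => /negbTE ->.
- by rewrite quadZ// sqrtrM ?sqr_ge0// sqrtr_sqr.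
rewrite -(@ler_pXn2r _ 2) ?nnegrE ?addr_ge0 ?sqrtr_ge0//.
rewrite sqrrD !sqr_sqrtr ?posdef_ge0// quadD.
by have := posdef_cauchy x y; lra.
Qed.

End PositiveDefinite.

(** * Lattice points and the linear extension of [Z] *)

Section Lattice.
Variables (R : realType) (Gam : zmodType) (E : vectType R).
Variables (iota : {additive Gam -> E}).
Hypothesis hiota : real_span iota.

Lemma lattice_coord : exists (n : nat) (X : n.-tuple E) (c : Gam -> 'rV[int]_n),
  [/\ basis_of fullv X, forall k l, c (k + l) = c k + c l,
      forall k, iota k = \sum_(i < n) (c k 0 i)%:~R *: X`_i,
      forall k, c k = 0 -> k = 0 &
      forall i, exists b, X`_i = iota b].
Proof.
have [n [b [Zb bas]]] := hiota.
have Xi i : [seq iota x | x <- b]`_i = iota (nth 0 b i).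
  have [ib|ib] := ltnP i (size b); first by rewrite (nth_map 0).
  by rewrite !nth_default ?size_map// raddf0.
pose c k := sval (cid (Zb k)).
have cE k : k = \sum_(i < n) tnth b i *~ c k 0 i by rewrite /c; case: cid => x [].
have cU k (d : 'rV[int]_n) : k = \sum_(i < n) tnth b i *~ d 0 i -> c k = d.
  by rewrite /c; case: cid => x [_ xu] /= /xu.
exists n, (map_tuple iota b), c; split => //.
- move=> k l; apply: cU; rewrite {1}(cE k) {1}(cE l) -big_split/=.
  by apply: eq_bigr => i _; rewrite mxE mulrzDr.
- move=> k; rewrite {1}(cE k) raddf_sum; apply: eq_bigr => i _.
  by rewrite raddfMz scaler_int Xi (tnth_nth 0).
- by move=> k ck; rewrite (cE k) ck big1// => i _; rewrite mxE mulr0z.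
- by move=> i; exists (nth 0 b i); exact: Xi.
Qed.

Lemma lattice_separated k : k != 0 -> exists phi : Gam -> rat,
  (forall l m, phi (l + m) = phi l + phi m) /\ phi k != 0.
Proof.
have [n [X [c [_ cD _ c0 _]]]] := lattice_coord => k0.
have [i ci] : exists i, c k 0 i != 0.
  apply/not_existsP => ck; move/eqP: k0; apply; apply: c0; apply/rowP => i.
  by rewrite mxE; apply/eqP; have /negP := ck i; rewrite negbK.
exists (fun l => (c l 0 i)%:~R); split => [l m|]; first by rewrite cD mxE intrD.
by rewrite intr_eq0.
Qed.

Lemma iota_eq0 k : iota k = 0 -> k = 0.
Proof.
have [n [X [c [bX _ iE c0 _]]]] := lattice_coord => ik; apply: c0; apply/rowP => i.
have := coord_sum_free (fun i => (c k 0 i)%:~R) i (basis_free bX).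
by rewrite -iE ik linear0 mxE => /esym/eqP; rewrite intr_eq0 => /eqP.
Qed.

Lemma finite_lattice_ball (P : E -> R) (t : R) : quadratic_form P ->
  (forall x, x != 0 -> 0 < P x) -> finite_set [set k | P (iota k) <= t].
Proof.
move=> qP P0.
have [n [X [c [bX cD iE c0 _]]]] := lattice_coord.
have iC k i : coord X i (iota k) = (c k 0 i)%:~R.
  by rewrite iE (coord_sum_free _ _ (basis_free bX)).
(* The square of a coordinate is a quadratic form, hence dominated by [P]; a bound on [P] thus
   bounds all the integer coordinates. *)
have bnd i : exists C, 0 < C /\ forall x, coord X i x ^+ 2 <= C * P x.
  have sc : scalar (coord X i) by move=> a x y; rewrite linearP.
  have [||C [C0 HC]] := quad_dominated (quadratic_form_sqr sc) qP.
  - exact: posdef_ge0.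
  - by move=> x /P0 + Px; rewrite Px ltxx.
  exists C; split => // x; have [->|/HC/ltW//] := eqVneq x 0.
  by rewrite linear0 quad0// expr0n mulr0.
pose C i := sval (cid (bnd i)).
have [M HM] : exists M : nat, forall k i, P (iota k) <= t -> `|c k 0 i| < M%:Z.
  have HMi i : exists M : nat, forall k, P (iota k) <= t -> `|c k 0 i| < M%:Z.
    have [D [D0 HD]] := bnd i.
    exists (Num.truncn (D * t + 1)).+1 => k kt.
    have : (`|c k 0 i|%:~R : R) ^+ 2 <= D * t.
      rewrite intr_norm -normrX ger0_norm ?sqr_ge0// -iC.
      by rewrite (le_trans (HD _))// ler_pM2l.
    move=> H; rewrite -(ltr_int R) (le_lt_trans _ (truncnS_gt _))//.
    have : 0 <= (`|c k 0 i|%:~R : R) by rewrite ler0z.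
    by nra.
  pose M i := sval (cid (HMi i)).
  exists (\max_i M i) => k i kt.
  apply: (@lt_le_trans _ _ (M i)%:Z); last by rewrite lez_nat leq_bigmax.
  by rewrite /M; case: cid => m /= Hm; exact: Hm.
have cinj : injective c.
  move=> k l kl; apply/eqP; rewrite -subr_eq0; apply/eqP/c0.
  have cN : c (- l) = - c l.
    have := cD l (- l); rewrite subrr => /esym/eqP.
    have -> : c 0 = 0 by have /eqP := cD 0 0; rewrite addr0 -subr_eq subrr => /eqP.
    by rewrite addrC addr_eq0 => /eqP.
  by rewrite cD cN kl subrr.
pose B : set 'rV[int]_n := range (fun f : {ffun 'I_n -> 'I_(M + M).+1} =>
  \row_i ((f i : nat)%:Z - M%:Z)).
have finB : finite_set B by exact: finite_image finite_finset.
suff -> : [set k | P (iota k) <= t] = (c @^-1` B) `&` [set k | P (iota k) <= t].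
  by apply: finite_setIl; apply: finite_preimage finB => ? ? _ _; exact: cinj.
apply/seteqP; split => [k /= kt|k []//]; split => //.
exists [ffun i => inord (absz (c k 0 i + M%:Z))] => //.
apply/rowP => i; rewrite mxE ffunE inordK; have := HM k i kt;
  by move: (c k 0 i) => v; rewrite ltr_norml => /andP[]; lia.
Qed.

End Lattice.

Section LinearExtension.
Variables (R : realType) (Gam : zmodType) (E : vectType R).
Variables (iota : {additive Gam -> E}).
Hypothesis hiota : real_span iota.
Variable Z : Gam -> plane R.
Hypothesis Zadd : zmod_morphism Z.

Lemma lin_ext_spec :
  linear (lin_ext iota Z) /\ forall k, lin_ext iota Z (iota k) = Z k.
Proof.
have [n [X [c [bX cD iE c0 Xi]]]] := lattice_coord hiota.
pose b i := sval (cid (Xi i)); have bE i : X`_i = iota (b i) by rewrite /b; case: cid.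
pose f x : plane R := \sum_(i < n) coord X i x *: Z (b i).
have lf : linear f.
  move=> a x y; rewrite scaler_sumr -big_split/=; apply: eq_bigr => i _.
  by rewrite linearP scalerDl scalerA.
pose ZA : {additive Gam -> plane R} := HB.pack Z (GRing.isZmodMorphism.Build _ _ Z Zadd).
have fZ k : f (iota k) = Z k.
  have inj l m : iota l = iota m -> l = m.
    move=> lm; apply/eqP; rewrite -subr_eq0; apply/eqP/(iota_eq0 hiota).
    by rewrite raddfB lm subrr.
  have -> : k = \sum_(i < n) b i *~ c k 0 i.
    apply: inj; rewrite {1}iE raddf_sum; apply: eq_bigr => i _.
    by rewrite raddfMz -bE scaler_int.
  set k' := \sum_(i < n) _.
  have -> : Z k' = \sum_(i < n) (c k 0 i)%:~R *: Z (b i).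
    rewrite -[Z]/(ZA : _ -> _) raddf_sum; apply: eq_bigr => i _.
    by rewrite raddfMz scaler_int.
  have -> : iota k' = \sum_(i < n) (c k 0 i)%:~R *: X`_i.
    by rewrite raddf_sum; apply: eq_bigr => i _; rewrite raddfMz -bE scaler_int.
  by apply: eq_bigr => i _; rewrite (coord_sum_free _ _ (basis_free bX)).
pose fl : {linear E -> plane R} := HB.pack f (GRing.isLinear.Build _ _ _ _ f lf).
have E1 x : lin_ext iota Z x = f x.
  apply: xget_unique => [|y]; first by exists fl.
  move=> [h [hZ <-]]; rewrite [x in LHS](coord_basis bX (memvf x)).
  rewrite linear_sum; apply: eq_bigr => i _.
  by rewrite linearZ bE hZ.
by split=> [a x y|k]; rewrite !E1; [exact: lf|exact: fZ].
Qed.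

End LinearExtension.

Section Cones.
Variables (R : realType) (Gam : zmodType) (E : vectType R).
Variables (iota : {additive Gam -> E}).
Hypothesis hiota : real_span iota.
Variables (Z : Gam -> plane R) (Q : E -> R).
Hypotheses (Zadd : zmod_morphism Z) (qQ : quadratic_form Q).
Let z := lin_ext iota Z.

Let zP a x y : z (a *: x + y) = a *: z x + z y.
Proof. by have [+ _] := lin_ext_spec hiota Zadd; exact. Qed.
Let z0 : z 0 = 0.
Proof. by have := zP (-1) 0 0; rewrite addr0 scaler0 scaleN1r => ->; rewrite addNr. Qed.
Let zZ a x : z (a *: x) = a *: z x.
Proof. by rewrite -[a *: x]addr0 zP z0 addr0. Qed.
Let zD x y : z (x + y) = z x + z y.
Proof. by rewrite -[x]scale1r zP !scale1r. Qed.
Let zi k : z (iota k) = Z k.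
Proof. by have [_] := lin_ext_spec hiota Zadd; exact. Qed.

Definition Zsq x : R := (z x).1 ^+ 2 + (z x).2 ^+ 2.

Lemma quadratic_Zsq : quadratic_form Zsq.
Proof.
by apply: quadratic_formD; apply: quadratic_form_sqr => a x y; rewrite zP.
Qed.

Lemma Zsq_ge0 x : 0 <= Zsq x.
Proof. by rewrite addr_ge0 ?sqr_ge0. Qed.

Lemma Zsq_eq0 x : Zsq x = 0 -> z x = 0.
Proof.
move=> /eqP; rewrite paddr_eq0 ?sqr_ge0// !sqrf_eq0 => /andP[/eqP a /eqP b].
by apply: injective_projections.
Qed.

(** The negativity of [Q] on [Ker Z] enters all the estimates through this
    bound. *)
Lemma neg_on_ker_dominated : neg_on_ker iota Q Z ->
  exists C, 0 < C /\ forall x, x != 0 -> 0 < C * Zsq x - Q x.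
Proof.
move=> neg; have [||C [C0 HC]] := quad_dominated qQ quadratic_Zsq.
- exact: Zsq_ge0.
- by move=> x x0 /Zsq_eq0; exact: neg.
by exists C; split => // x /HC; rewrite subr_gt0.
Qed.

Lemma quadratic_slack C : quadratic_form (fun x => C * Zsq x - Q x).
Proof.
have -> : (fun x => C * Zsq x - Q x) = (fun x => C * Zsq x + -1 * Q x).
  by apply/funext => x; rewrite mulN1r.
by apply: quadratic_formD; apply: quadratic_formZ => //; exact: quadratic_Zsq.
Qed.

Hypothesis neg : neg_on_ker iota Q Z.

(** The positive definite form C |Z|^2 - Q is at most C |Z|^2 where [Q] is nonnegative; its square
    root is the norm. *)
Lemma support_norm : exists N : E -> R, is_norm N /\
  exists C, 0 < C /\ forall x, 0 <= Q x -> N x <= C * modulus (z x).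
Proof.
have [C [C0 HC]] := neg_on_ker_dominated neg.
exists (fun x => Num.sqrt (C * Zsq x - Q x)); split.
  exact: posdef_norm (quadratic_slack C) HC.
exists (Num.sqrt C); split => [|x Qx]; first by rewrite sqrtr_gt0.
by rewrite /modulus -sqrtrM ?(ltW C0)// ler_wsqrtr// lerBlDr lerDl.
Qed.

(** On the preimage of a line, [Q] has at most one nonnegative direction, so
    the reversed Cauchy-Schwarz inequality makes half of [Q >= 0] convex. *)
Lemma ray_convex (v : plane R) x : v != 0 ->
  cone_hull [set x | [/\ x != 0, ray v (z x) & 0 <= Q x]] x ->
  ray v (z x) /\ 0 <= Q x.
Proof.
move=> v0.
elim => {x} [x []//|x y _ [[s /= s0 sx] Qx] _ [[t /= t0 ty] Qy]
  |t x t0 _ [[s /= s0 sx] Qx]].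
- split; first by exists (s + t); rewrite /= ?addr_gt0// zD -sx -ty scalerDl.
  (* With Z x = s v and Z y = t v this vector lies in Ker Z. Expanding its nonpositive value makes
     the polar term nonnegative, so Q (x + y) is at least Q x + Q y. *)
  have : Q (x - (s / t) *: y) <= 0.
    have [->|h0] := eqVneq (x - (s / t) *: y) 0; first by rewrite quad0.
    apply/ltW/neg => //; rewrite -/z -scaleNr addrC zP -sx -ty scalerA.
    by rewrite mulNr divfK ?gt_eqF// scaleNr addNr.
  have st : 0 < s / t by rewrite divr_gt0.
  rewrite -scaleNr (quadD Q x (- (s / t) *: y)) (quadD Q x y) quadZ// polarZ// sqrrN.
  have : 0 <= (s / t) ^+ 2 * Q y by rewrite mulr_ge0// sqr_ge0.
  set w := (s / t) ^+ 2 * Q y; move: st; set u := s / t => u0 w0 H.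
  have : 0 <= u * polar Q x y by move: H; rewrite mulNr; lra.
  by rewrite pmulr_rge0//; lra.
- split; first by exists (t * s); rewrite /= ?mulr_gt0// zZ -sx scalerA.
  by rewrite quadZ// mulr_ge0// sqr_ge0.
Qed.

Lemma cone_strictly_positive (V : sector R) (a b d : R) : 0 < d ->
  (forall v, sval V v -> 0 < a * v.1 + b * v.2 /\
     d * modulus v <= a * v.1 + b * v.2) ->
  strictly_positive R [set k | cone iota V Z Q (iota k)].
Proof.
move=> d0 Vab; pose f (v : plane R) : R := a * v.1 + b * v.2.
have fD u v : f (u + v) = f u + f v by rewrite /f /=; ring.
have fZ t v : f (t *: v) = t * f v by rewrite /f /= /GRing.scale /=; ring.
have [C [C0 HC]] := neg_on_ker_dominated neg.
pose N x := Num.sqrt (C * Zsq x - Q x).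
have [N0 _ NZ ND] : is_norm N := posdef_norm (quadratic_slack C) HC.
pose M := Num.sqrt C / d; have M0 : 0 < M by rewrite divr_gt0 ?sqrtr_gt0.
(* The bound on [N] holds on generators and passes to sums and multiples, [N] being a norm and [f]
   linear. Sublevel sets of [f] in the cone then lie in balls of [N]. *)
have key x : cone iota V Z Q x -> 0 < f (z x) /\ N x <= M * f (z x).
  elim=> {x} [x [x0 Vx Qx]|x y _ [fx Nx] _ [fy Ny]|t x t0 _ [fx Nx]].
  - have [f0 df] := Vab _ Vx; split => //.
    apply: (@le_trans _ _ (Num.sqrt C * modulus (z x))).
      by rewrite /modulus -sqrtrM ?(ltW C0)// ler_wsqrtr// lerBlDr lerDl.
    by rewrite /M -mulrA ler_pM2l ?sqrtr_gt0// mulrC ler_pdivlMr// mulrC.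
  - rewrite zD fD; split; first exact: addr_gt0.
    by rewrite (le_trans (ND _ _))// mulrDr lerD.
  - rewrite zZ fZ NZ (gtr0_norm t0); split; first exact: mulr_gt0.
    by rewrite mulrCA ler_pM2l.
have fin t : finite_set [set k | cone iota V Z Q (iota k) /\ f (Z k) <= t].
  apply: sub_finite_set (finite_lattice_ball hiota ((M * t) ^+ 2) (quadratic_slack C) HC).
  move=> k [/= /key[fk Nk]]; rewrite zi in fk Nk * => kt.
  have Nt : N (iota k) <= M * t by rewrite (le_trans Nk)// ler_pM2l.
  rewrite -[leLHS]sqr_sqrtr ?(posdef_ge0 (quadratic_slack C) HC)//.
  by rewrite ler_sqr ?nnegrE ?N0// (le_trans (N0 _) Nt).
split; first by move=> k l Sk Sl; rewrite /= raddfD; exact: cone_add.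
have [|e [e0 he]] := @finite_pos_lower_bound R _ _ (fun k => f (Z k)) (fin 1).
  by move=> k [/key[+ _] _]; rewrite zi.
(* [e] bounds [f] below on the finitely many lattice points with f at most 1, and 1 does so on the
   others; dividing by [e'] makes all heights at least 1. *)
pose e' := Num.min e 1; have e'0 : 0 < e' by rewrite lt_min e0 ltr01.
exists (fun k => f (Z k) / e'); split.
- by move=> k l; rewrite -!zi raddfD zD fD mulrDl.
- move=> k Sk; rewrite ler_pdivlMr// mul1r.
  have [fk|fk] := leP (f (Z k)) 1; first by rewrite ge_min he.
  by rewrite ge_min (ltW fk) orbT.
- by move=> t; apply: sub_finite_set (fin (t * e')) => k [Sk]; rewrite ler_pdivrMr.
Qed.

End Cones.

(** * Sectors *)

Section Sectors.
Variable R : realType.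
Implicit Types (u v w : plane R) (V : sector R) (t : R).

Definition det u w : R := u.1 * w.2 - u.2 * w.1.

Definition angular (I : interval R) : set (plane R) :=
  [set v | exists r t, [/\ 0 < r, t \in I & v = (r * cos t, r * sin t)]].

Lemma sector_angular V : exists c1 c2 (t1 t2 : R),
  [/\ t2 - t1 < pi, sval V = angular (Interval (BSide c1 t1) (BSide c2 t2)) &
      forall t, t \in Interval (BSide c1 t1) (BSide c2 t2) -> t1 <= t <= t2].
Proof.
have [c1 [c2 [t1 [t2 [t12 _ VE]]]]] := svalP V; exists c1, c2, t1, t2; split => // t.
by case: c1 {VE}; case: c2; rewrite in_itv/= => /andP[]; lra.
Qed.

Lemma modulus_polar r t : 0 < r -> modulus (r * cos t, r * sin t) = r.
Proof.
move=> r0; rewrite /modulus /= !exprMn -mulrDr cos2Dsin2 mulr1 sqrtr_sqr.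
exact: gtr0_norm.
Qed.

Lemma modulusZ r v : 0 < r -> modulus (r *: v) = r * modulus v.
Proof.
move=> r0; rewrite /modulus /= !exprMn -mulrDr sqrtrM ?sqr_ge0// sqrtr_sqr.
by rewrite (gtr0_norm r0).
Qed.

(** The scalar product with the bisecting direction; [d] is the cosine of half the opening angle,
    positive because the angle is less than pi. *)
Lemma sector_functional V : exists a b d : R, 0 < d /\
  forall v, sval V v -> 0 < a * v.1 + b * v.2 /\ d * modulus v <= a * v.1 + b * v.2.
Proof.
have [c1 [c2 [t1 [t2 [t12 -> It]]]]] := sector_angular V.
have [t21|t21] := ltP t2 t1.
  exists 0, 0, 1; split => // v [r [t [_ /It]]]; lra.
pose m := (t1 + t2) / 2; exists (cos m), (sin m), (cos ((t2 - t1) / 2)).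
have c0 : 0 < cos ((t2 - t1) / 2).
  by apply: cos_gt0_pihalf; have := pi_gt0 R; move: t12; set p := pi; lra.
split => // _ [r [t [r0 /It tI ->]]].
rewrite modulus_polar//= (_ : _ + _ = r * cos (t - m)); last by rewrite cosB; ring.
have cm : cos ((t2 - t1) / 2) <= cos (t - m).
  rewrite -[leRHS]cos_norm leNgt ltr_cos ?in_itv/= -?leNgt.
  - by rewrite ler_norml /m; move: tI; lra.
  - by have := pi_gt0 R; move: t12; set p := pi; lra.
  - rewrite normr_ge0/= ler_norml /m; move: tI; have := pi_gt0 R; move: t12.
    by set p := pi; lra.
split; first by rewrite mulr_gt0// (lt_le_trans c0).
by rewrite mulrC ler_pM2l.
Qed.

Lemma sector_neq0 V v : sval V v -> v != 0.
Proof.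
have [a [b [d [_ ab]]]] := sector_functional V => /ab[+ _].
by apply: contraTneq => ->; rewrite /= !mulr0 addr0 ltxx.
Qed.

Lemma sectorZ V r v : 0 < r -> sval V v -> sval V (r *: v).
Proof.
have [c1 [c2 [t1 [t2 [_ -> _]]]]] := sector_angular V.
move=> r0 [s [t [s0 tI ->]]]; exists (r * s), t; split => //.
  exact: mulr_gt0.
by apply: injective_projections; rewrite /= /GRing.scale/= mulrA.
Qed.

(** A direction for v + w between those of [v] and [w] is found by the intermediate value theorem;
    the positive functional then fixes the sign. *)
Lemma sectorD V v w : sval V v -> sval V w -> sval V (v + w).
Proof.
have [a [b [d [_ ab]]]] := sector_functional V.
have [c1 [c2 [t1 [t2 [t12 VE It]]]]] := sector_angular V.
wlog : v w / exists r s r' t, [/\ 0 < r, 0 < r', s <= t &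
    [/\ s \in Interval (BSide c1 t1) (BSide c2 t2),
    t \in Interval (BSide c1 t1) (BSide c2 t2), v = (r * cos s, r * sin s) &
    w = (r' * cos t, r' * sin t)]].
  move=> H Vv Vw; move: (Vv) (Vw); rewrite {1 2}VE.
  move=> [r [s [r0 sI vE]]] [r' [t [r'0 tI wE]]].
  have [st|ts] := leP s t; first by apply: H => //; exists r, s, r', t.
  by rewrite addrC; apply: H => //; exists r', t, r, s; split => //; exact: ltW.
move=> [r [s [r' [t [r0 r'0 st [sI tI vE wE]]]]]] Vv Vw.
(* Component of v + w orthogonal to the direction of angle [x]. *)
pose h x := r * sin (s - x) + r' * sin (t - x).
have ch : continuous h.
  have cB p : continuous (fun x : R => sin (p - x)).
    move=> x; apply: (@continuous_comp _ _ _ (fun x => p - x) sin); last exact: continuous_sin.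
    by apply: cvgB; [exact: cvg_cst|exact: cvg_id].
  by move=> x; apply: cvgD; apply: cvgM; first [exact: cvg_cst|exact: cB].
have sin_st : 0 <= sin (t - s).
  by apply: sin_ge0_pi; have := It _ sI; have := It _ tI; move: t12; set p := pi; lra.
have hs : 0 <= h s by rewrite /h subrr sin0 mulr0 add0r mulr_ge0// ltW.
have ht : h t <= 0.
  by rewrite /h subrr sin0 mulr0 addr0 pmulr_rle0// -opprB sinN oppr_le0.
have [x xst hx] : exists2 x, x \in `[s, t] & h x = 0.
  apply: IVT => //; first exact: continuous_subspaceT.
  by rewrite ge_min ht orbT le_max hs.
have xI : x \in Interval (BSide c1 t1) (BSide c2 t2).
  move: xst sI tI; rewrite in_itv/= => /andP[sx xt].
  by case: (c1); case: (c2); rewrite !in_itv/= => /andP[? ?] /andP[? ?]; lra.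
pose rho := r * cos (s - x) + r' * cos (t - x).
have E : v + w = (rho * cos x, rho * sin x).
  have cs y : cos y = cos (y - x) * cos x - sin (y - x) * sin x.
    by rewrite -cosD subrK.
  have sn y : sin y = sin (y - x) * cos x + cos (y - x) * sin x.
    by rewrite -sinD subrK.
  rewrite vE wE; apply: injective_projections => /=.
    rewrite (cs s) (cs t) /rho; apply/eqP; rewrite -subr_eq0; apply/eqP.
    by transitivity (- h x * sin x); [rewrite /h; ring|rewrite hx; ring].
  rewrite (sn s) (sn t) /rho; apply/eqP; rewrite -subr_eq0; apply/eqP.
  by transitivity (h x * cos x); [rewrite /h; ring|rewrite hx; ring].
rewrite VE; exists rho, x; split => //.
have Vx : sval V (1 * cos x, 1 * sin x) by rewrite VE; exists 1, x.
have [fv _] := ab _ Vv; have [fw _] := ab _ Vw; have [/= fx _] := ab _ Vx.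
have : 0 < rho * (a * (1 * cos x) + b * (1 * sin x)).
  have -> : rho * (a * (1 * cos x) + b * (1 * sin x)) = a * (v + w).1 + b * (v + w).2.
    by rewrite E /=; ring.
  by rewrite /= !mulrDr addrACA addr_gt0.
by rewrite pmulr_lgt0.
Qed.

Lemma sector_ray V v w : sval V v -> ray v w -> sval V w.
Proof. by move=> Vv [r r0 <-]; exact: sectorZ. Qed.

Lemma rayP v w : v != 0 -> ray v w -> ray w = ray v.
Proof.
move=> v0 [r /= r0 <-]; apply/seteqP; split => [_ [s /= s0 <-]|_ [s /= s0 <-]].
  by exists (s * r); rewrite ?scalerA//=; exact: mulr_gt0.
by exists (s / r); rewrite /= ?divr_gt0// scalerA divfK// gt_eqF.
Qed.

Lemma ray_self v : ray v v. Proof. by exists 1; rewrite /= ?ltr01 ?scale1r. Qed.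

Lemma det_eq0_ray V v w : sval V v -> sval V w -> det v w = 0 -> ray v w.
Proof.
have [a [b [d [_ ab]]]] := sector_functional V.
move=> /ab[fv _] /ab[fw _] dvw; set x := _ + _ in fv; set y := _ + _ in fw.
exists (y / x); rewrite /= ?divr_gt0//; apply: (@scalerI _ _ x); first by rewrite gt_eqF.
rewrite scalerA mulrC divfK ?gt_eqF//.
apply: injective_projections; rewrite /= /GRing.scale/=;
  apply/eqP; rewrite -subr_eq0; apply/eqP.
  by transitivity (b * det v w); [rewrite /det /x /y; ring|rewrite dvw mulr0].
by transitivity (- a * det v w); [rewrite /det /x /y; ring|rewrite dvw mulr0].
Qed.

(** Pluecker's identity, paired with a functional positive on [V]. *)
Lemma det_trans V u v w : sval V u -> sval V v -> sval V w ->
  det u v < 0 -> det v w < 0 -> det u w < 0.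
Proof.
have [a [b [d [_ ab]]]] := sector_functional V.
move=> /ab[fu _] /ab[fv _] /ab[fw _] uv vw.
have : det u w * (a * v.1 + b * v.2) =
  det u v * (a * w.1 + b * w.2) + det v w * (a * u.1 + b * u.2).
  by rewrite /det; ring.
move=> E; rewrite -(pmulr_llt0 _ fv) E.
have h1 : det u v * (a * w.1 + b * w.2) < 0 by rewrite pmulr_llt0.
have h2 : det v w * (a * u.1 + b * u.2) < 0 by rewrite pmulr_llt0.
by move: h1 h2; set p := det u v * _; set q := det v w * _; lra.
Qed.

Lemma det_trans_le V v u w : sval V u -> sval V v -> sval V w ->
  det u v <= 0 -> det v w <= 0 -> det u w <= 0.
Proof.
have [a [b [d [_ ab]]]] := sector_functional V.
move=> /ab[fu _] /ab[fv _] /ab[fw _] uv vw.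
have : det u w * (a * v.1 + b * v.2) =
  det u v * (a * w.1 + b * w.2) + det v w * (a * u.1 + b * u.2).
  by rewrite /det; ring.
move=> E; rewrite -(pmulr_lle0 _ fv) E.
have h1 : det u v * (a * w.1 + b * w.2) <= 0 by rewrite pmulr_lle0.
have h2 : det v w * (a * u.1 + b * u.2) <= 0 by rewrite pmulr_lle0.
by move: h1 h2; set p := det u v * _; set q := det v w * _; lra.
Qed.

Lemma ray_det v w : ray v w -> det v w = 0.
Proof. by move=> [r _ <-]; rewrite /det /= /GRing.scale/=; ring. Qed.
Lemma detC u v : det u v = - det v u. Proof. by rewrite /det; ring. Qed.
Lemma detvv v : det v v = 0. Proof. by rewrite /det; ring. Qed.

(** The sign of [det v w] is that of the difference of angles, as this is less than pi in absolute
    value. The pieces are the part before the ray of [v], the ray with the part after it, and the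
    part after it; two of them may be empty, and a strict sector is nonempty. *)
Lemma sector_split V v : sval V v ->
  [/\ (exists w, sval V w /\ 0 < det v w) -> strict_sector [set w | sval V w /\ 0 < det v w],
      strict_sector [set w | sval V w /\ det v w <= 0] &
      (exists w, sval V w /\ det v w < 0) -> strict_sector [set w | sval V w /\ det v w < 0]].
Proof.
have [c1 [c2 [t1 [t2 [t12 VE It]]]]] := sector_angular V.
rewrite VE => -[r [s [r0 sI vE]]]; have sb := It _ sI.
have dE r' t : det v (r' * cos t, r' * sin t) = r * r' * sin (t - s).
  by rewrite vE /det sinB/=; ring.
have sgn t : t \in Interval (BSide c1 t1) (BSide c2 t2) ->
    [/\ (0 < sin (t - s)) = (s < t) & (sin (t - s) < 0) = (t < s)].
  move=> /It tI; have [ts|st|->] := ltgtP t s.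
  - have H : 0 < sin (s - t).
      by apply: sin_gt0_pi; move: tI sb t12; set p := pi; lra.
    by rewrite -opprB sinN oppr_gt0 oppr_lt0 H ltNge (ltW H).
  - have H : 0 < sin (t - s).
      by apply: sin_gt0_pi; move: tI sb t12; set p := pi; lra.
    by rewrite H ltNge (ltW H).
  - by rewrite subrr sin0 ltxx.
split.
- move=> [w [[r' [t [r'0 tI ->]]]]]; rewrite dE pmulr_rgt0 ?mulr_gt0//.
  have [-> _] := sgn _ tI => st.
  exists false, c2, s, t2; split; first by move: sb t12; set p := pi; lra.
    by exists t; move: tI; case: (c1); case: (c2); rewrite !in_itv/= => /andP[? ?]; lra.
  apply/seteqP; split => [x [[p [q [p0 qI ->]]]]|x [p [q [p0 qI ->]]]].
    rewrite dE pmulr_rgt0 ?mulr_gt0//; have [-> _] := sgn _ qI => sq.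
    exists p, q; split => //.
    by move: qI; case: (c1); case: (c2); rewrite !in_itv/= => /andP[? ?]; lra.
  have qI' : q \in Interval (BSide c1 t1) (BSide c2 t2).
    by move: qI sI; case: (c1); case: (c2); rewrite !in_itv/= => /andP[? ?] /andP[? ?]; lra.
  split; first by exists p, q.
  rewrite dE pmulr_rgt0 ?mulr_gt0//; have [-> _] := sgn _ qI'.
  by move: qI; case: (c2); rewrite !in_itv/= => /andP[].
- exists c1, false, t1, s; split; first by move: sb t12; set p := pi; lra.
    by exists s; move: sI; case: (c1); case: (c2); rewrite !in_itv/= => /andP[? ?]; lra.
  apply/seteqP; split => [x [[p [q [p0 qI ->]]]]|x [p [q [p0 qI ->]]]].
    rewrite dE pmulr_rle0 ?mulr_gt0// leNgt; have [-> _] := sgn _ qI => sq.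
    exists p, q; split => //.
    by move: sq qI; case: (c1); case: (c2); rewrite !in_itv/= => ? /andP[? ?]; lra.
  have qI' : q \in Interval (BSide c1 t1) (BSide c2 t2).
    by move: qI sI; case: (c1); case: (c2); rewrite !in_itv/= => /andP[? ?] /andP[? ?]; lra.
  split; first by exists p, q.
  rewrite dE pmulr_rle0 ?mulr_gt0// leNgt; have [-> _] := sgn _ qI'.
  by move: qI; case: (c1); rewrite !in_itv/= => /andP[? ?]; rewrite -leNgt.
- move=> [w [[r' [t [r'0 tI ->]]]]]; rewrite dE pmulr_rlt0 ?mulr_gt0//.
  have [_ ->] := sgn _ tI => st.
  exists c1, true, t1, s; split; first by move: sb t12; set p := pi; lra.
    by exists t; move: tI; case: (c1); case: (c2); rewrite !in_itv/= => /andP[? ?]; lra.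
  apply/seteqP; split => [x [[p [q [p0 qI ->]]]]|x [p [q [p0 qI ->]]]].
    rewrite dE pmulr_rlt0 ?mulr_gt0//; have [_ ->] := sgn _ qI => sq.
    exists p, q; split => //.
    by move: qI; case: (c1); case: (c2); rewrite !in_itv/= => /andP[? ?]; lra.
  have qI' : q \in Interval (BSide c1 t1) (BSide c2 t2).
    by move: qI sI; case: (c1); case: (c2); rewrite !in_itv/= => /andP[? ?] /andP[? ?]; lra.
  split; first by exists p, q.
  rewrite dE pmulr_rlt0 ?mulr_gt0//; have [_ ->] := sgn _ qI'.
  by move: qI; case: (c1); rewrite !in_itv/= => /andP[].
Qed.

End Sectors.

Section GradedPieces.
Variables (Gam : zmodType) (g : gradedLie Gam).

Lemma piece_sum k I (r : seq I) (P : pred I) (F : I -> g) :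
  (forall i, P i -> lie_piece k (F i)) -> lie_piece k (\sum_(i <- r | P i) F i).
Proof.
move=> FP; apply: (big_ind (lie_piece k)) => //; first exact: lie_piece0.
by move=> x y kx ky; rewrite -[x]scale1r; exact: lie_piece_lin.
Qed.

Lemma pieceZ k q (x : g) : lie_piece k x -> lie_piece k (q *: x).
Proof.
move=> kx; rewrite -[q *: x]addr0.
by apply: lie_piece_lin => //; exact: lie_piece0.
Qed.

Lemma bch_piece (x y : Gam -> g) :
  (forall k, lie_piece k (x k)) -> (forall k, lie_piece k (y k)) ->
  forall k, lie_piece k (bch x y k).
Proof.
move=> xP yP.
have wP w : forall k, lie_piece k (bracket_word x y w k).
  have cP c k : lie_piece k ((if c then y else x) k) by case: c.
  elim: w => [|c [|c' w] IHw] k; [exact: lie_piece0|exact: cP|].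
  apply: piece_sum => l _; rewrite -[k in lie_piece k](subrK l) addrC.
  exact: lie_piece_br.
move=> k; apply: piece_sum => n _; apply: pieceZ; apply: piece_sum => w _.
exact: pieceZ.
Qed.

End GradedPieces.

Lemma sector_eq (R : realType) (V W : sector R) : sval V = sval W -> V = W.
Proof.
case: V W => V hV [W hW] /= VW; move: hV hW; rewrite VW => hV hW.
by congr exist; exact: Prop_irrelevance.
Qed.

Lemma clockwise_splitP (R : realType) (V V1 V2 : sector R) :
  sval V = sval V1 `|` sval V2 ->
  (forall u w, sval V1 u -> sval V2 w -> det u w < 0) -> clockwise_split V V1 V2.
Proof.
move=> VE h; split => //; apply/seteqP; split => // w [w1 w2].
by have := h _ _ w1 w2; rewrite detvv ltxx.
Qed.

Lemma count_lt (T : eqType) (p q : pred T) (s : seq T) x :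
  (forall y, p y -> q y) -> x \in s -> q x -> ~~ p x -> (count p s < count q s)%N.
Proof.
move=> pq; elim: s => // y s IHs; rewrite inE => /predU1P[<-|xs] qx px /=.
  by rewrite qx (negbTE px) add0n ltnS sub_count.
have := IHs xs qx px; have := pq y; case: (p y) => [->//|_]; case: (q y) => //=; lia.
Qed.

Section UnitVectors.
Variable R : realType.
Implicit Types u v w : plane R.

(** Canonical point of a ray, so that rays can be listed, counted and compared. *)
Definition unitv v : plane R := (modulus v)^-1 *: v.

Lemma modulus_gt0 v : v != 0 -> 0 < modulus v.
Proof. by move=> /polar_exists[r [t [r0 ->]]]; rewrite modulus_polar. Qed.

Lemma ray_unitv v : v != 0 -> ray v (unitv v).
Proof. by move=> v0; exists (modulus v)^-1; rewrite //= invr_gt0 modulus_gt0. Qed.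

Lemma unitv_ray v w : v != 0 -> ray v w -> unitv w = unitv v.
Proof.
move=> v0 [r /= r0 <-]; rewrite /unitv modulusZ// scalerA invfM -mulrA.
by rewrite mulrCA mulVf ?mulr1// gt_eqF.
Qed.

Lemma unitvK v : v != 0 -> unitv (unitv v) = unitv v.
Proof. by move=> v0; apply: unitv_ray => //; exact: ray_unitv. Qed.

End UnitVectors.

(** * A collection is determined by its rays *)

Section ConeLattice.
Variables (R : realType) (Gam : zmodType) (E : vectType R).
Variables (iota : {additive Gam -> E}).
Hypothesis hiota : real_span iota.
Variable g : gradedLie Gam.
Variables (Z : Gam -> plane R) (Q : E -> R).
Hypotheses (Zadd : zmod_morphism Z) (qQ : quadratic_form Q)
  (neg : neg_on_ker iota Q Z).

Definition cone_lattice (V : sector R) : set Gam := [set k | cone iota V Z Q (iota k)].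

Lemma cone_lattice_pos V : strictly_positive R (cone_lattice V).
Proof.
have [a [b [d [d0 ab]]]] := sector_functional V.
exact: (cone_strictly_positive hiota Zadd qQ neg d0 ab).
Qed.

Lemma cone_sub V W x : sval V `<=` sval W -> cone iota V Z Q x -> cone iota W Z Q x.
Proof.
move=> VW; elim => {x} [x [x0 Vx Qx]|x y _ hx _ hy|t x t0 _ hx].
- by apply: cone_gen; split => //; exact: VW.
- exact: cone_add.
- exact: cone_scale.
Qed.

Lemma cone_lattice_sector V k : cone_lattice V k -> sval V (Z k).
Proof.
have [zP zi] := lin_ext_spec hiota Zadd; rewrite -zi.
have zD x y : lin_ext iota Z (x + y) = lin_ext iota Z x + lin_ext iota Z y.
  by rewrite -[x]scale1r zP !scale1r.
have z0 : lin_ext iota Z 0 = 0.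
  by have := zP (-1) 0 0; rewrite addr0 scaler0 scaleN1r => ->; rewrite addNr.
rewrite /cone_lattice /=; elim => {k} [x []//|x y _ hx _ hy|t x t0 _ hx].
  by rewrite zD; exact: sectorD.
by rewrite -[t *: x]addr0 zP z0 addr0; exact: sectorZ.
Qed.

Lemma cone_lattice_gen V k : k != 0 -> sval V (Z k) -> 0 <= Q (iota k) -> cone_lattice V k.
Proof.
move=> k0 Vk Qk; have [_ zi] := lin_ext_spec hiota Zadd.
apply: cone_gen; split; rewrite ?zi//.
by apply: contra k0 => /eqP/(iota_eq0 hiota) ->.
Qed.

Lemma G_supp V (x : Gam -> g) : G_ iota V Z Q x -> supp_in (cone_lattice V) x.
Proof. by move=> Gx k nk; apply: contrapT => /eqP xk; have [_ /(_ xk)] := Gx k. Qed.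

Lemma supp_in_sub V W (x : Gam -> g) : sval V `<=` sval W ->
  supp_in (cone_lattice V) x -> supp_in (cone_lattice W) x.
Proof. by move=> VW xV k Wk; apply: xV => Vk; apply: Wk; exact: cone_sub Vk. Qed.

Lemma cone_bchA V (x y z : Gam -> g) : supp_in (cone_lattice V) x ->
  supp_in (cone_lattice V) y -> supp_in (cone_lattice V) z ->
  bch (bch x y) z = bch x (bch y z).
Proof.
apply: (bchA (cone_lattice_pos V)) => k /cone_lattice_sector/sector_neq0 Zk.
apply: (lattice_separated hiota); apply: contraNneq Zk => ->.
by have := Zadd 0 0; rewrite !subrr => ->.
Qed.

Section Injectivity.
Variables A A' : sector R -> Gam -> g.
Hypotheses (GA : forall V, G_ iota V Z Q (A V)) (GA' : forall V, G_ iota V Z Q (A' V)).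
Hypotheses
  (facA : forall V V1 V2, clockwise_split V V1 V2 -> A V = bch (A V1) (A V2))
  (facA' : forall V V1 V2, clockwise_split V V1 V2 -> A' V = bch (A' V1) (A' V2)).
Hypothesis rayA : forall v (v0 : v != 0), A (ray_sector v0) = A' (ray_sector v0).

(** Induction on the number of rays of lattice points below [k] that meet the
    sector: cutting along one of them leaves fewer on either side. *)
Lemma factorization_inj V : A V = A' V.
Proof.
apply/funext => k; pose S := cone_lattice V.
have [Sk|Sk] := pselect (S k); last by rewrite (G_supp (GA V))// (G_supp (GA' V)).
have posS := cone_lattice_pos V.
pose L := [seq unitv (Z l) | l <- divs S k].
have suppA W : sval W `<=` sval V -> supp_in S (A W).
  by move=> WV; apply: supp_in_sub WV _; exact: G_supp.
have suppA' W : sval W `<=` sval V -> supp_in S (A' W).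
  by move=> WV; apply: supp_in_sub WV _; exact: G_supp.
have main n : forall W, sval W `<=` sval V -> (count (fun u => `[< sval W u >]) L < n)%N ->
    {in divs S k, A W =1 A' W}.
  elim: n => // n IHn W WV cW.
  have glue W1 W2 U : sval U `<=` sval V -> clockwise_split U W1 W2 ->
      {in divs S k, A W1 =1 A' W1} -> {in divs S k, A W2 =1 A' W2} ->
      {in divs S k, A U =1 A' U}.
    move=> UV UW e1 e2; rewrite (facA UW) (facA' UW).
    case: UW => UE _ _.
    have W1V : sval W1 `<=` sval V by apply: subset_trans UV; rewrite UE => u; left.
    have W2V : sval W2 `<=` sval V by apply: subset_trans UV; rewrite UE => u; right.
    by apply: (eq_bch posS) => //; [exact: suppA|exact: suppA|exact: suppA'|exact: suppA'].
  have [[v [vL Wv]]|noL] := pselect (exists v, v \in L /\ sval W v); last first.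
    (* No divisor of [k] maps into [W], so both elements vanish at all of them. *)
    move=> l ls; have nl : ~ cone_lattice W l.
      move=> /cone_lattice_sector Wl; apply: noL; exists (unitv (Z l)); split.
        exact: map_f.
      by apply: sector_ray (Wl) _; apply: ray_unitv; exact: sector_neq0 Wl.
    by rewrite (G_supp (GA W))// (G_supp (GA' W)).
  have v0 := sector_neq0 Wv; have [s1 s2 s3] := sector_split Wv.
  pose W2 : sector R := exist _ _ s2.
  have W2W : sval W2 `<=` sval W by move=> u [].
  have sub_lt U : sval U `<=` sval W -> ~ sval U v ->
      (count (fun u => `[< sval U u >]) L < n)%N.
    move=> UW Uv; rewrite -ltnS (leq_trans _ cW)// ltnS.
    apply: (@count_lt _ _ _ _ v) => //; first by move=> y /asboolP /UW /asboolP.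
      exact/asboolP.
    by apply/negP => /asboolP.
  (* [W2] is the ray of [v] alone, or that ray followed by a sector that misses [v] and so has a
     smaller count. *)
  have e2 : {in divs S k, A W2 =1 A' W2}.
    have [ne|ne] := pselect (exists w, sval W w /\ det v w < 0); last first.
      have -> : W2 = ray_sector v0.
        apply: sector_eq; apply/seteqP; split => [w [Ww vw]|w vw] /=.
          apply: (det_eq0_ray Wv Ww); apply/eqP; rewrite eq_le vw/= leNgt.
          by apply/negP => vw'; apply: ne; exists w.
        split; first exact: sector_ray Wv vw.
        by rewrite ray_det.
      by move=> l _; rewrite rayA.
    pose W3 : sector R := exist _ _ (s3 ne).
    apply: (glue (ray_sector v0) W3); first exact: subset_trans WV.
    - apply: clockwise_splitP => [|u w].
        apply/seteqP; split => [w [Ww vw]|w [vw|[Ww vw]]] /=.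
        + move: vw; rewrite le_eqVlt => /predU1P[vw|vw]; last by right.
          by left; exact: det_eq0_ray Wv Ww vw.
        + split; first exact: sector_ray Wv vw.
          by rewrite ray_det.
        + by split => //; exact: ltW.
      move=> [r /= r0 <-] [Ww vw].
      have -> : det (r *: v) w = r * det v w by rewrite /det /= /GRing.scale/=; ring.
      by rewrite pmulr_rlt0.
    - by move=> l _; rewrite rayA.
    - apply: IHn; first by move=> u [Wu _]; exact: WV.
      by apply: sub_lt => [u []//|[_]]; rewrite detvv ltxx.
  have [ne|ne] := pselect (exists w, sval W w /\ 0 < det v w); last first.
    suff -> : W = W2 by [].
    apply: sector_eq; apply/seteqP; split => [w Ww|w []//]; split => //.
    by rewrite leNgt; apply/negP => vw; apply: ne; exists w.
  pose W1 : sector R := exist _ _ (s1 ne).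
  apply: (glue W1 W2) => //.
  - apply: clockwise_splitP => [|u w [Wu vu] [Ww vw]].
      apply/seteqP; split => [w Ww|w [[]//|[]//]].
      by have [vw|vw] := ltP 0 (det v w); [left|right].
    have uv : det u v < 0 by rewrite detC oppr_lt0.
    move: vw; rewrite le_eqVlt => /predU1P[/(det_eq0_ray Wv Ww)[r /= r0 <-]|vw].
      have -> : det u (r *: v) = r * det u v by rewrite /det /= /GRing.scale/=; ring.
      by rewrite pmulr_rlt0.
    exact: det_trans Wu Wv Ww uv vw.
  - apply: IHn; first by move=> u [Wu _]; exact: WV.
    by apply: sub_lt => [u []//|[_]]; rewrite detvv ltxx.
exact: (main _ V _ (ltnSn _) k (divs_self posS Sk)).
Qed.

End Injectivity.

End ConeLattice.

(** * Ordered products over the rays of a sector *)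

Section Existence.
Variables (R : realType) (Gam : zmodType) (E : vectType R).
Variables (iota : {additive Gam -> E}).
Hypothesis hiota : real_span iota.
Variable g : gradedLie Gam.
Variables (Z : Gam -> plane R) (Q : E -> R).
Hypotheses (Zadd : zmod_morphism Z) (qQ : quadratic_form Q)
  (neg : neg_on_ker iota Q Z).
Variable a : Gam -> g.
Hypotheses (a_piece : forall k, lie_piece k (a k)) (a0 : a 0 = 0)
  (a_supp : forall k, a k != 0 -> 0 <= Q (iota k)).
Implicit Types (V : sector R) (v w : plane R) (L : seq (plane R)).

Notation lat := (cone_lattice iota Z Q).

Definition ray_part v : Gam -> g := fun k => if `[< ray v (Z k) >] then a k else 0.

Definition ray_prod L : Gam -> g :=
  foldr (fun v x => bch (ray_part v) x) (fun=> 0) L.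

Definition clockwise : rel (plane R) := fun v w => det v w < 0.

Lemma a_lattice V k : a k != 0 -> sval V (Z k) -> lat V k.
Proof.
move=> ak Vk; apply: (cone_lattice_gen hiota Zadd) => //; last exact: a_supp.
by apply: contraNneq ak => ->; rewrite a0.
Qed.

Lemma ray_part_supp V v : sval V v -> supp_in (lat V) (ray_part v).
Proof.
move=> Vv k nk; rewrite /ray_part; case: asboolP => // vk.
by apply: contrapT => /eqP ak; apply: nk; apply: a_lattice ak _; exact: sector_ray vk.
Qed.

Definition rays_in V L := forall v, v \in L -> sval V v.

Lemma rays_in_cons V v L : rays_in V (v :: L) -> sval V v /\ rays_in V L.
Proof.
by move=> h; split=> [|w wL]; apply: h; rewrite inE ?eqxx ?wL ?orbT.
Qed.

Lemma ray_prod_supp V L : rays_in V L -> supp_in (lat V) (ray_prod L).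
Proof.
elim: L => [//|v L IHL] /rays_in_cons[Vv VL].
by apply: (bch_supp (cone_lattice_pos hiota Zadd qQ neg V)); [exact: ray_part_supp|exact: IHL].
Qed.

Lemma ray_prod_piece L k : lie_piece k (ray_prod L k).
Proof.
elim: L k => [k|v L IHL k]; first exact: lie_piece0.
apply: bch_piece => // l; rewrite /ray_part; case: asboolP => // _.
exact: lie_piece0.
Qed.

Lemma ray_prod_cat V L L' : rays_in V L -> rays_in V L' ->
  ray_prod (L ++ L') = bch (ray_prod L) (ray_prod L').
Proof.
move=> + VL'; have posV := cone_lattice_pos hiota Zadd qQ neg V.
elim: L => [_|v L IHL /rays_in_cons[Vv VL]].
  by rewrite (bch0l posV)//; exact: ray_prod_supp.
rewrite /= IHL// (cone_bchA hiota Zadd qQ neg (V := V))//.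
- exact: ray_part_supp.
- exact: ray_prod_supp.
- exact: ray_prod_supp.
Qed.

Definition relevant V k v :=
  `[< exists l, [/\ l \in divs (lat V) k, a l != 0 & ray v (Z l)] >].

(** The factor of an irrelevant ray vanishes at all divisors of [k], where it therefore acts as the
    identity. *)
Lemma ray_prod_filter V k L : rays_in V L ->
  {in divs (lat V) k, ray_prod L =1 ray_prod (seq.filter (relevant V k) L)}.
Proof.
have posV := cone_lattice_pos hiota Zadd qQ neg V.
elim: L => [//|v L IHL] /rays_in_cons[Vv VL].
have VL' : rays_in V (seq.filter (relevant V k) L).
  by move=> w; rewrite mem_filter => /andP[_ /VL].
rewrite /=; case: ifPn => vk.
  by apply: (eq_bch posV); try exact: ray_part_supp; try exact: ray_prod_supp;
    [move=> l _|exact: IHL].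
move=> l lk; rewrite -[ray_prod (seq.filter _ _)](bch0l posV (ray_prod_supp VL')).
apply: (eq_bch posV (k := k)) => //; try exact: ray_part_supp;
  try exact: ray_prod_supp; last exact: IHL.
move=> m mk; rewrite /ray_part; case: asboolP => // vm.
apply: contrapT => /eqP am; move/asboolP: vk; apply.
by exists m.
Qed.

Definition ray_list V k L :=
  [/\ rays_in V L, pairwise clockwise L, forall v, v \in L -> unitv v = v &
      forall l, l \in divs (lat V) k -> a l != 0 -> unitv (Z l) \in L].

(** Once reduced to relevant rays, both lists have the same members in the same strict order, hence
    are equal. *)
Lemma ray_prod_unique V k L L' : ray_list V k L -> ray_list V k L' ->
  {in divs (lat V) k, ray_prod L =1 ray_prod L'}.
Proof.
move=> [VL pL uL cL] [VL' pL' uL' cL'] l lk.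
rewrite (ray_prod_filter VL lk) (ray_prod_filter VL' lk).
suff -> : seq.filter (relevant V k) L = seq.filter (relevant V k) L' by [].
apply: (@irr_sorted_eq_in _ clockwise).
- move=> u v w; rewrite !mem_filter => /andP[_ /VL Vu] /andP[_ /VL Vv] /andP[_ /VL Vw].
  exact: (det_trans Vv Vu Vw).
- by move=> v _; rewrite /clockwise detvv ltxx.
- by apply/pairwise_sorted/pairwise_filter.
- by apply/pairwise_sorted/pairwise_filter.
have sub M M' : ray_list V k M -> ray_list V k M' ->
    forall v, v \in seq.filter (relevant V k) M -> v \in seq.filter (relevant V k) M'.
  move=> [VM _ uM _] [_ _ _ cM'] v; rewrite !mem_filter => /andP[vk vM].
  rewrite vk; move/asboolP: vk => [m [mk am vm]].
  by rewrite -(uM _ vM) -(unitv_ray (sector_neq0 (VM _ vM)) vm) cM'.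
by move=> v; apply/idP/idP; apply: sub.
Qed.

Definition rays V k : seq (plane R) :=
  sort (fun v w => det v w <= 0) (undup [seq unitv (Z l) | l <- divs (lat V) k]).

Lemma mem_rays V k v : v \in rays V k ->
  exists l, [/\ l \in divs (lat V) k, sval V (Z l) & v = unitv (Z l)].
Proof.
rewrite mem_sort mem_undup => /mapP[l lk ->]; exists l; split => //.
have /(mem_divs (cone_lattice_pos hiota Zadd qQ neg V))[+ _] := lk.
exact: cone_lattice_sector.
Qed.

Lemma rays_list V k : ray_list V k (rays V k).
Proof.
have VL : rays_in V (rays V k).
  move=> v /mem_rays[l [_ Vl ->]]; apply: sector_ray (Vl) _.
  by apply: ray_unitv; exact: sector_neq0 Vl.
have uL v : v \in rays V k -> unitv v = v.
  by move=> /mem_rays[l [_ Vl ->]]; apply: unitvK; exact: sector_neq0 Vl.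
split => //; last by move=> l lk _; rewrite mem_sort mem_undup; exact: map_f.
pose P v := `[< sval V v >].
have Pall : all P (rays V k) by apply/allP => v /VL /asboolP.
have : sorted (fun v w => det v w <= 0) (rays V k).
  apply: (@sort_sorted_in _ P) => [v w _ _|].
    by rewrite detC oppr_le0 le_total.
  by apply/allP => v vL; apply/asboolP/VL; rewrite mem_sort.
rewrite (@sorted_pairwise_in _ P)//; last first.
  move=> v u w /asboolP Vv /asboolP Vu /asboolP Vw; exact: (det_trans_le Vu Vv Vw).
have := sort_uniq (fun v w => det v w <= 0) (undup [seq unitv (Z l) | l <- divs (lat V) k]).
rewrite undup_uniq -/(rays V k) uniq_pairwise => uq pw.
(* Distinct unit vectors of a sector cannot have determinant 0, as they would span the same ray; so
   the weak order is strict. *)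
have : pairwise [rel v w | (det v w <= 0) && (v != w)] (rays V k).
  by rewrite pairwise_relI pw.
apply: (@sub_in_pairwise _ (mem (rays V k))); last exact/allP.
move=> v w vL wL /andP[vw /eqP nvw]; rewrite /clockwise lt_neqAle vw andbT.
apply/eqP => d0; apply: nvw; rewrite -(uL _ vL) -(uL _ wL).
apply/esym/unitv_ray; first exact: sector_neq0 (VL _ vL).
exact: det_eq0_ray (VL _ vL) (VL _ wL) d0.
Qed.

(** Infinitely many rays may occur in all, so each component is read off from a finite list of its
    own. *)
Definition sector_prod V : Gam -> g := fun k => ray_prod (rays V k) k.

Lemma sector_prod_supp V : supp_in (lat V) (sector_prod V).
Proof. by move=> k nk; apply: (ray_prod_supp (V := V)) nk; have [] := rays_list V k. Qed.

Lemma sector_prod_G V : G_ iota V Z Q (sector_prod V).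
Proof.
move=> k; split; first exact: ray_prod_piece.
by move=> /eqP nk; apply: contrapT => /sector_prod_supp.
Qed.

Lemma sector_prodE V k L : ray_list V k L ->
  lat V k -> sector_prod V k = ray_prod L k.
Proof.
move=> hL Vk; apply: ray_prod_unique (rays_list V k) hL _ _.
by apply: divs_self => //; exact: cone_lattice_pos.
Qed.

Lemma sector_prod_split V V1 V2 : clockwise_split V V1 V2 ->
  sector_prod V = bch (sector_prod V1) (sector_prod V2).
Proof.
move=> [VE V12 V12c].
have posV := cone_lattice_pos hiota Zadd qQ neg V.
have V1V : sval V1 `<=` sval V by rewrite VE => u; left.
have V2V : sval V2 `<=` sval V by rewrite VE => u; right.
have supp W : sval W `<=` sval V -> supp_in (lat V) (sector_prod W).
  by move=> WV; apply: supp_in_sub WV _; exact: sector_prod_supp.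
apply/funext => k; have [Vk|Vk] := pselect (lat V k); last first.
  by rewrite sector_prod_supp// (bch_supp posV) => //; exact: supp.
(* The rays for [k] in [V] that lie in [V1], followed by those in [V2], again form a list for [V],
   while each half is a list for its own sector. *)
pose part (W : sector R) := seq.filter (fun v => `[< sval W v >]) (rays V k).
have [VL pL uL cL] := rays_list V k.
have partL W v : v \in part W -> sval W v /\ v \in rays V k.
  by rewrite mem_filter => /andP[/asboolP].
have part_prod W : sval W `<=` sval V ->
    {in divs (lat V) k, sector_prod W =1 ray_prod (part W)}.
  move=> WV l lk; have WL : rays_in W (part W) by move=> v /partL[].
  have [Wl|Wl] := pselect (lat W l); last first.
    by rewrite sector_prod_supp// (ray_prod_supp WL).
  apply: sector_prodE => //; split => //.
  - exact: pairwise_filter.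
  - by move=> v /partL[_ /uL].
  (* A divisor of [l] inside the cone of [W] is a divisor of [k] inside that of [V]. *)
  - move=> m /(mem_divs (cone_lattice_pos hiota Zadd qQ neg W))[Wm ml] am.
    rewrite mem_filter; apply/andP; split.
      have Zm := cone_lattice_sector hiota Zadd Wm.
      by apply/asboolP; apply: sector_ray (Zm) _; apply: ray_unitv; exact: sector_neq0 Zm.
    apply: cL => //; case: ml => [->//|ml]; apply: (divs_trans posV lk).
      exact: cone_sub Wm.
    exact: cone_sub ml.
have VL1 : rays_in V (part V1) by move=> v /partL[/V1V].
have VL2 : rays_in V (part V2) by move=> v /partL[/V2V].
have kk := divs_self posV Vk.
transitivity (ray_prod (part V1 ++ part V2) k).
  apply: sector_prodE => //; split.
  - by move=> v; rewrite mem_cat => /orP[/VL1|/VL2].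
  - rewrite pairwise_cat !pairwise_filter// !andbT.
    by apply/allrelP => v w /partL[v1 _] /partL[w2 _]; exact: V12c.
  - by move=> v; rewrite mem_cat => /orP[] /partL[_ /uL].
  - move=> l lk al; have lL := cL _ lk al; rewrite mem_cat !mem_filter lL !andbT.
    by have := VL _ lL; rewrite VE => -[] /asboolP ->; rewrite ?orbT.
rewrite (ray_prod_cat VL1 VL2).
apply: (eq_bch posV (k := k)) => //; try exact: supp; try exact: ray_prod_supp.
- by move=> l lk; rewrite part_prod.
- by move=> l lk; rewrite part_prod.
Qed.

Lemma sector_prod_ray k (k0 : Z k != 0) : sector_prod (ray_sector k0) k = a k.
Proof.
set V := ray_sector k0; have Vk : sval V (Z k) by exact: ray_self.
have [Sk|Sk] := pselect (lat V k); last first.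
  rewrite sector_prod_supp//; apply/esym; apply: contrapT => /eqP ak.
  exact/Sk/a_lattice.
have posV := cone_lattice_pos hiota Zadd qQ neg V.
have uV : sval V (unitv (Z k)) by exact: ray_unitv.
rewrite (@sector_prodE _ _ [:: unitv (Z k)])//.
  rewrite /= (bch0r posV); last exact: ray_part_supp.
  rewrite /ray_part; case: asboolP => // -[]; exists (modulus (Z k)).
    exact: modulus_gt0.
  by rewrite /unitv scalerA divff ?scale1r// gt_eqF// modulus_gt0.
split => //.
- by move=> v; rewrite inE => /eqP ->.
- by move=> v; rewrite inE => /eqP ->; exact: unitvK.
- move=> l /(mem_divs posV)[Vl _] _; rewrite inE; apply/eqP.
  by apply: unitv_ray => //; exact: (cone_lattice_sector hiota Zadd Vl).
Qed.

End Existence.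

(** The branch depends on the proof, so the case analysis is made on an arbitrary element of
    [alt_spec b b c]; irrelevance of boolean proofs identifies the witnesses. *)
Lemma boolP_true (T : Type) (b : bool) (f : b -> T) (t : T) (h : b) :
  match boolP b with AltTrue h => f h | AltFalse _ => t end = f h.
Proof.
have H c (x : alt_spec b b c) : c ->
    match x with AltTrue h => f h | AltFalse _ => t end = f h.
  by case: x => // h' _; rewrite (bool_irrelevance h' h).
exact: H h.
Qed.

Lemma boolP_false (T : Type) (b : bool) (f : b -> T) (t : T) : ~~ b ->
  match boolP b with AltTrue h => f h | AltFalse _ => t end = t.
Proof.
have H c (x : alt_spec b b c) : ~~ c ->
    match x with AltTrue h => f h | AltFalse _ => t end = t by case: x.
exact: H.
Qed.

(** * The bijection and the equivalence relation *)

Section Correspondence.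
Variables (R : realType) (Gam : zmodType) (E : vectType R).
Variables (iota : {additive Gam -> E}).
Hypothesis hiota : real_span iota.
Variable g : gradedLie Gam.
Implicit Types (Q : E -> R) (ZA : (Gam -> plane R) * (sector R -> Gam -> g)).

Lemma defines_rayE ZA (k : nonzero Gam) (Zk0 : ZA.1 (sval k) != 0) :
  (defines ZA).2 k = ZA.2 (ray_sector Zk0) (sval k).
Proof.
exact: (boolP_true (fun h => ZA.2 (ray_sector h) (sval k)) 0 Zk0).
Qed.

Lemma defines_ker ZA (k : nonzero Gam) : ZA.1 (sval k) = 0 -> (defines ZA).2 k = 0.
Proof.
move=> Zk; apply: (boolP_false (fun h => ZA.2 (ray_sector h) (sval k)) 0).
by rewrite negbK; apply/eqP.
Qed.

(** Group elements are only known to be supported on convex cones, but by [ray_convex] the cone of a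
    ray contains no point with [Q] negative; [support_norm] then yields the support property. *)
Lemma defines_StabQ Q ZA : quadratic_form Q ->
  hatStabQ iota Q ZA -> StabQ iota Q (defines ZA).
Proof.
move=> qQ [Zadd neg GA fac].
have [_ zi] := lin_ext_spec hiota Zadd.
have Qk (k : nonzero Gam) : (defines ZA).2 k != 0 -> 0 <= Q (iota (sval k)).
  have [/defines_ker ->|Zk0] := eqVneq (ZA.1 (sval k)) 0; first by rewrite eqxx.
  rewrite defines_rayE => ak; have [_ /(_ ak)] := GA (ray_sector Zk0) (sval k).
  by move=> /(ray_convex hiota Zadd qQ neg Zk0)[].
split => //; split => //.
- move=> k; have [/defines_ker ->|Zk0] := eqVneq (ZA.1 (sval k)) 0.
    exact: lie_piece0.
  by rewrite defines_rayE; have [] := GA (ray_sector Zk0) (sval k).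
have [N [normN [C [C0 NC]]]] := support_norm hiota Zadd qQ neg.
exists N; split => //; exists C; split => // k /Qk /NC.
by rewrite zi.
Qed.

Lemma defines_inj Q ZA ZA' : quadratic_form Q -> hatStabQ iota Q ZA ->
  hatStabQ iota Q ZA' -> defines ZA = defines ZA' -> ZA = ZA'.
Proof.
case: ZA ZA' => [Z A] [Z' A'] qQ [/= Zadd neg GA fac] [/= Zadd' _ GA' fac'] dA.
have ZZ' : Z = Z' := congr1 fst dA; move: GA' fac' dA; rewrite -ZZ' => GA' fac' dA.
congr pair; apply/funext => V.
apply: (factorization_inj hiota Zadd qQ neg GA GA' fac fac') => v v0.
apply/funext => k.
(* [defines] sees degree [k] only on the ray through Z k, but an element attached to a ray has no
   other degrees. *)
have [Sk|Sk] := pselect (cone_lattice iota Z Q (ray_sector v0) k); last first.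
  by rewrite (G_supp (GA _))// (G_supp (GA' _)).
have Vk : ray v (Z k) := cone_lattice_sector hiota Zadd Sk.
have Zk0 : Z k != 0 := sector_neq0 (Vk : sval (ray_sector v0) _).
have k0 : k != 0.
  by apply: contraNneq Zk0 => ->; have := Zadd 0 0; rewrite !subrr => ->.
have -> : ray_sector v0 = ray_sector Zk0 by apply: sector_eq; rewrite /= (rayP v0 Vk).
have := congr1 (fun f => f.2 (exist _ k k0 : nonzero Gam)) dA.
rewrite (@defines_rayE (Z, A) (exist _ k k0) Zk0).
by rewrite (@defines_rayE (Z, A') (exist _ k k0) Zk0).
Qed.

Lemma defines_surj Q Za : quadratic_form Q -> StabQ iota Q Za ->
  exists2 ZA, hatStabQ iota Q ZA & defines ZA = Za :> (_ * (nonzero Gam -> g)).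
Proof.
case: Za => Z a qQ [/= [/= Zadd a_piece _] neg a_supp].
pose b (k : Gam) : g :=
  match boolP (k != 0) with AltTrue h => a (exist _ k h) | AltFalse _ => 0 end.
have bE (k : nonzero Gam) : b (sval k) = a k.
  case: k => k k0; exact: (boolP_true (fun h => a (exist _ k h)) 0 k0).
have b0 : b 0 = 0.
  by apply: (@boolP_false _ _ (fun h : (0 : Gam) != 0 => a (exist _ 0 h)) 0); rewrite negbK.
have bk k : b k = 0 \/ exists l : nonzero Gam, sval l = k /\ b k = a l.
  have [->|k0] := eqVneq k 0; first by left.
  by right; exists (exist _ k k0); rewrite -bE.
have b_piece k : lie_piece k (b k).
  by have [->|[l [<- ->]]] := bk k; [exact: lie_piece0|exact: a_piece].
have b_supp k : b k != 0 -> 0 <= Q (iota k).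
  by have [->|[l [<- ->]]] := bk k; rewrite ?eqxx//; exact: a_supp.
exists (Z, sector_prod iota Z Q b).
  split => //= [V|V V1 V2]; first exact: sector_prod_G.
  exact: sector_prod_split.
congr pair; apply/funext => k.
rewrite -[LHS]/((defines (Z, sector_prod iota Z Q b)).2 k).
(* If Z k = 0, then [Q] is negative at [k], and the support condition forces a k = 0, the default
   value in [defines]. *)
have [Zk0|Zk0] := eqVneq (Z (sval k)) 0.
  rewrite (@defines_ker (Z, _))//; apply/esym; apply: contrapT => /eqP /a_supp.
  rewrite leNgt => /negP; apply; apply: neg.
    by apply: contra (svalP k) => /eqP/(iota_eq0 hiota) ->.
  by have [_ ->] := lin_ext_spec hiota Zadd.
rewrite (@defines_rayE (Z, _) k Zk0) -bE.
exact: (sector_prod_ray hiota Zadd qQ neg b0 b_supp Zk0).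
Qed.

(** With P = C |Z|^2 - Q and P' = C' |Z|^2 - Q' positive definite, subtracting from (C + C') |Z|^2 a
    multiple of [P] below both [P] and [P'] gives a form above [Q] and [Q'], still negative on Ker
    Z. *)
Lemma common_majorant Q Q' (Z : Gam -> plane R) : zmod_morphism Z ->
  quadratic_form Q -> quadratic_form Q' ->
  neg_on_ker iota Q Z -> neg_on_ker iota Q' Z ->
  exists Q0, [/\ quadratic_form Q0, forall x, Q x <= Q0 x, forall x, Q' x <= Q0 x &
    neg_on_ker iota Q0 Z].
Proof.
move=> Zadd qQ qQ' neg neg'.
have [C [C0 HC]] := neg_on_ker_dominated hiota Zadd qQ neg.
have [C' [C'0 HC']] := neg_on_ker_dominated hiota Zadd qQ' neg'.
pose z2 := Zsq iota Z.
pose P x := C * z2 x - Q x; pose P' x := C' * z2 x - Q' x.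
have qP : quadratic_form P := quadratic_slack hiota Zadd qQ C.
have qP' : quadratic_form P' := quadratic_slack hiota Zadd qQ' C'.
have P0 x : 0 <= P x := posdef_ge0 qP HC x.
have P'0 x : 0 <= P' x := posdef_ge0 qP' HC' x.
have [//||M [M0 HM]] := quad_dominated qP qP'.
  by move=> x /HC' + Px; rewrite -/z2 -/(P' x) Px ltxx.
have PM x : P x <= M * P' x.
  by have [->|/HM/ltW//] := eqVneq x 0; rewrite (quad0 qP) (quad0 qP') mulr0.
(* As P is at most M P', this choice makes e P at most both P and P'. *)
pose e := (1 + M)^-1; have e0 : 0 < e by rewrite invr_gt0 addr_gt0.
have e1 : e <= 1 by rewrite invf_le1 ?addr_gt0// lerDl ltW.
have eM : e * M <= 1 by rewrite mulrC ler_pdivrMr ?addr_gt0// mul1r lerDr.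
have z2_ge0 x : 0 <= z2 x by exact: Zsq_ge0.
exists (fun x => (C + C') * z2 x + (- e) * P x); split.
- by apply: quadratic_formD; apply: quadratic_formZ => //; exact: quadratic_Zsq.
- move=> x; have h1 : e * P x <= P x by rewrite ler_piMl.
  have h2 : 0 <= C' * z2 x by rewrite mulr_ge0// ltW.
  by move: h1 h2; rewrite mulrDl mulNr {2}/P; set p := e * P x; lra.
- move=> x; have h1 : e * P x <= P' x.
    rewrite (le_trans (y := e * (M * P' x)))// ?ler_pM2l//.
    by rewrite mulrA ler_piMl.
  have h2 : 0 <= C * z2 x by rewrite mulr_ge0// ltW.
  by move: h1 h2; rewrite mulrDl mulNr {1}/P'; set p := e * P x; lra.
- move=> x x0 zx; have -> : z2 x = 0 by rewrite /z2 /Zsq zx /= expr0n addr0.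
  by rewrite mulr0 add0r mulNr oppr_lt0 mulr_gt0//; exact: HC.
Qed.

Lemma cone_mono V (Z : Gam -> plane R) Q Q0 x : (forall x, Q x <= Q0 x) ->
  cone iota V Z Q x -> cone iota V Z Q0 x.
Proof.
move=> QQ0; elim => {x} [x [x0 Vx Qx]|x y _ hx _ hy|t x t0 _ hx].
- by apply: cone_gen; split => //; exact: le_trans (QQ0 x).
- exact: cone_add.
- exact: cone_scale.
Qed.

Lemma G_mono V (Z : Gam -> plane R) Q Q0 : (forall x, Q x <= Q0 x) ->
  G_ (g := g) iota V Z Q `<=` G_ iota V Z Q0.
Proof. by move=> QQ0 x Gx k; have [pk ck] := Gx k; split => // /ck; exact: cone_mono. Qed.

Lemma hatStabQ_mono Q Q0 ZA : (forall x, Q x <= Q0 x) -> neg_on_ker iota Q0 ZA.1 ->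
  hatStabQ iota Q ZA -> hatStabQ iota Q0 ZA.
Proof. by move=> QQ0 neg0 [Zadd neg GA fac]; split => // V; apply: G_mono (GA V). Qed.

End Correspondence.

Theorem theorem2 (R : realType) (Gam : zmodType) (E : vectType R)
    (iota : {additive Gam -> E}) (hiota : real_span iota) (g : gradedLie Gam) :
  (forall Q : E -> R, quadratic_form Q ->
     set_bij (hatStabQ iota (g := g) Q) (StabQ iota (g := g) Q)
       (@defines R Gam g)) /\
  (forall Q Q' : E -> R, quadratic_form Q -> quadratic_form Q' ->
     forall ZA ZA' : (Gam -> plane R) * (sector R -> Gam -> g),
       hatStabQ iota Q ZA -> hatStabQ iota Q' ZA' ->
       (hat_equiv iota Q Q' ZA ZA' <->
        Stab iota (defines ZA) /\ Stab iota (defines ZA') /\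
        defines ZA = defines ZA')).
Proof.
split => [Q qQ|Q Q' qQ qQ' ZA ZA' hZA hZA'].
  split.
  - by move=> ZA; exact: defines_StabQ.
  - by move=> ZA ZA' /set_mem h /set_mem h'; exact: (defines_inj hiota qQ).
  - by move=> Za /(defines_surj hiota qQ)[ZA h <-]; exists ZA.
have [SZA _ _] := defines_StabQ hiota qQ hZA.
have [SZA' _ _] := defines_StabQ hiota qQ' hZA'.
split=> [[ZZ' [Q0 [_ _ _ _ AA']]]|[_ [_ dZA]]].
  do 2!split => //; congr defines; apply: injective_projections => //.
  by apply/funext => V; have [] := AA' V.
have ZZ' : ZA.1 = ZA'.1 := congr1 fst dZA.
have [Zadd neg GA _] := hZA; have [_ neg' GA' _] := hZA'; rewrite -ZZ' in neg'.
have [Q0 [qQ0 QQ0 Q'Q0 neg0]] := common_majorant hiota Zadd qQ qQ' neg neg'.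
have neg0' := neg0; rewrite ZZ' in neg0'.
(* Enlarging the form keeps both collections admissible, and the injectivity of [defines] is applied
   for [Q0]. *)
have EZA : ZA = ZA'.
  apply: (defines_inj hiota qQ0 _ _ dZA); first exact: hatStabQ_mono QQ0 neg0 hZA.
  exact: hatStabQ_mono Q'Q0 neg0' hZA'.
split => //; exists Q0; split => // V.
split; last by rewrite EZA.
  exact: G_mono (GA V).
by rewrite ZZ'; exact: G_mono (GA' V).
Qed.
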